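(* Let $\mathcal{D}$ be a convex domain in $\mathbb{H}$ and let $f$ be polar-analytic on $\mathcal{D}$ except for isolated singularities which are all logarithmic poles. Let $\gamma$ be a positively oriented, closed, regular curve in $\mathcal{D}$ that is the boundary of a convex domain $\operatorname{int}(\gamma)\subset\mathcal{D}$. Suppose that no isolated singularity lies on $\gamma$, while $(r_j,\theta_j)$ for $j=1,\dots,m$ are the isolated singularities lying in $\operatorname{int}(\gamma)$. Then, for $c\in\mathbb{R}$, $$\int_\gamma \bigl(re^{i\theta}\bigr)^{c-1}f(r,\theta)\,e^{i\theta}\,(dr+ir\,d\theta)=2\pi i\sum_{j=1}^m\bigl(\operatorname{res}_cf\bigr)(r_j,\theta_j).$$
   Context: $\mathbb{H}:=\{(r,\theta): r\in\mathbb{R}^+,\ \theta\in\mathbb{R}\}$ with $\mathbb{R}^+=(0,\infty)$, regarded as an open subset of $\mathbb{R}^2$; a domain is a nonempty open connected subset. A function $f$ on an open subset of $\mathbb{H}$ is polar-analytic there if at every point $(r_0,\theta_0)$ of that set the limit $$(D_{\rm pol}f)(r_0,\theta_0):=\lim_{(r,\theta)\to(r_0,\theta_0)}\frac{f(r,\theta)-f(r_0,\theta_0)}{re^{i\theta}-r_0e^{i\theta_0}}$$ exists. For $c\in\mathbb{R}$, $(\widetilde{\Theta}_cf)(r,\theta):=re^{i\theta}(D_{\rm pol}f)(r,\theta)+c f(r,\theta)$, and $\widetilde{\Theta}_c^kf(r,\theta):=\sum_{j=0}^kS_c(k,j)\,r^je^{ij\theta}(D_{\rm pol}^jf)(r,\theta)$,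 where $D_{\rm pol}^j$ is the $j$-fold iterate of $D_{\rm pol}$ and $S_c(k,j)$ are given by $S_c(0,0)=1$, $S_c(k+1,j)=S_c(k,j-1)+(c+j)S_c(k,j)$, $S_c(k,j)=0$ for $j<0$ or $j>k$; equivalently, $\widetilde{\Theta}_c^k$ is the $k$-fold iterate of $\widetilde{\Theta}_c$, with $\widetilde{\Theta}_c^0f=f$. Powers are understood as $(re^{i\theta})^a:=r^ae^{ia\theta}$ for $a\in\mathbb{R}$. Let $(r_0,\theta_0)\in\mathbb{H}$ and let $\mathcal{U}\subset\mathbb{H}$ be an open neighborhood of it. If $f:\mathcal{U}\setminus\{(r_0,\theta_0)\}\to\mathbb{C}$ is polar-analytic, then $(r_0,\theta_0)$ is called an isolated singularity of $f$. It is a logarithmic pole of order $k\in\mathbb{N}=\{1,2,\dots\}$ if there is a polar-analytic $g:\mathcal{U}\to\mathbb{C}$ with $g(r_0,\theta_0)\neq0$ and $$f(r,\theta)=\frac{g(r,\theta)}{\bigl(\log(r/r_0)+i(\theta-\theta_0)\bigr)^k}\quad\text{for }(r,\theta)\in\mathcal{U}\setminus\{(r_0,\theta_0)\}.$$ In this case the $c$-residue of $f$ at $(r_0,\theta_0)$ is $$(\operatorname{res}_cf)(r_0,\theta_0):=\bigl(r_0e^{i\theta_0}\bigr)^c\,\frac{(\widetilde{\Theta}_c^{k-1}g)(r_0,\theta_0)}{(k-1)!}.$$ A closed regular curve is a simple closed piecewise continuously differentiable curve; positively oriented means counterclockwise in the $(r,\theta)$-plane. The integral is the line integral over $\gamma$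 in the $(r,\theta)$-plane. *)

(* Defs.v *)
From Stdlib Require Import Reals Factorial List.
From Coquelicot Require Import Coquelicot.
Open Scope R_scope.

(* Points (r, theta) have type R * R; values of functions have type C. *)
Definition halfplane (p : R * R) : Prop := 0 < fst p.

Definition is_convex (E : R * R -> Prop) : Prop :=
  forall p q : R * R, E p -> E q -> forall s : R, 0 <= s <= 1 ->
    E ((1 - s) * fst p + s * fst q, (1 - s) * snd p + s * snd q).

Definition is_connected (E : R * R -> Prop) : Prop :=
  forall U V : R * R -> Prop, open U -> open V ->
    (forall p, E p -> U p \/ V p) ->
    (exists p, E p /\ U p) -> (exists p, E p /\ V p) ->
    exists p, E p /\ U p /\ V p.

Definition is_domain (E : R * R -> Prop) : Prop :=
  (exists p, E p) /\ open E /\ is_connected E /\ (forall p, E p -> halfplane p).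

Definition boundary (E : R * R -> Prop) (p : R * R) : Prop :=
  forall N : R * R -> Prop, locally p N ->
    (exists q, N q /\ E q) /\ (exists q, N q /\ ~ E q).

Definition cis (t : R) : C := (cos t, sin t).

(* The power (r e^(i theta))^a; it is not a function of the complex number
   r e^(i theta), since theta is not reduced modulo 2 pi. *)
Definition polar_pow (a : R) (p : R * R) : C :=
  (RtoC (Rpower (fst p) a) * cis (a * snd p))%C.

Definition polar_to_C (p : R * R) : C := (RtoC (fst p) * cis (snd p))%C.

Definition is_Dpol (f : R * R -> C) (p : R * R) (l : C) : Prop :=
  filterlim (fun q => (f q - f p) / (polar_to_C q - polar_to_C p))%C
    (locally' p) (locally l).

Definition Dpol (f : R * R -> C) (p : R * R) : C := iota (T := C_R_CompleteNormedModule) (is_Dpol f p).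

(* A function on E is represented by a total function whose values outside E
   are irrelevant; this is harmless because E is open. *)
Definition polar_analytic (E : R * R -> Prop) (f : R * R -> C) : Prop :=
  open E /\ (forall p, E p -> halfplane p) /\
  forall p, E p -> exists l : C, is_Dpol f p l.

Fixpoint Dpol_n (j : nat) (f : R * R -> C) : R * R -> C :=
  match j with
  | O => f
  | S j' => Dpol (Dpol_n j' f)
  end.

Fixpoint stirling (c : R) (k j : nat) : R :=
  match k, j with
  | O, O => 1
  | O, S _ => 0
  | S k', O => (c + INR 0) * stirling c k' 0
  | S k', S j' => stirling c k' j' + (c + INR (S j')) * stirling c k' (S j')
  end.

(* The k-fold iterate of f |-> r e^(i theta) D_pol f + c f, expanded by means of
   the generalized Stirling numbers S_c(k, j). *)
Definition Theta (c : R) (k : nat) (f : R * R -> C) (p : R * R) : C :=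
  sum_n (fun j => RtoC (stirling c k j) * polar_pow (INR j) p * Dpol_n j f p)%C k.

Definition polar_log (p q : R * R) : C :=
  (RtoC (ln (fst q / fst p)) + Ci * RtoC (snd q - snd p))%C.

Definition punctured (U : R * R -> Prop) (p q : R * R) : Prop := U q /\ q <> p.

Definition isolated_singularity (U : R * R -> Prop) (f : R * R -> C) (p : R * R) : Prop :=
  open U /\ U p /\ (forall q, U q -> halfplane q) /\ polar_analytic (punctured U p) f.

Definition log_pole_with (f : R * R -> C) (p : R * R) (k : nat) (g : R * R -> C) : Prop :=
  (1 <= k)%nat /\
  exists U : R * R -> Prop,
    isolated_singularity U f p /\ polar_analytic U g /\ g p <> RtoC 0 /\
    forall q, punctured U p q -> f q = (g q / Cpow (polar_log p q) k)%C.

Definition log_pole (f : R * R -> C) (p : R * R) : Prop :=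
  exists (k : nat) (g : R * R -> C), log_pole_with f p k g.

(* The order k and the germ of g at p are determined by f, so a logarithmic
   pole has exactly one residue. *)
Definition is_residue (c : R) (f : R * R -> C) (p : R * R) (v : C) : Prop :=
  exists (k : nat) (g : R * R -> C), log_pole_with f p k g /\
    v = (polar_pow c p * (Theta c (k - 1) g p / RtoC (INR (fact (k - 1)))))%C.

Definition residue (c : R) (f : R * R -> C) (p : R * R) : C :=
  iota (T := C_R_CompleteNormedModule) (is_residue c f p).

Definition C1_curve (eta : R -> R * R) : Prop :=
  forall t : R,
    ex_derive (fun s => fst (eta s)) t /\ ex_derive (fun s => snd (eta s)) t /\
    continuous (Derive (fun s => fst (eta s))) t /\
    continuous (Derive (fun s => snd (eta s))) t.

(* Being C1 on a compact interval, with one-sided derivatives at its ends, is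
   expressed as agreeing there with a C1 curve on the whole line.  Consecutive
   closed pieces share an endpoint, so gamma is continuous on [a, b]. *)
Definition piecewise_C1 (gamma : R -> R * R) (a b : R) : Prop :=
  exists (n : nat) (x : nat -> R),
    x 0%nat = a /\ x n = b /\
    forall i : nat, (i < n)%nat ->
      x i < x (S i) /\
      exists eta : R -> R * R, C1_curve eta /\
        forall t, x i <= t <= x (S i) -> gamma t = eta t.

Definition closed_regular_curve (gamma : R -> R * R) (a b : R) : Prop :=
  a < b /\ piecewise_C1 gamma a b /\ gamma a = gamma b /\
  forall s t : R, a <= s < b -> a <= t < b -> gamma s = gamma t -> s = t.

Definition trace (gamma : R -> R * R) (a b : R) (p : R * R) : Prop :=
  exists t : R, a <= t <= b /\ gamma t = p.

(* Seen from any enclosed point p, the polar angle phi (in the Cartesian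
   (r, theta)-plane) of the moving point has a positive total change. *)
Definition counterclockwise (gamma : R -> R * R) (a b : R) (Om : R * R -> Prop) : Prop :=
  forall p, Om p ->
    exists phi : R -> R,
      (forall t, a <= t <= b -> continuous phi t) /\
      (forall t, a <= t <= b ->
         exists rho : R, 0 < rho /\
           gamma t = (fst p + rho * cos (phi t), snd p + rho * sin (phi t))) /\
      phi a < phi b.

(* v is the line integral of h(r, theta) e^(i theta) (dr + i r dtheta) along
   gamma; the finitely many parameters where gamma is not differentiable do not
   affect it. *)
Definition is_polar_integral (h : R * R -> C) (gamma : R -> R * R) (a b : R) (v : C) : Prop :=
  is_RInt (V := C_R_NormedModule)
    (fun t =>
       h (gamma t) * cis (snd (gamma t)) *
       (RtoC (Derive (fun s => fst (gamma s)) t) +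
        Ci * RtoC (fst (gamma t)) * RtoC (Derive (fun s => snd (gamma s)) t)))%C
    a b v.

(* Main.v *)
(* With [z = log r + i theta], polar-analytic functions of [(r, theta)] are the holomorphic
   functions of [z], the form [(r e^(i theta))^(c-1) f e^(i theta) (dr + i r dtheta)] becomes
   [e^(c z) f dz], a logarithmic pole becomes an ordinary pole, and [Theta_c^n g] is
   [e^(-c z)] times the [n]-th derivative of [e^(c z) g].  Convexity in the [(r, theta)]-plane
   is not preserved, so Goursat's bisection is run on the parameter rectangle of a homotopy
   rather than on triangles.  Shrinking a circle to a point gives the Cauchy formula, hence
   the regularity of derivatives and of divided differences, and so the principal parts at
   the poles; shrinking [gamma] to a point of the convex interior gives the Cauchy theorem
   for what is left.  For the winding number, a ray from an interior point of a convex set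
   meets the boundary once, so a positive total change of the angle can only be [2 PI]. *)
Require Import Defs.
From Stdlib Require Import Reals Ranalysis5 Factorial List Lra Lia Psatz Classical ClassicalEpsilon.
From Coquelicot Require Import Coquelicot.
Open Scope R_scope.

(** * Complex derivatives *)

(** Polar analyticity provides a derivative at each point and says nothing about its continuity, so
    Green's formula is out of reach and every comparison of two contours has to go through
    [homotopy_goursat].

    Two mismatches between the planes shape the rest. Segments from an interior point to [gamma]
    stay in the region when drawn in the [(r, theta)]-plane, while segments drawn in the chart might
    leave it; the homotopy therefore consists of logarithmic images of the former. And the
    orientation is given by an angle in the [(r, theta)]-plane, while [dz / z] measures an angle in
    the chart. Since [ln] is increasing, the vector from a pole to the moving point and its image in
    the chart are always less than a quarter turn apart, so both angles have the same total change
    along a closed curve.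

    Residues and polar derivatives are defined by [iota], which means something only for a unique
    value; uniqueness of both is obtained in the chart. *)

Definition cderiv (F : C -> C) (z l : C) : Prop :=
  forall eps : R, 0 < eps -> exists d : R, 0 < d /\
    forall w : C, Cmod (w - z) < d ->
      Cmod (F w - F z - l * (w - z)) <= eps * Cmod (w - z).

Definition cdiff (F : C -> C) (z : C) : Prop := exists l : C, cderiv F z l.

(** The estimates below need explicit radii; this equivalence still gives access to the general sum,
    product and chain rules. *)
Lemma cderiv_is_derive (F : C -> C) (z l : C) :
  cderiv F z l <->
  @is_derive C_AbsRing (AbsRing_NormedModule C_AbsRing) F z l.
Proof.
split.
- intros H; split; [apply is_linear_scal_l|].
  intros x Hx.
  assert (Hxz : z = x).
  { apply (is_filter_lim_locally_unique (V := AbsRing_NormedModule C_AbsRing)), Hx. }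
  subst x; intros eps; destruct (H eps (cond_pos eps)) as [d [Hd Hw]].
  exists (mkposreal d Hd); intros w Hb.
  change (Cmod (F w - F z - (w - z) * l) <= eps * Cmod (w - z)).
  rewrite (Cmult_comm (w - z)); apply Hw, Hb.
- intros [_ H] eps Heps.
  destruct (H z (fun P HP => HP) (mkposreal eps Heps)) as [d Hd].
  exists d; split; [apply cond_pos|]; intros w Hw.
  specialize (Hd w Hw).
  change (Cmod (F w - F z - (w - z) * l) <= eps * Cmod (w - z)) in Hd.
  now rewrite (Cmult_comm l).
Qed.

Lemma cderiv_eq (F : C -> C) (z l m : C) : cderiv F z l -> l = m -> cderiv F z m.
Proof. now intros H <-. Qed.

Lemma cderiv_const (a z : C) : cderiv (fun _ => a) z 0.
Proof.
intros eps Heps; exists 1; split; [lra|]; intros w _.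
replace (a - a - 0 * (w - z))%C with (RtoC 0) by ring.
rewrite Cmod_0; apply Rmult_le_pos; [lra|apply Cmod_ge_0].
Qed.

Lemma cderiv_id (z : C) : cderiv (fun w => w) z 1.
Proof.
intros eps Heps; exists 1; split; [lra|]; intros w _.
replace (w - z - 1 * (w - z))%C with (RtoC 0) by ring.
rewrite Cmod_0; apply Rmult_le_pos; [lra|apply Cmod_ge_0].
Qed.

Lemma cderiv_plus (F G : C -> C) (z l m : C) :
  cderiv F z l -> cderiv G z m -> cderiv (fun w => F w + G w)%C z (l + m).
Proof.
intros HF%cderiv_is_derive HG%cderiv_is_derive.
now apply cderiv_is_derive, (is_derive_plus (V := AbsRing_NormedModule C_AbsRing)).
Qed.

Lemma cderiv_mult (F G : C -> C) (z l m : C) :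
  cderiv F z l -> cderiv G z m ->
  cderiv (fun w => F w * G w)%C z (l * G z + F z * m).
Proof.
intros HF%cderiv_is_derive HG%cderiv_is_derive.
apply cderiv_is_derive, (is_derive_mult (K := C_AbsRing)); trivial.
intros; apply Cmult_comm.
Qed.

Lemma cderiv_ext (F G : C -> C) (z l : C) (d : R) :
  0 < d -> (forall w, Cmod (w - z) < d -> F w = G w) -> cderiv F z l -> cderiv G z l.
Proof.
intros Hd Heq HF eps Heps; destruct (HF eps Heps) as [d' [Hd' Hw]].
exists (Rmin d d'); split; [now apply Rmin_glb_lt|]; intros w Hwz.
rewrite <- !Heq.
- apply Hw; eapply Rlt_le_trans; [exact Hwz|apply Rmin_r].
- replace (z - z)%C with (RtoC 0) by ring; now rewrite Cmod_0.
- eapply Rlt_le_trans; [exact Hwz|apply Rmin_l].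
Qed.

Lemma cdiff_ext (F G : C -> C) (z : C) (d : R) :
  0 < d -> (forall w, Cmod (w - z) < d -> F w = G w) -> cdiff F z -> cdiff G z.
Proof. intros Hd Heq [l Hl]; exists l; now apply (cderiv_ext F G z l d). Qed.

Lemma cderiv_cont (F : C -> C) (z l : C) : cderiv F z l ->
  forall eps, 0 < eps -> exists d, 0 < d /\
    forall w, Cmod (w - z) < d -> Cmod (F w - F z) < eps.
Proof.
intros HF eps Heps; destruct (HF 1 Rlt_0_1) as [d [Hd Hw]].
assert (Hl := Cmod_ge_0 l).
exists (Rmin d (eps / (2 + Cmod l))); split.
{ apply Rmin_glb_lt; [trivial|apply Rdiv_lt_0_compat; lra]. }
intros w Hwz.
assert (H1 : Cmod (w - z) < d) by (eapply Rlt_le_trans; [exact Hwz|apply Rmin_l]).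
assert (H2 : Cmod (w - z) < eps / (2 + Cmod l)) by (eapply Rlt_le_trans; [exact Hwz|apply Rmin_r]).
replace (F w - F z)%C with ((F w - F z - l * (w - z)) + l * (w - z))%C by ring.
eapply Rle_lt_trans; [apply Cmod_triangle|].
specialize (Hw w H1); rewrite Cmod_mult.
assert (H3 := Cmod_ge_0 (w - z)).
assert (H4 : Cmod (w - z) * (2 + Cmod l) < eps).
{ apply Rmult_lt_reg_r with (/ (2 + Cmod l)); [apply Rinv_0_lt_compat; lra|].
  rewrite Rmult_assoc, Rinv_r, Rmult_1_r by lra; exact H2. }
nra.
Qed.

Lemma cderiv_inv_id (z : C) : z <> 0 -> cderiv Cinv z (- (/ z * / z)).
Proof.
intros Hz eps Heps.
assert (Hm : 0 < Cmod z) by now apply Cmod_gt_0.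
set (m := Cmod z) in *.
assert (Hm3 : 0 < m * m * m) by (repeat apply Rmult_lt_0_compat; trivial).
(* The first radius keeps [|w| > m / 2], so that the remainder [(w - z)^2 / (w z^2)] is at most
   [2 |w - z|^2 / m^3]; the second turns one factor [|w - z|] into [eps]. *)
exists (Rmin (m / 2) (eps * (m * m * m) / 2)); split.
{ apply Rmin_glb_lt; [lra|]. apply Rdiv_lt_0_compat; [now apply Rmult_lt_0_compat|lra]. }
intros w Hw.
assert (H1 : Cmod (w - z) < m / 2) by (eapply Rlt_le_trans; [exact Hw|apply Rmin_l]).
assert (H2 : Cmod (w - z) < eps * (m * m * m) / 2) by (eapply Rlt_le_trans; [exact Hw|apply Rmin_r]).
assert (Hwm : m / 2 < Cmod w).
{ assert (H := Cmod_triangle w (- (w - z))).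
  replace (w + - (w - z))%C with z in H by ring; rewrite Cmod_opp in H; fold m in H; lra. }
assert (Hw0 : w <> 0) by (apply Cmod_gt_0; lra).
replace (/ w - / z - - (/ z * / z) * (w - z))%C with ((w - z) * (w - z) * (/ w * / z * / z))%C
  by (field; auto).
rewrite !Cmod_mult, !Cmod_inv by trivial; fold m.
assert (H3 := Cmod_ge_0 (w - z)).
assert (Hi : / Cmod w <= / (m / 2)) by (apply Rinv_le_contravar; lra).
assert (Hi' : / Cmod w * / m * / m <= 2 / (m * m * m)).
{ replace (2 / (m * m * m)) with (/ (m / 2) * / m * / m) by (field; lra).
  assert (0 < / m) by (now apply Rinv_0_lt_compat).
  apply Rmult_le_compat_r; [lra|]; apply Rmult_le_compat_r; [lra|exact Hi]. }
assert (Hp : 0 < 2 / (m * m * m)) by (apply Rdiv_lt_0_compat; lra).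
assert (Cmod (w - z) * (2 / (m * m * m)) <= eps).
{ replace eps with (eps * (m * m * m) / 2 * (2 / (m * m * m))) by (field; lra).
  apply Rmult_le_compat_r; lra. }
assert (0 <= / Cmod w * / m * / m).
{ repeat apply Rmult_le_pos; left; apply Rinv_0_lt_compat; lra. }
rewrite Rmult_assoc, (Rmult_comm eps).
apply Rmult_le_compat_l; [trivial|].
apply Rle_trans with (Cmod (w - z) * (2 / (m * m * m))); [|trivial].
apply Rmult_le_compat_l; trivial.
Qed.

Lemma cderiv_comp (F G : C -> C) (z l m : C) :
  cderiv F (G z) l -> cderiv G z m -> cderiv (fun w => F (G w)) z (l * m).
Proof.
intros HF%cderiv_is_derive HG%cderiv_is_derive.
apply cderiv_is_derive; rewrite Cmult_comm.
exact (is_derive_comp (K := C_AbsRing) (V := AbsRing_NormedModule C_AbsRing) F G z l m HF HG).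
Qed.

Lemma cderiv_inv (G : C -> C) (z m : C) :
  G z <> 0 -> cderiv G z m -> cderiv (fun w => / G w)%C z (- (/ G z * / G z) * m).
Proof. intros H HG; apply (cderiv_comp Cinv G); trivial; now apply cderiv_inv_id. Qed.

Lemma cderiv_unique (F : C -> C) (z l m : C) : cderiv F z l -> cderiv F z m -> l = m.
Proof.
intros HF HG; apply NNPP; intros Hne.
assert (Hp : 0 < Cmod (l - m)).
{ apply Cmod_gt_0; intros H; apply Hne; replace l with (l - m + m)%C by ring; rewrite H; ring. }
destruct (HF (Cmod (l - m) / 3)) as [d1 [Hd1 H1]]; [lra|].
destruct (HG (Cmod (l - m) / 3)) as [d2 [Hd2 H2]]; [lra|].
pose (h := Rmin d1 d2 / 2).
assert (Hm1 := Rmin_l d1 d2); assert (Hm2 := Rmin_r d1 d2).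
assert (Hh : 0 < h) by (unfold h; assert (0 < Rmin d1 d2) by (now apply Rmin_glb_lt); lra).
assert (Ch : Cmod ((z + RtoC h) - z) = h).
{ replace (z + RtoC h - z)%C with (RtoC h) by ring; rewrite Cmod_R; apply Rabs_pos_eq; lra. }
specialize (H1 (z + RtoC h)%C); specialize (H2 (z + RtoC h)%C); rewrite Ch in H1, H2.
assert (H1' : Cmod (F (z + h)%C - F z - l * (z + h - z)) <= Cmod (l - m) / 3 * h)
  by (apply H1; unfold h; lra).
assert (H2' : Cmod (F (z + h)%C - F z - m * (z + h - z)) <= Cmod (l - m) / 3 * h)
  by (apply H2; unfold h; lra).
assert (H3 := Cmod_triangle (F (z + h)%C - F z - m * (z + h - z)) (- (F (z + h)%C - F z - l * (z + h - z)))).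
rewrite Cmod_opp in H3.
replace (F (z + h)%C - F z - m * (z + h - z) + - (F (z + h)%C - F z - l * (z + h - z)))%C
  with ((l - m) * RtoC h)%C in H3 by ring.
rewrite Cmod_mult, Cmod_R, (Rabs_pos_eq h) in H3 by lra.
nra.
Qed.

(** * Complex-valued functions of a real variable *)

Definition rderiv (f : R -> C) (t : R) (l : C) : Prop :=
  is_derive (V := C_R_NormedModule) f t l.

Definition rcont (f : R -> C) (t : R) : Prop :=
  continuous (T := R_UniformSpace) (U := C_UniformSpace) f t.

Definition cint (f : R -> C) (a b : R) (v : C) : Prop :=
  is_RInt (V := C_R_NormedModule) f a b v.

Lemma rcont_pair (f : R -> C) (t : R) :
  continuous (fun x => fst (f x)) t -> continuous (fun x => snd (f x)) t -> rcont f t.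
Proof.
intros H1 H2.
apply (continuous_ext (T := R_UniformSpace) (U := C_UniformSpace) (fun x => (fst (f x), snd (f x)))).
{ intros x; symmetry; apply surjective_pairing. }
apply (continuous_comp_2 (W := R_UniformSpace) (V := R_UniformSpace) (X := C_UniformSpace)
  (fun x => fst (f x)) (fun x => snd (f x)) (fun x y => (x, y))); trivial.
apply (continuous_ext (T := C_UniformSpace) (U := C_UniformSpace) (fun p => p)).
{ intros p; apply surjective_pairing. }
apply continuous_id.
Qed.

Lemma rcont_fst (f : R -> C) (t : R) : rcont f t -> continuous (fun x => fst (f x)) t.
Proof.
intros H; apply (continuous_comp (V := C_UniformSpace) f fst); trivial.
rewrite (surjective_pairing (f t)); apply continuous_fst.
Qed.

Lemma rcont_snd (f : R -> C) (t : R) : rcont f t -> continuous (fun x => snd (f x)) t.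
Proof.
intros H; apply (continuous_comp (V := C_UniformSpace) f snd); trivial.
rewrite (surjective_pairing (f t)); apply continuous_snd.
Qed.

Lemma rcont_const (k : C) (t : R) : rcont (fun _ => k) t.
Proof. apply continuous_const. Qed.

Lemma rcont_plus (f g : R -> C) (t : R) :
  rcont f t -> rcont g t -> rcont (fun x => f x + g x)%C t.
Proof.
intros Hf Hg; apply rcont_pair; simpl;
  apply (continuous_plus (V := R_NormedModule)); first [now apply rcont_fst|now apply rcont_snd].
Qed.

Lemma rcont_mult (f g : R -> C) (t : R) :
  rcont f t -> rcont g t -> rcont (fun x => f x * g x)%C t.
Proof.
intros Hf Hg; apply rcont_pair; simpl;
  [apply (continuous_minus (V := R_NormedModule))|apply (continuous_plus (V := R_NormedModule))];
  apply (continuous_mult (K := R_AbsRing)); first [now apply rcont_fst|now apply rcont_snd].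
Qed.

Lemma rcont_eps (f : R -> C) (t : R) :
  rcont f t <-> forall eps, 0 < eps -> exists d, 0 < d /\
    forall x, Rabs (x - t) < d -> Cmod (f x - f t) < eps.
Proof.
split.
- intros H eps Heps.
  assert (L : locally (T := C_UniformSpace) (f t) (fun z => Cmod (z - f t) < eps)).
  { apply locally_C; exists (mkposreal eps Heps); intros y Hy; exact Hy. }
  destruct (H _ L) as [d Hd]; exists d; split; [apply cond_pos|].
  intros x Hx; exact (Hd x Hx).
- intros H P HP; apply locally_C in HP; destruct HP as [e He].
  destruct (H e (cond_pos e)) as [d [Hd Hx]].
  exists (mkposreal d Hd); intros x Hb; apply He, Hx, Hb.
Qed.

Lemma rcont_cdiff (F : C -> C) (f : R -> C) (t : R) :
  cdiff F (f t) -> rcont f t -> rcont (fun x => F (f x)) t.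
Proof.
intros [l Hl] Hf; apply rcont_eps; intros eps Heps.
destruct (cderiv_cont _ _ _ Hl eps Heps) as [d [Hd H]].
destruct (proj1 (rcont_eps f t) Hf d Hd) as [d' [Hd' H']].
exists d'; split; trivial; intros x Hx; apply H, H', Hx.
Qed.

Lemma rcont_inv (f : R -> C) (t : R) : f t <> 0 -> rcont f t -> rcont (fun x => / f x)%C t.
Proof.
intros Hn Hf; apply (rcont_cdiff Cinv); trivial; eexists; now apply cderiv_inv_id.
Qed.

Lemma rderiv_pair (f : R -> C) (t : R) (l : C) :
  is_derive (fun x => fst (f x)) t (fst l) -> is_derive (fun x => snd (f x)) t (snd l) ->
  rderiv f t l.
Proof.
intros H1 H2; unfold rderiv.
apply (is_derive_ext (V := C_R_NormedModule) (fun x => (fst (f x), snd (f x)))).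
{ intros x; symmetry; apply surjective_pairing. }
rewrite (surjective_pairing l).
split; [apply (is_linear_scal_l (V := C_R_NormedModule))|].
intros x Hx; assert (E := is_filter_lim_locally_unique _ _ Hx); subst x.
clear Hx; intros eps.
destruct H1 as [_ H1]; destruct H2 as [_ H2].
assert (Hp : 0 < eps / 2). { assert (P := cond_pos eps); lra. }
destruct (H1 t (fun P HP => HP) (mkposreal _ Hp)) as [d1 Hd1].
destruct (H2 t (fun P HP => HP) (mkposreal _ Hp)) as [d2 Hd2].
assert (Hm : 0 < Rmin d1 d2) by (apply Rmin_glb_lt; apply cond_pos).
exists (mkposreal _ Hm); intros y Hy.
assert (Y1 : ball t d1 y) by (eapply Rlt_le_trans; [exact Hy|apply Rmin_l]).
assert (Y2 : ball t d2 y) by (eapply Rlt_le_trans; [exact Hy|apply Rmin_r]).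
specialize (Hd1 y Y1); specialize (Hd2 y Y2); simpl in Hd1, Hd2.
match goal with |- norm ?x <= _ => change (@norm R_AbsRing C_R_NormedModule x)
  with (@norm R_AbsRing (prod_NormedModule R_AbsRing R_NormedModule R_NormedModule) x);
  rewrite <- (Cmod_norm x) end.
match goal with |- Cmod ?x <= _ => eapply Rle_trans; [apply (Cmod_2Rmax x)|] end.
assert (Hs : sqrt 2 <= 2).
{ rewrite <- (sqrt_Rsqr 2) at 2 by lra; apply sqrt_le_1; unfold Rsqr; lra. }
apply Rle_trans with (2 * (eps / 2 * norm (minus y t))); [|right; change (2 * (eps / 2 * norm (minus y t)) = eps * norm (minus y t)); field].
assert (Hmx : 0 <= eps / 2 * norm (minus y t)).
{ apply Rmult_le_pos; [lra|apply norm_ge_0]. }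
match goal with |- sqrt 2 * ?m <= _ => assert (0 <= m) end.
{ eapply Rle_trans; [apply Rabs_pos|apply Rmax_l]. }
apply Rmult_le_compat; trivial; [apply sqrt_pos|].
apply Rmax_lub; [exact Hd1|exact Hd2].
Qed.

Lemma rderiv_components (f : R -> C) (t : R) (l : C) : rderiv f t l ->
  is_derive (fun x => fst (f x)) t (fst l) /\ is_derive (fun x => snd (f x)) t (snd l).
Proof.
intros [_ H]; split; (split; [apply (is_linear_scal_l (V := R_NormedModule))|]);
  intros x Hx; assert (E := is_filter_lim_locally_unique _ _ Hx); subst x;
  clear Hx; intros eps; destruct (H t (fun P HP => HP) eps) as [d Hd]; exists d;
  intros y Hy; specialize (Hd y Hy);
  match type of Hd with norm ?x <= _ => change (@norm R_AbsRing C_R_NormedModule x)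
    with (@norm R_AbsRing (prod_NormedModule R_AbsRing R_NormedModule R_NormedModule) x) in Hd;
    rewrite <- (Cmod_norm x) in Hd; assert (Hr := Rmax_Cmod x) end;
  (eapply Rle_trans; [|exact Hd]); (eapply Rle_trans; [|exact Hr]).
- apply Rmax_l.
- apply Rmax_r.
Qed.

Lemma rderiv_const (k : C) (t : R) : rderiv (fun _ => k) t 0.
Proof. apply rderiv_pair; apply (is_derive_const (V := R_NormedModule)). Qed.

Lemma rderiv_plus (f g : R -> C) (t : R) (l m : C) :
  rderiv f t l -> rderiv g t m -> rderiv (fun x => f x + g x)%C t (l + m).
Proof. apply (is_derive_plus (V := C_R_NormedModule)). Qed.

Lemma rderiv_cont (f : R -> C) (t : R) (l : C) : rderiv f t l -> rcont f t.
Proof.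
intros H; apply (ex_derive_continuous (V := C_R_NormedModule)); now exists l.
Qed.

Lemma rderiv_eps (f : R -> C) (t : R) (l : C) :
  rderiv f t l <-> forall eps, 0 < eps -> exists d, 0 < d /\
    forall x, Rabs (x - t) < d -> Cmod (f x - f t - l * RtoC (x - t)) <= eps * Rabs (x - t).
Proof.
assert (E : forall x, norm (minus (minus (f x) (f t)) (scal (minus x t) l) : C_R_NormedModule)
  = Cmod (f x - f t - l * RtoC (x - t))).
{ intros x.
  match goal with |- norm ?y = _ => change (@norm R_AbsRing C_R_NormedModule y)
    with (@norm R_AbsRing (prod_NormedModule R_AbsRing R_NormedModule R_NormedModule) y);
    rewrite <- (Cmod_norm y) end.
  f_equal; unfold minus, plus, opp, scal; simpl.
  unfold Cminus, Cplus, Copp, Cmult, RtoC; simpl.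
  unfold prod_plus, prod_opp, prod_scal, plus, opp, scal; simpl; unfold mult; simpl.
  apply injective_projections; simpl; ring. }
split.
- intros [_ H] eps Heps; destruct (H t (fun P HP => HP) (mkposreal eps Heps)) as [d Hd].
  exists d; split; [apply cond_pos|]; intros x Hx; specialize (Hd x Hx).
  rewrite <- E; exact Hd.
- intros H; split; [apply (is_linear_scal_l (V := C_R_NormedModule))|].
  intros x Hx; assert (E' := is_filter_lim_locally_unique _ _ Hx); subst x; clear Hx.
  intros eps; destruct (H eps (cond_pos eps)) as [d [Hd Hx]].
  exists (mkposreal d Hd); intros x Hb; specialize (Hx x Hb); rewrite <- E in Hx; exact Hx.
Qed.

Lemma rderiv_comp (F : C -> C) (f : R -> C) (t : R) (l m : C) :
  cderiv F (f t) l -> rderiv f t m -> rderiv (fun x => F (f x)) t (l * m).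
Proof.
intros HF Hf; apply rderiv_eps; intros eps Heps.
assert (Hl := Cmod_ge_0 l); assert (Hm := Cmod_ge_0 m).
destruct (HF (eps / 2 / (1 + Cmod m))) as [d1 [Hd1 H1]].
{ apply Rdiv_lt_0_compat; lra. }
(* The bound 1 makes [f] Lipschitz at [t] with constant [1 + Cmod m], which controls the remainder
   of [F]; the other bound pays for the remainder of [f] after multiplication by [l]. *)
destruct (proj1 (rderiv_eps f t m) Hf (Rmin 1 (eps / 2 / (1 + Cmod l)))) as [d2 [Hd2 H2]].
{ apply Rmin_glb_lt; [lra|]; apply Rdiv_lt_0_compat; lra. }
destruct (proj1 (rcont_eps f t) (rderiv_cont _ _ _ Hf) d1 Hd1) as [d3 [Hd3 H3]].
exists (Rmin d2 d3); split; [now apply Rmin_glb_lt|]; intros x Hx.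
assert (X2 : Rabs (x - t) < d2) by (eapply Rlt_le_trans; [exact Hx|apply Rmin_l]).
assert (X3 : Rabs (x - t) < d3) by (eapply Rlt_le_trans; [exact Hx|apply Rmin_r]).
specialize (H3 x X3); specialize (H2 x X2); specialize (H1 _ H3).
assert (Hx0 := Rabs_pos (x - t)).
assert (H2a : Cmod (f x - f t - m * RtoC (x - t)) <= 1 * Rabs (x - t)).
{ eapply Rle_trans; [exact H2|]; apply Rmult_le_compat_r; [trivial|apply Rmin_l]. }
assert (H2b : Cmod (f x - f t - m * RtoC (x - t)) <= eps / 2 / (1 + Cmod l) * Rabs (x - t)).
{ eapply Rle_trans; [exact H2|]; apply Rmult_le_compat_r; [trivial|apply Rmin_r]. }
assert (H4 : Cmod (f x - f t) <= (1 + Cmod m) * Rabs (x - t)).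
{ replace (f x - f t)%C with ((f x - f t - m * RtoC (x - t)) + m * RtoC (x - t))%C by ring.
  eapply Rle_trans; [apply Cmod_triangle|]; rewrite Cmod_mult, Cmod_R; lra. }
replace (F (f x) - F (f t) - l * m * RtoC (x - t))%C with
  ((F (f x) - F (f t) - l * (f x - f t)) + l * (f x - f t - m * RtoC (x - t)))%C by ring.
eapply Rle_trans; [apply Cmod_triangle|]; rewrite Cmod_mult.
apply Rle_trans with (eps / 2 / (1 + Cmod m) * ((1 + Cmod m) * Rabs (x - t))
  + (1 + Cmod l) * (eps / 2 / (1 + Cmod l) * Rabs (x - t))).
- apply Rplus_le_compat.
  + eapply Rle_trans; [exact H1|]; apply Rmult_le_compat_l; [|exact H4].
    left; apply Rdiv_lt_0_compat; lra.
  + apply Rmult_le_compat; trivial; [apply Cmod_ge_0|lra].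
- right; field; lra.
Qed.

Lemma cint_pair (f : R -> C) (a b : R) (v : C) :
  is_RInt (fun t => fst (f t)) a b (fst v) -> is_RInt (fun t => snd (f t)) a b (snd v) ->
  cint f a b v.
Proof.
intros; unfold cint; rewrite (surjective_pairing v).
now apply (is_RInt_fct_extend_pair (U := R_NormedModule) (V := R_NormedModule)).
Qed.

Lemma cint_fst (f : R -> C) (a b : R) (v : C) :
  cint f a b v -> is_RInt (fun t => fst (f t)) a b (fst v).
Proof. apply (is_RInt_fct_extend_fst (U := R_NormedModule) (V := R_NormedModule)). Qed.

Lemma cint_snd (f : R -> C) (a b : R) (v : C) :
  cint f a b v -> is_RInt (fun t => snd (f t)) a b (snd v).
Proof. apply (is_RInt_fct_extend_snd (U := R_NormedModule) (V := R_NormedModule)). Qed.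

Lemma cint_mult_l (k : C) (f : R -> C) (a b : R) (v : C) :
  cint f a b v -> cint (fun t => k * f t)%C a b (k * v).
Proof.
intros H; assert (H1 := cint_fst _ _ _ _ H); assert (H2 := cint_snd _ _ _ _ H).
apply cint_pair; simpl.
- apply (is_RInt_minus (V := R_NormedModule)); now apply (is_RInt_scal (V := R_NormedModule)).
- apply (is_RInt_plus (V := R_NormedModule)); now apply (is_RInt_scal (V := R_NormedModule)).
Qed.

Lemma cint_plus (f g : R -> C) (a b : R) (u v : C) :
  cint f a b u -> cint g a b v -> cint (fun t => f t + g t)%C a b (u + v).
Proof. apply (is_RInt_plus (V := C_R_NormedModule)). Qed.

Lemma cint_minus (f g : R -> C) (a b : R) (u v : C) :
  cint f a b u -> cint g a b v -> cint (fun t => f t - g t)%C a b (u - v).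
Proof. apply (is_RInt_minus (V := C_R_NormedModule)). Qed.

Lemma cint_ext (f g : R -> C) (a b : R) (v : C) : a <= b ->
  (forall t, a < t < b -> f t = g t) -> cint f a b v -> cint g a b v.
Proof.
intros Hab He; apply (is_RInt_ext (V := C_R_NormedModule)).
rewrite Rmin_left, Rmax_right by trivial; exact He.
Qed.

Lemma cint_Chasles (f : R -> C) (a b c : R) (u v : C) :
  cint f a b u -> cint f b c v -> cint f a c (u + v).
Proof. apply (is_RInt_Chasles (V := C_R_NormedModule)). Qed.

Lemma cint_exists (f : R -> C) (a b : R) : a <= b ->
  (forall t, a <= t <= b -> rcont f t) -> exists v, cint f a b v.
Proof.
intros Hab H; apply (ex_RInt_continuous (V := C_R_CompleteNormedModule)).
rewrite Rmin_left, Rmax_right by trivial; exact H.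
Qed.

Lemma cint_bound (f : R -> C) (a b : R) (v : C) (M : R) : a <= b ->
  (forall t, a <= t <= b -> Cmod (f t) <= M) -> cint f a b v -> Cmod v <= M * (b - a).
Proof.
intros Hab HM Hv; rewrite Cmod_norm, Rmult_comm.
apply (norm_RInt_le (V := C_R_NormedModule) f (fun _ => M) a b v); trivial.
- intros t Ht; specialize (HM t Ht); rewrite Cmod_norm in HM; exact HM.
- apply (is_RInt_const (V := R_NormedModule)).
Qed.

Lemma cint_rderiv (f df : R -> C) (a b : R) : a <= b ->
  (forall t, a <= t <= b -> rderiv f t (df t)) ->
  (forall t, a <= t <= b -> rcont df t) -> cint df a b (f b - f a).
Proof.
intros Hab H1 H2.
apply (is_RInt_derive (V := C_R_CompleteNormedModule) f df);
  rewrite Rmin_left, Rmax_right by trivial; trivial.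
Qed.

(** * Goursat's lemma for homotopies *)

Definition cI (f : R -> C) (a b : R) : C := RInt (V := C_R_CompleteNormedModule) f a b.

Lemma cI_correct (f : R -> C) (a b : R) : a <= b ->
  (forall t, a <= t <= b -> rcont f t) -> cint f a b (cI f a b).
Proof.
intros Hab H; apply (RInt_correct (V := C_R_CompleteNormedModule)).
destruct (cint_exists f a b Hab H) as [v Hv]; now exists v.
Qed.

Lemma cI_unique (f : R -> C) (a b : R) (v : C) : cint f a b v -> cI f a b = v.
Proof. apply (is_RInt_unique (V := C_R_CompleteNormedModule)). Qed.

Lemma cI_ext (f g : R -> C) (a b : R) : (forall t, f t = g t) -> cI f a b = cI g a b.
Proof. intros H; apply (RInt_ext (V := C_R_CompleteNormedModule)); intros t _; apply H. Qed.

Lemma cI_Chasles (f : R -> C) (a b c : R) : a <= b <= c ->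
  (forall t, a <= t <= c -> rcont f t) -> (cI f a b + cI f b c)%C = cI f a c.
Proof.
intros Hab H; symmetry; apply cI_unique, cint_Chasles with b; apply cI_correct;
  try lra; intros; apply H; lra.
Qed.

Lemma half_power_small (K d : R) : 0 < d -> exists N : nat, forall n : nat,
  (N <= n)%nat -> K / 2 ^ n < d.
Proof.
intros Hd; destruct (pow_lt_1_zero (1 / 2)) with (y := d / (1 + Rabs K)) as [N HN].
- rewrite Rabs_pos_eq; lra.
- apply Rdiv_lt_0_compat; [trivial|assert (H := Rabs_pos K); lra].
- exists N; intros n Hn; specialize (HN n Hn).
  assert (H := Rabs_pos K); assert (H' := Rle_abs K).
  unfold Rdiv at 1 in HN; rewrite Rmult_1_l, pow_inv in HN.
  assert (Hp : 0 < / 2 ^ n) by (apply Rinv_0_lt_compat, pow_lt; lra).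
  rewrite Rabs_pos_eq in HN by lra.
  assert (Hq : / 2 ^ n * (1 + Rabs K) < d).
  { apply Rmult_lt_reg_r with (/ (1 + Rabs K)); [apply Rinv_0_lt_compat; lra|].
    rewrite Rmult_assoc, Rinv_r, Rmult_1_r by lra; exact HN. }
  unfold Rdiv; nra.
Qed.

(** The left ends increase and the right ends decrease, so the supremum of the left ends lies in
    every interval. *)
Lemma nested_halves (u : nat -> R) (A : R) : 0 <= A ->
  (forall n, u (S n) = u n \/ u (S n) = u n + A / 2 ^ S n) ->
  exists x, forall n, u n <= x <= u n + A / 2 ^ n.
Proof.
intros HA H.
assert (Hh : forall n, A / 2 ^ S n = A / 2 ^ n / 2).
{ intros n; simpl; field; apply pow_nonzero; lra. }
assert (Hp : forall n, 0 <= A / 2 ^ n).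
{ intros n; apply Rdiv_le_0_compat; [trivial|apply pow_lt; lra]. }
assert (Hmono : forall n k, u n <= u (n + k)%nat /\ u (n + k)%nat + A / 2 ^ (n + k) <= u n + A / 2 ^ n).
{ intros n k; induction k as [|k IH]; [rewrite Nat.add_0_r; lra|].
  rewrite Nat.add_succ_r, Hh; specialize (Hp (n + k)%nat).
  destruct (H (n + k)%nat) as [E|E]; rewrite ?Hh in E; lra. }
destruct (completeness (fun y => exists n, y = u n)) as [x [Hub Hlub]].
- exists (u 0%nat + A / 2 ^ 0); intros y [n ->].
  destruct (Hmono 0%nat n) as [_ H1]; change (0 + n)%nat with n in H1; specialize (Hp n); lra.
- now exists (u 0%nat), 0%nat.
- exists x; intros n; split; [apply Hub; now exists n|].
  apply Hlub; intros y [m ->].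
  destruct (Nat.le_ge_cases n m) as [Hl|Hl].
  + replace m with (n + (m - n))%nat by lia.
    destruct (Hmono n (m - n)%nat) as [_ H1]; specialize (Hp (n + (m - n))%nat); lra.
  + replace n with (m + (n - m))%nat by lia.
    destruct (Hmono m (n - m)%nat) as [H1 _]; specialize (Hp (m + (n - m))%nat); lra.
Qed.

(** A cell is named by its lower left corner, since its level [n] fixes the side lengths. The
    quarter to keep is chosen by [epsilon], and [Bad] guarantees at every level that there is
    one. *)
Lemma bisection (Bad : nat -> R -> R -> Prop) (A B a c : R) : 0 <= A -> 0 <= B ->
  (forall n u v, Bad n u v -> exists u' v',
     (u' = u \/ u' = u + A / 2 ^ S n) /\ (v' = v \/ v' = v + B / 2 ^ S n) /\ Bad (S n) u' v') ->
  Bad 0%nat a c ->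
  exists x y, forall n, exists u v, Bad n u v /\
    u <= x <= u + A / 2 ^ n /\ v <= y <= v + B / 2 ^ n.
Proof.
intros HA HB Hstep H0.
pose (step n (p q : R * R) :=
  (fst q = fst p \/ fst q = fst p + A / 2 ^ S n) /\
  (snd q = snd p \/ snd q = snd p + B / 2 ^ S n) /\ Bad (S n) (fst q) (snd q)).
pose (s := nat_rect (fun _ => (R * R)%type) (a, c)
  (fun n p => epsilon (inhabits p) (step n p))).
assert (Hs : forall n, Bad n (fst (s n)) (snd (s n)) /\ step n (s n) (s (S n))).
{ assert (Hn : forall n, Bad n (fst (s n)) (snd (s n)) -> step n (s n) (s (S n))).
  { intros n Hb; apply (epsilon_spec (inhabits (s n)) (step n (s n))).
    destruct (Hstep _ _ _ Hb) as (u' & v' & H); now exists (u', v'). }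
  induction n as [|n [IH1 IH2]]; [split; [exact H0|now apply Hn]|].
  assert (Bad (S n) (fst (s (S n))) (snd (s (S n)))) by apply IH2.
  split; [trivial|now apply Hn]. }
destruct (nested_halves (fun n => fst (s n)) A HA) as [x Hx]; [intros n; apply (Hs n)|].
destruct (nested_halves (fun n => snd (s n)) B HB) as [y Hy]; [intros n; apply (Hs n)|].
exists x, y; intros n; exists (fst (s n)), (snd (s n)); split; [apply Hs|split; auto].
Qed.

Lemma rderiv_lipschitz (z dz : R -> C) (a b M : R) : a <= b ->
  (forall t, a <= t <= b -> rderiv z t (dz t)) ->
  (forall t, a <= t <= b -> rcont dz t) ->
  (forall t, a <= t <= b -> Cmod (dz t) <= M) -> Cmod (z b - z a) <= M * (b - a).
Proof. intros Hab H1 H2 H3; apply (cint_bound dz); trivial; now apply cint_rderiv. Qed.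

(** The affine function [p + q (w - z0)] has the primitive [p w + q (w - z0)^2 / 2], so its integral
    depends on the end points only; what remains of the integrand is at most [eta * M]. *)
Lemma path_integral_near_affine (F : C -> C) (z dz : R -> C) (a b M eta : R) (p q z0 : C) :
  a <= b -> 0 <= eta ->
  (forall t, a <= t <= b -> rderiv z t (dz t)) ->
  (forall t, a <= t <= b -> rcont dz t) ->
  (forall t, a <= t <= b -> Cmod (dz t) <= M) ->
  (forall t, a <= t <= b -> cdiff F (z t)) ->
  (forall t, a <= t <= b -> Cmod (F (z t) - p - q * (z t - z0)) <= eta) ->
  Cmod (cI (fun t => F (z t) * dz t)%C a b
    - ((p * z b + q * ((z b - z0) * (z b - z0) / 2)) - (p * z a + q * ((z a - z0) * (z a - z0) / 2)))) <= eta * M * (b - a).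
Proof.
intros Hab Heta Hz Hdz HM HF He.
pose (P := fun w => (p * w + q * ((w - z0) * (w - z0) / 2))%C).
assert (HP : forall w, cderiv P w (p + q * (w - z0))).
{ intros w; unfold P.
  assert (Hsub : cderiv (fun w => w - z0)%C w 1).
  { replace (RtoC 1) with (1 + 0)%C by ring; apply cderiv_plus; [apply cderiv_id|apply cderiv_const]. }
  assert (H2 : cderiv (fun w => ((w - z0) * (w - z0)) * / 2)%C w (w - z0)).
  { eapply cderiv_eq.
    - apply (cderiv_mult (fun w => (w - z0) * (w - z0))%C (fun _ => / 2)%C); [|apply cderiv_const].
      apply (cderiv_mult (fun w => w - z0)%C (fun w => w - z0)%C); exact Hsub.
    - simpl; field; intros H; injection H; lra. }
  replace (p + q * (w - z0))%C with ((0 * w + p * 1) + (0 * ((w - z0) * (w - z0) / 2) + q * (w - z0)))%C by ring.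
  apply cderiv_plus.
  - apply (cderiv_mult (fun _ => p) (fun w => w)); [apply cderiv_const|apply cderiv_id].
  - apply (cderiv_mult (fun _ => q) (fun w => (w - z0) * (w - z0) / 2)%C); [apply cderiv_const|exact H2]. }
assert (Hzc : forall t, a <= t <= b -> rcont z t).
{ intros t Ht; eapply rderiv_cont, Hz, Ht. }
assert (C1 : cint (fun t => F (z t) * dz t)%C a b (cI (fun t => F (z t) * dz t)%C a b)).
{ apply cI_correct; trivial; intros t Ht; apply rcont_mult; auto; apply rcont_cdiff; auto. }
assert (C2 : cint (fun t => (p + q * (z t - z0)) * dz t)%C a b (P (z b) - P (z a))).
{ apply (cint_rderiv (fun t => P (z t))); trivial.
  - intros t Ht; apply rderiv_comp; auto.
  - intros t Ht; apply rcont_mult; auto; apply rcont_plus; [apply rcont_const|].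
    apply rcont_mult; [apply rcont_const|]; apply rcont_plus; auto; apply rcont_const. }
apply (cint_bound (fun t => F (z t) * dz t - (p + q * (z t - z0)) * dz t)%C a b); trivial.
- intros t Ht.
  replace (F (z t) * dz t - (p + q * (z t - z0)) * dz t)%C
    with ((F (z t) - p - q * (z t - z0)) * dz t)%C by ring.
  rewrite Cmod_mult; apply Rmult_le_compat; auto using Cmod_ge_0.
- exact (cint_minus _ _ _ _ _ _ C1 C2).
Qed.

(** What the bisection consumes: derivatives along the coordinate lines, each continuous along its
    own line, with a common bound [M] that makes [Z] Lipschitz. *)
Definition smooth_map (Z Zu Zv : R -> R -> C) (a b c d M : R) : Prop :=
  forall u v, a <= u <= b -> c <= v <= d ->
    rderiv (fun x => Z x v) u (Zu u v) /\ rderiv (fun y => Z u y) v (Zv u v) /\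
    rcont (fun x => Zu x v) u /\ rcont (fun y => Zv u y) v /\
    Cmod (Zu u v) <= M /\ Cmod (Zv u v) <= M.

(** The integral of [F dz] over the image of the rectangle's boundary, run counterclockwise in the
    [(u, v)]-plane. *)
Definition boundary_integral (F : C -> C) (Z Zu Zv : R -> R -> C) (a b c d : R) : C :=
  (cI (fun y => F (Z b y) * Zv b y) c d - cI (fun y => F (Z a y) * Zv a y) c d
   - (cI (fun x => F (Z x d) * Zu x d) a b - cI (fun x => F (Z x c) * Zu x c) a b))%C.

Lemma edge_v_cont (F : C -> C) (Z Zu Zv : R -> R -> C) (a b c d M : R) :
  smooth_map Z Zu Zv a b c d M ->
  (forall u v, a <= u <= b -> c <= v <= d -> cdiff F (Z u v)) ->
  forall u v, a <= u <= b -> c <= v <= d -> rcont (fun y => F (Z u y) * Zv u y)%C v.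
Proof.
intros HZ HF u v Hu Hv; destruct (HZ u v Hu Hv) as (_ & H2 & _ & H4 & _).
apply rcont_mult; trivial; apply (rcont_cdiff F (Z u)); auto; eapply rderiv_cont, H2.
Qed.

Lemma edge_u_cont (F : C -> C) (Z Zu Zv : R -> R -> C) (a b c d M : R) :
  smooth_map Z Zu Zv a b c d M ->
  (forall u v, a <= u <= b -> c <= v <= d -> cdiff F (Z u v)) ->
  forall u v, a <= u <= b -> c <= v <= d -> rcont (fun x => F (Z x v) * Zu x v)%C u.
Proof.
intros HZ HF u v Hu Hv; destruct (HZ u v Hu Hv) as (H1 & _ & H3 & _ & _).
apply rcont_mult; trivial; apply (rcont_cdiff F (fun x => Z x v)); auto; eapply rderiv_cont, H1.
Qed.

(** Each inner edge belongs to two quarters, with opposite directions, and cancels. *)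
Lemma boundary_integral_split (F : C -> C) (Z Zu Zv : R -> R -> C) (a b c d M m n : R) :
  smooth_map Z Zu Zv a b c d M ->
  (forall u v, a <= u <= b -> c <= v <= d -> cdiff F (Z u v)) ->
  a <= m <= b -> c <= n <= d ->
  boundary_integral F Z Zu Zv a b c d =
  (boundary_integral F Z Zu Zv a m c n + boundary_integral F Z Zu Zv m b c n
   + boundary_integral F Z Zu Zv a m n d + boundary_integral F Z Zu Zv m b n d)%C.
Proof.
intros HZ HF Hm Hn; unfold boundary_integral.
assert (Ev : forall u, a <= u <= b -> cI (fun y => F (Z u y) * Zv u y)%C c d =
  (cI (fun y => F (Z u y) * Zv u y) c n + cI (fun y => F (Z u y) * Zv u y) n d)%C).
{ intros u Hu; symmetry; apply cI_Chasles; trivial; intros t Ht.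
  now apply (edge_v_cont F Z Zu Zv a b c d M). }
assert (Eu : forall v, c <= v <= d -> cI (fun x => F (Z x v) * Zu x v)%C a b =
  (cI (fun x => F (Z x v) * Zu x v) a m + cI (fun x => F (Z x v) * Zu x v) m b)%C).
{ intros v Hv; symmetry; apply cI_Chasles; trivial; intros t Ht.
  now apply (edge_u_cont F Z Zu Zv a b c d M). }
rewrite (Ev a), (Ev b), (Eu c), (Eu d) by lra; ring.
Qed.

Lemma one_of_four_large (x1 x2 x3 x4 : C) (e : R) : e <= Cmod (x1 + x2 + x3 + x4) ->
  e / 4 <= Cmod x1 \/ e / 4 <= Cmod x2 \/ e / 4 <= Cmod x3 \/ e / 4 <= Cmod x4.
Proof.
intros H; assert (H1 := Cmod_triangle (x1 + x2 + x3) x4).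
assert (H2 := Cmod_triangle (x1 + x2) x3); assert (H3 := Cmod_triangle x1 x2).
destruct (Rle_dec (e / 4) (Cmod x1)); [now left|].
destruct (Rle_dec (e / 4) (Cmod x2)); [now right; left|].
destruct (Rle_dec (e / 4) (Cmod x3)); [now right; right; left|].
right; right; right; lra.
Qed.

Lemma smooth_map_sub (Z Zu Zv : R -> R -> C) (a b c d M a' b' c' d' : R) :
  smooth_map Z Zu Zv a b c d M -> a <= a' -> b' <= b -> c <= c' -> d' <= d ->
  smooth_map Z Zu Zv a' b' c' d' M.
Proof. intros H ? ? ? ? u v Hu Hv; apply H; lra. Qed.

Lemma smooth_map_lipschitz (Z Zu Zv : R -> R -> C) (a b c d M u v x y : R) :
  smooth_map Z Zu Zv a b c d M ->
  a <= u <= b -> c <= v <= d -> a <= x <= b -> c <= y <= d ->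
  Cmod (Z u v - Z x y) <= M * (b - a + (d - c)).
Proof.
intros HZ Hu Hv Hx Hy.
assert (HM : 0 <= M).
{ destruct (HZ u v Hu Hv) as (_ & _ & _ & _ & H & _); eapply Rle_trans; [apply Cmod_ge_0|exact H]. }
assert (Hh : forall s t, a <= s <= t -> t <= b -> Cmod (Z t v - Z s v) <= M * (b - a)).
{ intros s t Hs Ht; eapply Rle_trans.
  - apply (rderiv_lipschitz (fun x => Z x v) (fun x => Zu x v) s t M); try lra;
      intros r Hr; apply (HZ r v); lra.
  - apply Rmult_le_compat_l; lra. }
assert (Hw : forall s t, c <= s <= t -> t <= d -> Cmod (Z x t - Z x s) <= M * (d - c)).
{ intros s t Hs Ht; eapply Rle_trans.
  - apply (rderiv_lipschitz (fun y => Z x y) (fun y => Zv x y) s t M); try lra;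
      intros r Hr; apply (HZ x r); lra.
  - apply Rmult_le_compat_l; lra. }
assert (Sym : forall z w : C, Cmod (z - w) = Cmod (w - z)).
{ intros z w; replace (z - w)%C with (- (w - z))%C by ring; apply Cmod_opp. }
replace (Z u v - Z x y)%C with ((Z u v - Z x v) + (Z x v - Z x y))%C by ring.
eapply Rle_trans; [apply Cmod_triangle|]; rewrite Rmult_plus_distr_l; apply Rplus_le_compat.
- destruct (Rle_dec x u); [|rewrite Sym]; apply Hh; lra.
- destruct (Rle_dec y v); [|rewrite Sym]; apply Hw; lra.
Qed.

(** The end-point values of the primitive cancel at the four corners, which leaves the errors of two
    pairs of opposite edges. *)
Lemma boundary_integral_near_affine (F : C -> C) (Z Zu Zv : R -> R -> C) (a b c d M eta : R)
  (p q z0 : C) :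
  a <= b -> c <= d -> 0 <= eta -> smooth_map Z Zu Zv a b c d M ->
  (forall u v, a <= u <= b -> c <= v <= d -> cdiff F (Z u v)) ->
  (forall u v, a <= u <= b -> c <= v <= d -> Cmod (F (Z u v) - p - q * (Z u v - z0)) <= eta) ->
  Cmod (boundary_integral F Z Zu Zv a b c d) <= 2 * (eta * M * (b - a + (d - c))).
Proof.
intros Hab Hcd Heta HZ HF He.
assert (Hv : forall u, a <= u <= b -> Cmod (cI (fun y => F (Z u y) * Zv u y)%C c d
   - ((p * Z u d + q * ((Z u d - z0) * (Z u d - z0) / 2)) - (p * Z u c + q * ((Z u c - z0) * (Z u c - z0) / 2)))) <= eta * M * (d - c)).
{ intros u Hu; apply (path_integral_near_affine F (Z u) (Zv u)); trivial;
    intros t Ht; first [now apply HF|now apply He|now apply HZ]. }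
assert (Hu : forall v, c <= v <= d -> Cmod (cI (fun x => F (Z x v) * Zu x v)%C a b
   - ((p * Z b v + q * ((Z b v - z0) * (Z b v - z0) / 2)) - (p * Z a v + q * ((Z a v - z0) * (Z a v - z0) / 2)))) <= eta * M * (b - a)).
{ intros v Hv'; apply (path_integral_near_affine F (fun x => Z x v) (fun x => Zu x v)); trivial;
    intros t Ht; first [now apply HF|now apply He|now apply HZ]. }
unfold boundary_integral.
assert (H1 := Hv a); assert (H2 := Hv b); assert (H3 := Hu c); assert (H4 := Hu d).
match type of H1 with _ -> Cmod ?x <= _ => set (x1 := x) in * end.
match type of H2 with _ -> Cmod ?x <= _ => set (x2 := x) in * end.
match type of H3 with _ -> Cmod ?x <= _ => set (x3 := x) in * end.
match type of H4 with _ -> Cmod ?x <= _ => set (x4 := x) in * end.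
match goal with |- Cmod ?x <= _ => replace x with (x2 + - x1 + - (x4 + - x3))%C end.
- assert (T1 := Cmod_triangle (x2 + - x1) (- (x4 + - x3))).
  assert (T2 := Cmod_triangle x2 (- x1)); assert (T3 := Cmod_triangle x4 (- x3)).
  rewrite !Cmod_opp in *; rewrite Rmult_plus_distr_l.
  assert (H1' := H1 ltac:(lra)); assert (H2' := H2 ltac:(lra));
  assert (H3' := H3 ltac:(lra)); assert (H4' := H4 ltac:(lra)); lra.
- unfold x1, x2, x3, x4; ring.
Qed.

Theorem homotopy_goursat (F : C -> C) (Z Zu Zv : R -> R -> C) (a b c d M : R) :
  a <= b -> c <= d -> smooth_map Z Zu Zv a b c d M ->
  (forall u v, a <= u <= b -> c <= v <= d -> cdiff F (Z u v)) ->
  boundary_integral F Z Zu Zv a b c d = 0.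
Proof.
intros Hab Hcd HZ HF; apply NNPP; intros Hne.
assert (Heta : 0 < Cmod (boundary_integral F Z Zu Zv a b c d)) by now apply Cmod_gt_0.
set (eta := Cmod (boundary_integral F Z Zu Zv a b c d)) in *.
pose (h := b - a); pose (k := d - c).
assert (Hh : forall n, h / 2 ^ n = h / 2 ^ S n + h / 2 ^ S n).
{ intros n; simpl; field; apply pow_nonzero; lra. }
assert (Hk : forall n, k / 2 ^ n = k / 2 ^ S n + k / 2 ^ S n).
{ intros n; simpl; field; apply pow_nonzero; lra. }
assert (Hh0 : forall n, 0 <= h / 2 ^ n).
{ intros n; apply Rdiv_le_0_compat; [unfold h; lra|apply pow_lt; lra]. }
assert (Hk0 : forall n, 0 <= k / 2 ^ n).
{ intros n; apply Rdiv_le_0_compat; [unfold k; lra|apply pow_lt; lra]. }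
destruct (bisection (fun n u v => a <= u /\ u + h / 2 ^ n <= b /\ c <= v /\ v + k / 2 ^ n <= d /\
  eta / 4 ^ n <= Cmod (boundary_integral F Z Zu Zv u (u + h / 2 ^ n) v (v + k / 2 ^ n))) h k a c)
  as (x & y & Hxy).
- unfold h; lra.
- unfold k; lra.
- intros n u v (Hu1 & Hu2 & Hv1 & Hv2 & Hb).
  specialize (Hh0 (S n)); specialize (Hk0 (S n)); specialize (Hh n); specialize (Hk n).
  rewrite (boundary_integral_split F Z Zu Zv _ _ _ _ M (u + h / 2 ^ S n) (v + k / 2 ^ S n)) in Hb;
    [|eapply smooth_map_sub; [exact HZ|lra..]|intros; apply HF; lra|lra|lra].
  replace (u + h / 2 ^ n) with (u + h / 2 ^ S n + h / 2 ^ S n) in Hb by lra.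
  replace (v + k / 2 ^ n) with (v + k / 2 ^ S n + k / 2 ^ S n) in Hb by lra.
  apply one_of_four_large in Hb.
  replace (eta / 4 ^ n / 4) with (eta / 4 ^ S n) in Hb
    by (simpl; field; apply pow_nonzero; lra).
  destruct Hb as [Hb|[Hb|[Hb|Hb]]].
  + exists u, v; repeat split; try (now left); try lra; exact Hb.
  + exists (u + h / 2 ^ S n), v; repeat split; try (now left); try (now right); try lra; exact Hb.
  + exists u, (v + k / 2 ^ S n); repeat split; try (now left); try (now right); try lra; exact Hb.
  + exists (u + h / 2 ^ S n), (v + k / 2 ^ S n); repeat split; try (now right); try lra; exact Hb.
- simpl; replace (a + h / 1) with b by (unfold h; field).
  replace (c + k / 1) with d by (unfold k; field); unfold eta; repeat split; lra.
- assert (Hx : a <= x <= b /\ c <= y <= d).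
  { destruct (Hxy 0%nat) as (u & v & (? & ? & ? & ? & _) & ? & ?); lra. }
  destruct (HF x y) as [l Hl]; [tauto..|].
  assert (HM : 0 <= M).
  { destruct (HZ x y) as (_ & _ & _ & _ & H & _); [tauto..|].
    eapply Rle_trans; [apply Cmod_ge_0|exact H]. }
  assert (HMS : 0 <= M * (h + k)) by (apply Rmult_le_pos; [trivial|unfold h, k; lra]).
  (* [S / 2 ^ N] bounds the diameter of the image of a cell of level [N]. With slope error
     [eta / (4 (S^2 + 1))], the near-affine bound becomes [eta S^2 / (2 (S^2 + 1)) / 4^N], strictly
     below the lower bound [eta / 4^N]. The added 1 covers [S = 0]. *)
  pose (S := (M * (h + k))); fold S in HMS.
  assert (HS : 0 < S * S + 1) by nra.
  destruct (Hl (eta / (4 * (S * S + 1)))) as [dl [Hdl Hw]].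
  { apply Rdiv_lt_0_compat; lra. }
  destruct (half_power_small S dl Hdl) as [N HN].
  specialize (HN N (Nat.le_refl N)).
  destruct (Hxy N) as (u & v & (Hu1 & Hu2 & Hv1 & Hv2 & Hb) & Hux & Hvy).
  assert (HZ' : smooth_map Z Zu Zv u (u + h / 2 ^ N) v (v + k / 2 ^ N) M)
    by (eapply smooth_map_sub; [exact HZ|lra..]).
  assert (Hp : 0 < 2 ^ N) by (apply pow_lt; lra).
  assert (Hsmall : forall s t, u <= s <= u + h / 2 ^ N -> v <= t <= v + k / 2 ^ N ->
    Cmod (Z s t - Z x y) <= S / 2 ^ N).
  { intros s t Hs Ht; eapply Rle_trans.
    - apply (smooth_map_lipschitz _ _ _ _ _ _ _ M s t x y HZ'); trivial.
    - right; unfold S; field; lra. }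
  assert (HB : Cmod (boundary_integral F Z Zu Zv u (u + h / 2 ^ N) v (v + k / 2 ^ N)) <=
    2 * (eta / (4 * (S * S + 1)) * (S / 2 ^ N) * M
         * (u + h / 2 ^ N - u + (v + k / 2 ^ N - v)))).
  { apply (boundary_integral_near_affine F Z Zu Zv) with (p := F (Z x y)) (q := l) (z0 := Z x y); trivial.
    - specialize (Hh0 N); lra.
    - specialize (Hk0 N); lra.
    - apply Rmult_le_pos; [apply Rlt_le, Rdiv_lt_0_compat; lra|apply Rdiv_le_0_compat; lra].
    - intros s t Hs Ht; apply HF; lra.
    - intros s t Hs Ht; specialize (Hsmall s t Hs Ht); eapply Rle_trans; [apply Hw; lra|].
      apply Rmult_le_compat_l; [apply Rlt_le, Rdiv_lt_0_compat; lra|trivial]. }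
  assert (HC : eta / 4 ^ N <= eta / (2 * (S * S + 1)) * (S * S) / 4 ^ N).
  { eapply Rle_trans; [exact Hb|]; eapply Rle_trans; [exact HB|]; right.
    replace (4 ^ N) with (2 ^ N * 2 ^ N) by (rewrite <- Rpow_mult_distr; f_equal; lra).
    unfold S; field; fold S; lra. }
  assert (Hp4 : 0 < 4 ^ N) by (apply pow_lt; lra).
  apply (Rmult_le_compat_r (4 ^ N)) in HC; [|lra].
  replace (eta / 4 ^ N * 4 ^ N) with eta in HC by (field; lra).
  replace (eta / (2 * (S * S + 1)) * (S * S) / 4 ^ N * 4 ^ N)
    with (eta * (S * S / (2 * (S * S + 1)))) in HC by (field; lra).
  assert (HH : S * S / (2 * (S * S + 1)) < 1).
  { apply Rmult_lt_reg_r with (2 * (S * S + 1)); [lra|].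
    unfold Rdiv; rewrite Rmult_assoc, Rinv_l, Rmult_1_r by lra; nra. }
  nra.
Qed.

(** * The Cauchy formula for circles *)

Lemma rderiv_eq (f : R -> C) (t : R) (l m : C) : rderiv f t l -> l = m -> rderiv f t m.
Proof. now intros H <-. Qed.

Lemma rderiv_mult_l (k : C) (f : R -> C) (t : R) (l : C) :
  rderiv f t l -> rderiv (fun x => k * f x)%C t (k * l).
Proof.
intros H; eapply rderiv_eq.
- apply (rderiv_comp (fun w => k * w)%C f); [|exact H].
  apply (cderiv_mult (fun _ => k) (fun w => w)); [apply cderiv_const|apply cderiv_id].
- ring.
Qed.

Lemma rderiv_RtoC (t : R) : rderiv RtoC t 1.
Proof. apply rderiv_pair; simpl; [apply (is_derive_id (K := R_AbsRing))|apply (is_derive_const (V := R_NormedModule))]. Qed.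

Lemma rderiv_cis (t : R) : rderiv cis t (Ci * cis t).
Proof. apply rderiv_pair; simpl; auto_derive; trivial; ring. Qed.

Lemma Cmod_cis (t : R) : Cmod (cis t) = 1.
Proof.
unfold Cmod, cis; simpl; rewrite !Rmult_1_r, Rplus_comm.
change (sqrt (Rsqr (sin t) + Rsqr (cos t)) = 1); rewrite sin2_cos2; apply sqrt_1.
Qed.

Lemma Cmod_minus_sym (z w : C) : Cmod (z - w) = Cmod (w - z).
Proof. replace (z - w)%C with (- (w - z))%C by ring; apply Cmod_opp. Qed.

Lemma cis_2PI : cis (2 * PI) = cis 0.
Proof. unfold cis; now rewrite cos_2PI, sin_2PI, cos_0, sin_0. Qed.

Definition circle (z0 : C) (rho t : R) : C := (z0 + RtoC rho * cis t)%C.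
Definition dcircle (rho t : R) : C := (RtoC rho * (Ci * cis t))%C.

Lemma rderiv_circle (z0 : C) (rho t : R) : rderiv (circle z0 rho) t (dcircle rho t).
Proof.
eapply rderiv_eq; [apply rderiv_plus; [apply rderiv_const|apply rderiv_mult_l, rderiv_cis]|].
unfold dcircle; ring.
Qed.

Lemma rcont_cis (t : R) : rcont cis t.
Proof. eapply rderiv_cont, rderiv_cis. Qed.

Lemma rcont_circle (z0 : C) (rho t : R) : rcont (circle z0 rho) t.
Proof. eapply rderiv_cont, rderiv_circle. Qed.

Lemma rcont_dcircle (rho t : R) : rcont (dcircle rho) t.
Proof. apply rcont_mult; [apply rcont_const|]; apply rcont_mult; [apply rcont_const|apply rcont_cis]. Qed.

Lemma Cmod_dcircle (rho t : R) : 0 <= rho -> Cmod (dcircle rho t) = rho.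
Proof.
intros H; unfold dcircle; rewrite !Cmod_mult, Cmod_cis, Cmod_Ci, Cmod_R, Rabs_pos_eq; lra.
Qed.

Lemma Cmod_circle (z0 : C) (rho t : R) : 0 <= rho -> Cmod (circle z0 rho t - z0) = rho.
Proof.
intros H; unfold circle; replace (z0 + rho * cis t - z0)%C with (RtoC rho * cis t)%C by ring.
rewrite Cmod_mult, Cmod_cis, Cmod_R, Rabs_pos_eq; lra.
Qed.

Lemma circle_dist_lower (z0 z : C) (rho t : R) : 0 <= rho ->
  rho - Cmod (z - z0) <= Cmod (circle z0 rho t - z).
Proof.
intros H; assert (T := Cmod_triangle (circle z0 rho t - z) (z - z0)).
replace (circle z0 rho t - z + (z - z0))%C with (circle z0 rho t - z0)%C in T by ring.
rewrite Cmod_circle in T; lra.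
Qed.

Lemma circle_dist_upper (z0 z : C) (rho t : R) : 0 <= rho ->
  Cmod (circle z0 rho t - z) <= rho + Cmod (z - z0).
Proof.
intros H; assert (T := Cmod_triangle (circle z0 rho t - z0) (z0 - z)).
replace (circle z0 rho t - z0 + (z0 - z))%C with (circle z0 rho t - z)%C in T by ring.
rewrite Cmod_circle, (Cmod_minus_sym z0) in T; lra.
Qed.

Lemma two_pi_pos : 0 <= 2 * PI.
Proof. assert (H := PI_RGT_0); lra. Qed.

Lemma cderiv_sub (z a : C) : cderiv (fun w => w - a)%C z 1.
Proof.
eapply cderiv_eq; [apply cderiv_plus; [apply cderiv_id|apply cderiv_const]|ring].
Qed.

Lemma cderiv_inv_sub (z a : C) : (z - a)%C <> 0 ->
  cderiv (fun w => / (w - a))%C z (- (/ (z - a) * / (z - a))).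
Proof.
intros H; eapply cderiv_eq; [apply (cderiv_inv (fun w => w - a)%C); [exact H|apply cderiv_sub]|].
ring.
Qed.

(** The circle is translated instead of moving the pole: [Z 1] is the circle seen from [z], [Z 0]
    the circle seen from its centre, where the integrand is the constant [Ci]. No intermediate
    circle meets 0, because [z] is closer to [z0] than [rho]. The edges at angles 0 and [2 * PI]
    coincide and cancel. *)
Lemma winding_circle (z0 z : C) (rho : R) : Cmod (z - z0) < rho ->
  cint (fun t => / (circle z0 rho t - z) * dcircle rho t)%C 0 (2 * PI) (2 * PI * Ci)%C.
Proof.
intros Hz; assert (H0 := Cmod_ge_0 (z - z0)).
pose (Z := fun u t => (circle z0 rho t - z0 + RtoC u * (z0 - z))%C).
assert (HZ0 : forall u t, 0 <= u <= 1 -> Z u t <> 0).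
{ intros u t Hu; apply Cmod_gt_0.
  assert (T := Cmod_triangle (Z u t) (- (RtoC u * (z0 - z)))).
  replace (Z u t + - (RtoC u * (z0 - z)))%C with (circle z0 rho t - z0)%C in T by (unfold Z; ring).
  rewrite Cmod_circle, Cmod_opp, Cmod_mult, Cmod_R, Rabs_pos_eq, Cmod_minus_sym in T by lra.
  nra. }
assert (HF : forall u t, 0 <= u <= 1 -> cdiff Cinv (Z u t)).
{ intros u t Hu; eexists; apply cderiv_inv_id; auto. }
assert (HZ : smooth_map Z (fun _ _ => z0 - z)%C (fun _ t => dcircle rho t) 0 1 0 (2 * PI) rho).
{ intros u t Hu Ht; split; [|split; [|split; [|split; [|split]]]].
  - eapply rderiv_eq.
    + apply (rderiv_plus (fun _ => circle z0 rho t - z0)%C (fun x => RtoC x * (z0 - z))%C);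
        [apply rderiv_const|].
      apply (rderiv_comp (fun w => w * (z0 - z))%C RtoC); [|apply rderiv_RtoC].
      apply (cderiv_mult (fun w => w) (fun _ => z0 - z)%C); [apply cderiv_id|apply cderiv_const].
    + cbv beta; ring.
  - eapply rderiv_eq.
    + apply (rderiv_plus (fun y => circle z0 rho y - z0)%C); [|apply rderiv_const].
      apply rderiv_plus; [apply rderiv_circle|apply rderiv_const].
    + cbv beta; ring.
  - apply rcont_const.
  - apply rcont_dcircle.
  - rewrite Cmod_minus_sym; lra.
  - rewrite Cmod_dcircle; lra. }
assert (G := homotopy_goursat Cinv Z _ _ 0 1 0 (2 * PI) rho Rle_0_1 two_pi_pos HZ
  (fun u v Hu Hv => HF u v Hu)).
unfold boundary_integral in G.
assert (E : forall x, Z x (2 * PI) = Z x 0).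
{ intros x; unfold Z, circle; now rewrite cis_2PI. }
assert (E' : cI (fun x => / Z x (2 * PI)%R * (z0 - z))%C 0 1 = cI (fun x => / Z x 0 * (z0 - z))%C 0 1).
{ apply cI_ext; intros x; now rewrite E. }
assert (C1 : cint (fun t => / (circle z0 rho t - z) * dcircle rho t)%C 0 (2 * PI)
  (cI (fun t => / Z 1 t * dcircle rho t)%C 0 (2 * PI))).
{ apply (cint_ext (fun t => / Z 1 t * dcircle rho t)%C); [apply two_pi_pos|..].
  - intros t _; unfold Z; replace (circle z0 rho t - z0 + 1 * (z0 - z))%C with (circle z0 rho t - z)%C by ring.
    reflexivity.
  - apply cI_correct; [apply two_pi_pos|].
    intros t Ht; apply (edge_v_cont Cinv Z _ _ 0 1 0 (2 * PI) rho HZ); auto; lra. }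
assert (C0 : cI (fun t => / Z 0 t * dcircle rho t)%C 0 (2 * PI) = (2 * PI * Ci)%C).
{ apply cI_unique, (cint_ext (fun _ => Ci)); [apply two_pi_pos|..].
  - intros t _.
    assert (Hr : (rho * cis t)%C <> 0).
    { apply Cmod_gt_0; rewrite Cmod_mult, Cmod_cis, Cmod_R, Rabs_pos_eq; lra. }
    unfold Z, dcircle, circle.
    replace (z0 + rho * cis t - z0 + 0 * (z0 - z))%C with (rho * cis t)%C by ring.
    replace (RtoC rho * (Ci * cis t))%C with (Ci * (rho * cis t))%C by ring.
    revert Hr; generalize (rho * cis t)%C; intros x Hx; field; exact Hx.
  - replace (2 * PI * Ci)%C with (Ci * (2 * PI - 0)%R)%C.
    + eapply (cint_ext (fun _ => Ci * 1)%C); [apply two_pi_pos|intros; ring|].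
      apply cint_mult_l.
      replace (RtoC (2 * PI - 0)%R) with (RtoC (2 * PI) - RtoC 0)%C.
      * apply (cint_rderiv RtoC (fun _ => RtoC 1)); [apply two_pi_pos|..].
        -- intros; apply rderiv_RtoC.
        -- intros; apply rcont_const.
      * now rewrite RtoC_minus.
    + rewrite Rminus_0_r, RtoC_mult; ring. }
rewrite C0, E' in G.
replace (2 * PI * Ci)%C with (cI (fun t => / Z 1 t * dcircle rho t)%C 0 (2 * PI)); [exact C1|].
match type of G with (?x - ?y - (?c - ?c))%C = _ => replace x with (x - y - (c - c) + y)%C by ring end.
rewrite G; ring.
Qed.

(** Contracting the circle towards [z] by a factor [u] leaves the form [dw / (w - z)] unchanged. The
    integral [A u] of [F] against it is therefore constant for [0 < u <= 1], and continuity of [F]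
    at [z] gives its limit as [u] tends to 0. *)
Theorem cauchy_formula (F : C -> C) (z0 z : C) (rho Rd : R) :
  rho < Rd -> Cmod (z - z0) < rho ->
  (forall w, Cmod (w - z0) < Rd -> cdiff F w) ->
  cint (fun t => F (circle z0 rho t) * dcircle rho t / (circle z0 rho t - z))%C 0 (2 * PI)
    (2 * PI * Ci * F z)%C.
Proof.
intros HR Hz HF; assert (H0 := Cmod_ge_0 (z - z0)).
set (w := circle z0 rho); set (dw := dcircle rho).
pose (Z := fun u t => (z + RtoC u * (w t - z))%C).
assert (Hlow : forall t, rho - Cmod (z - z0) <= Cmod (w t - z)) by (intros; apply circle_dist_lower; lra).
assert (Hupp : forall t, Cmod (w t - z) <= 2 * rho).
{ intros t; eapply Rle_trans; [apply circle_dist_upper|]; lra. }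
assert (Hwz : forall t, (w t - z)%C <> 0) by (intros t; apply Cmod_gt_0; specialize (Hlow t); lra).
assert (HZd : forall u t, 0 <= u <= 1 -> Cmod (Z u t - z0) < Rd).
{ intros u t Hu; replace (Z u t - z0)%C with (RtoC (1 - u) * (z - z0) + RtoC u * (w t - z0))%C
    by (unfold Z; rewrite RtoC_minus; ring).
  eapply Rle_lt_trans; [apply Cmod_triangle|].
  unfold w; rewrite !Cmod_mult, !Cmod_R, !Rabs_pos_eq, Cmod_circle by lra; nra. }
pose (A := fun u => cI (fun t => F (Z u t) * (dw t / (w t - z)))%C 0 (2 * PI)).
assert (Hk : forall t, rcont (fun t => dw t / (w t - z))%C t).
{ intros t; apply rcont_mult; [apply rcont_dcircle|].
  apply rcont_inv; [apply Hwz|].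
  apply rcont_plus; [apply rcont_circle|apply rcont_const]. }
assert (HA : forall u, 0 <= u <= 1 -> cint (fun t => F (Z u t) * (dw t / (w t - z)))%C 0 (2 * PI) (A u)).
{ intros u Hu; apply cI_correct; [apply two_pi_pos|]; intros t _; apply rcont_mult; [|apply Hk].
  apply (rcont_cdiff F (Z u)); [auto|].
  apply rcont_plus; [apply rcont_const|]; apply rcont_mult; [apply rcont_const|].
  apply rcont_plus; [apply rcont_circle|apply rcont_const]. }
(* The homotopy stops at [e > 0], since [Phi] has its pole at [z], which is [Z 0 t]. *)
assert (HAc : forall e, 0 < e <= 1 -> A 1 = A e).
{ intros e He.
  pose (Phi := fun y => (F y * / (y - z))%C).
  assert (HP : forall u t, e <= u <= 1 -> cdiff Phi (Z u t)).
  { intros u t Hu; destruct (HF (Z u t)) as [l Hl]; [apply HZd; lra|].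
    eexists; apply cderiv_mult; [exact Hl|apply cderiv_inv_sub].
    replace (Z u t - z)%C with (u * (w t - z))%C by (unfold Z; ring).
    apply Cmult_neq_0; [|apply Hwz]; intros E; injection E; lra. }
  assert (HZ : smooth_map Z (fun _ t => w t - z)%C (fun u t => RtoC u * dw t)%C e 1 0 (2 * PI) (2 * rho)).
  { intros u t Hu Ht; split; [|split; [|split; [|split; [|split]]]].
    - eapply rderiv_eq.
      + apply (rderiv_plus (fun _ => z) (fun x => RtoC x * (w t - z))%C); [apply rderiv_const|].
        apply (rderiv_comp (fun y => y * (w t - z))%C RtoC); [|apply rderiv_RtoC].
        apply (cderiv_mult (fun w => w) (fun _ => w t - z)%C); [apply cderiv_id|apply cderiv_const].
      + cbv beta; ring.
    - eapply rderiv_eq.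
      + apply (rderiv_plus (fun _ => z)); [apply rderiv_const|].
        apply rderiv_mult_l, rderiv_plus; [apply rderiv_circle|apply rderiv_const].
      + unfold dw; ring.
    - apply rcont_const.
    - apply rcont_mult; [apply rcont_const|apply rcont_dcircle].
    - apply Hupp.
    - unfold dw; rewrite Cmod_mult, Cmod_R, Cmod_dcircle, Rabs_pos_eq by lra; nra. }
  assert (G := homotopy_goursat Phi Z _ _ e 1 0 (2 * PI) (2 * rho) (proj2 He) two_pi_pos HZ
    (fun u v Hu Hv => HP u v Hu)).
  unfold boundary_integral in G.
  assert (Ew : w (2 * PI) = w 0) by (unfold w, circle; now rewrite cis_2PI).
  assert (E' : cI (fun x => Phi (Z x (2 * PI)%R) * (w (2 * PI)%R - z))%C e 1
             = cI (fun x => Phi (Z x 0) * (w 0 - z))%C e 1).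
  { apply cI_ext; intros x; unfold Z; now rewrite Ew. }
  assert (EA : forall u, e <= u <= 1 -> cI (fun y => Phi (Z u y) * (RtoC u * dw y))%C 0 (2 * PI) = A u).
  { intros u Hu; apply cI_ext; intros x; unfold Phi.
    replace (Z u x - z)%C with (u * (w x - z))%C by (unfold Z; ring).
    field; split; [apply Hwz|intros E; injection E; lra]. }
  rewrite E', !EA in G by lra.
  match type of G with (?x - ?y - (?c - ?c))%C = _ => replace x with (x - y - (c - c) + y)%C by ring end.
  rewrite G; ring. }
assert (HW := winding_circle z0 z rho Hz); fold w dw in HW.
assert (HA1 : A 1 = (2 * PI * Ci * F z)%C).
{ apply NNPP; intros Hne.
  assert (Hp : 0 < Cmod (A 1 - 2 * PI * Ci * F z)).
  { apply Cmod_gt_0; intros E; apply Hne.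
    replace (A 1) with ((A 1 - 2 * PI * Ci * F z) + 2 * PI * Ci * F z)%C by ring; rewrite E; ring. }
  destruct (HF z) as [l Hl]; [lra|].
  set (eta := Cmod (A 1 - 2 * PI * Ci * F z)) in *.
  set (q := rho - Cmod (z - z0)) in *.
  assert (Hq : 0 < q) by (unfold q; lra).
  assert (HPI := PI_RGT_0).
  assert (Hrho : 0 < rho) by lra.
  (* [rho / q] bounds [|dw / (w - z)|]; keeping [F] within this tolerance of [F z] makes the two
     integrals differ by at most [eta / 2]. *)
  assert (Hc : 0 < eta / (2 * (rho / q) * (2 * PI))).
  { apply Rdiv_lt_0_compat; [trivial|]; assert (0 < rho / q) by (now apply Rdiv_lt_0_compat).
    apply Rmult_lt_0_compat; lra. }
  destruct (cderiv_cont F z l Hl _ Hc) as [d [Hd HFd]].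
  pose (e := Rmin 1 (d / (4 * rho))).
  assert (He : 0 < e <= 1).
  { split; [apply Rmin_glb_lt; [lra|apply Rdiv_lt_0_compat; lra]|apply Rmin_l]. }
  assert (He2 : e * (4 * rho) <= d).
  { assert (H : e <= d / (4 * rho)) by apply Rmin_r.
    apply (Rmult_le_compat_r (4 * rho)) in H; [|lra].
    replace (d / (4 * rho) * (4 * rho)) with d in H by (field; lra); exact H. }
  assert (HB : eta <= eta / (2 * (rho / q) * (2 * PI)) * (rho / q) * (2 * PI - 0)).
  { unfold eta at 1; rewrite (HAc e He).
    apply (cint_bound (fun t => F (Z e t) * (dw t / (w t - z)) - F z * (/ (w t - z) * dw t))%C 0 (2 * PI));
      [apply two_pi_pos| |].
    - intros t _.
      replace (F (Z e t) * (dw t / (w t - z)) - F z * (/ (w t - z) * dw t))%C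
        with ((F (Z e t) - F z) * (dw t / (w t - z)))%C by (unfold Cdiv; ring).
      rewrite Cmod_mult; apply Rmult_le_compat; try apply Cmod_ge_0.
      + left; apply HFd; replace (Z e t - z)%C with (e * (w t - z))%C by (unfold Z; ring).
        rewrite Cmod_mult, Cmod_R, Rabs_pos_eq by lra; specialize (Hupp t); nra.
      + rewrite Cmod_div by apply Hwz; unfold dw; rewrite Cmod_dcircle by lra.
        apply Rmult_le_compat_l; [lra|]; apply Rinv_le_contravar; [trivial|apply Hlow].
    - apply cint_minus; [apply HA; lra|].
      replace (2 * PI * Ci * F z)%C with (F z * (2 * PI * Ci))%C by ring.
      now apply cint_mult_l. }
  replace (eta / (2 * (rho / q) * (2 * PI)) * (rho / q) * (2 * PI - 0)) with (eta / 2) in HB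
    by (field; lra).
  lra. }
rewrite <- HA1.
apply (cint_ext (fun t => F (Z 1 t) * (dw t / (w t - z)))%C); [apply two_pi_pos| |apply HA; lra].
intros t _; replace (Z 1 t) with (w t) by (unfold Z; ring); unfold Cdiv; ring.
Qed.

(** * Derivatives and divided differences *)

(** Differentiation under the integral sign; a quadratic remainder uniform in [t] takes the place of
    a domination argument. *)
Lemma cderiv_cI_param (k : C -> R -> C) (k' : R -> C) (a b : R) (z : C) (K d0 : R) :
  a <= b -> 0 < d0 -> 0 <= K ->
  (forall y t, Cmod (y - z) < d0 -> a <= t <= b -> rcont (k y) t) ->
  (forall t, a <= t <= b -> rcont k' t) ->
  (forall y t, Cmod (y - z) < d0 -> a <= t <= b ->
     Cmod (k y t - k z t - (y - z) * k' t) <= K * (Cmod (y - z) * Cmod (y - z))) ->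
  cderiv (fun y => cI (k y) a b) z (cI k' a b).
Proof.
intros Hab Hd0 HK Hk Hk' Hb eps Heps.
assert (Hc : 0 < 1 + K * (b - a)) by (assert (0 <= K * (b - a)) by (apply Rmult_le_pos; lra); lra).
exists (Rmin d0 (eps / (1 + K * (b - a)))); split.
{ apply Rmin_glb_lt; [trivial|now apply Rdiv_lt_0_compat]. }
intros y Hy.
assert (Hy1 : Cmod (y - z) < d0) by (eapply Rlt_le_trans; [exact Hy|apply Rmin_l]).
assert (Hy2 : Cmod (y - z) < eps / (1 + K * (b - a))) by (eapply Rlt_le_trans; [exact Hy|apply Rmin_r]).
assert (Hz0 : Cmod (z - z) < d0).
{ replace (z - z)%C with (RtoC 0) by ring; now rewrite Cmod_0. }
apply Rle_trans with (K * (Cmod (y - z) * Cmod (y - z)) * (b - a)).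
- apply (cint_bound (fun t => k y t - k z t - (y - z) * k' t)%C); trivial.
  + intros t Ht; now apply Hb.
  + rewrite (Cmult_comm (cI k' a b)).
    apply (cint_minus (fun t => k y t - k z t)%C).
    * apply cint_minus; apply cI_correct; auto.
    * now apply cint_mult_l, cI_correct.
- assert (H0 := Cmod_ge_0 (y - z)).
  assert (H1 : Cmod (y - z) * (1 + K * (b - a)) < eps).
  { apply (Rmult_lt_compat_r (1 + K * (b - a))) in Hy2; [|trivial].
    replace (eps / (1 + K * (b - a)) * (1 + K * (b - a))) with eps in Hy2 by (field; lra); exact Hy2. }
  replace (K * (Cmod (y - z) * Cmod (y - z)) * (b - a)) with (Cmod (y - z) * K * (b - a) * Cmod (y - z)) by ring.
  apply Rmult_le_compat_r; trivial; lra.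
Qed.

Lemma rcont_bounded (f : R -> C) (a b : R) : a <= b ->
  (forall t, a <= t <= b -> rcont f t) ->
  exists M, 0 <= M /\ forall t, a <= t <= b -> Cmod (f t) <= M.
Proof.
intros Hab H.
assert (Hb : forall g : R -> R, (forall t, a <= t <= b -> continuous g t) ->
  exists M, 0 <= M /\ forall t, a <= t <= b -> Rabs (g t) <= M).
{ intros g Hg; destruct (continuity_ab_maj (fun x => Rabs (g x)) a b Hab) as [x [Hx _]].
  - intros c Hc; apply continuity_pt_filterlim, (continuous_comp g Rabs); [now apply Hg|].
    apply continuous_Rabs.
  - exists (Rabs (g x)); split; [apply Rabs_pos|exact Hx]. }
destruct (Hb (fun t => fst (f t))) as [M1 [HM1 H1]]; [intros; now apply rcont_fst, H|].
destruct (Hb (fun t => snd (f t))) as [M2 [HM2 H2]]; [intros; now apply rcont_snd, H|].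
exists (2 * (M1 + M2)); split; [lra|]; intros t Ht.
eapply Rle_trans; [apply Cmod_2Rmax|].
assert (Hs : sqrt 2 <= 2).
{ rewrite <- (sqrt_Rsqr 2) at 2 by lra; apply sqrt_le_1; unfold Rsqr; lra. }
specialize (H1 t Ht); specialize (H2 t Ht).
apply Rmult_le_compat; try lra; [apply sqrt_pos| |].
- eapply Rle_trans; [apply Rabs_pos|apply Rmax_l].
- apply Rmax_lub; lra.
Qed.

(** A Cauchy-type integral with free density [h], which absorbs the factor [dw]. The density is left
    free because divided differences need one other than the boundary values of [F]. *)
Definition cauchy_kernel (z0 : C) (rho : R) (h : R -> C) (n : nat) (z : C) : C :=
  cI (fun t => h t * (/ (circle z0 rho t - z)) ^ n)%C 0 (2 * PI).

Lemma rcont_pow (f : R -> C) (n : nat) (t : R) : rcont f t -> rcont (fun x => f x ^ n)%C t.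
Proof.
intros H; induction n as [|n IH]; [apply rcont_const|].
apply (rcont_mult f (fun x => f x ^ n)%C); trivial.
Qed.

Lemma rcont_kernel (z0 : C) (rho : R) (h : R -> C) (n : nat) (z : C) :
  Cmod (z - z0) < rho -> (forall t, rcont h t) ->
  forall t, rcont (fun t => h t * (/ (circle z0 rho t - z)) ^ n)%C t.
Proof.
intros Hz Hh t; apply rcont_mult; trivial; apply rcont_pow, rcont_inv.
- apply Cmod_gt_0; assert (H := Cmod_ge_0 (z - z0));
    assert (Hl := circle_dist_lower z0 z rho t); lra.
- apply rcont_plus; [apply rcont_circle|apply rcont_const].
Qed.

(** The hypothesis on [a] and [e] isolates the algebra of one exponent, with [a] the vector from [z]
    to the circle and [e] the displacement of [z]. The exponents 1 and 2 are enough to differentiate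
    [F] twice, and higher derivatives follow by iteration. *)
Lemma cauchy_kernel_cderiv (z0 : C) (rho : R) (h : R -> C) (n : nat) (z : C) (K d : R) :
  0 < d -> 0 <= K -> Cmod (z - z0) + d <= rho -> (forall t, rcont h t) ->
  (forall a e : C, d <= Cmod a -> Cmod e < d / 2 ->
     Cmod ((/ (a - e)) ^ n - (/ a) ^ n - e * (RtoC (INR n) * (/ a) ^ S n)) <= K * (Cmod e * Cmod e)) ->
  cderiv (cauchy_kernel z0 rho h n) z (RtoC (INR n) * cauchy_kernel z0 rho h (S n) z).
Proof.
intros Hd HK Hz Hh Hest; assert (H0 := Cmod_ge_0 (z - z0)).
assert (Hy : forall y, Cmod (y - z) < d / 2 -> Cmod (y - z0) < rho).
{ intros y Hy; replace (y - z0)%C with ((y - z) + (z - z0))%C by ring.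
  eapply Rle_lt_trans; [apply Cmod_triangle|]; lra. }
destruct (rcont_bounded h 0 (2 * PI) two_pi_pos) as [M [HM HhM]]; [auto|].
eapply cderiv_eq.
- apply (cderiv_cI_param (fun z t => h t * (/ (circle z0 rho t - z)) ^ n)%C
    (fun t => RtoC (INR n) * (h t * (/ (circle z0 rho t - z)) ^ S n))%C 0 (2 * PI) z (M * K) (d / 2)).
  + apply two_pi_pos.
  + lra.
  + now apply Rmult_le_pos.
  + intros y t Hyz _; apply rcont_kernel; auto.
  + intros t _; apply rcont_mult; [apply rcont_const|apply rcont_kernel; [lra|trivial]].
  + intros y t Hyz Ht.
    replace (circle z0 rho t - y)%C with ((circle z0 rho t - z) - (y - z))%C by ring.
    match goal with |- Cmod ?x <= _ => replace x with
      (h t * ((/ ((circle z0 rho t - z) - (y - z))) ^ n - (/ (circle z0 rho t - z)) ^ n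
        - (y - z) * (RtoC (INR n) * (/ (circle z0 rho t - z)) ^ S n)))%C by ring end.
    rewrite Cmod_mult, Rmult_assoc; apply Rmult_le_compat; auto using Cmod_ge_0.
    apply Hest; trivial; assert (Hl := circle_dist_lower z0 z rho t); lra.
- apply cI_unique, cint_mult_l, cI_correct; [apply two_pi_pos|].
  intros t _; apply rcont_kernel; [lra|trivial].
Qed.

Lemma inv_pos_lower (a e : C) (d : R) : 0 < d -> d <= Cmod a -> Cmod e < d / 2 ->
  a <> 0 /\ (a - e)%C <> 0 /\ d / 2 <= Cmod (a - e) /\ Cmod a <= 2 * Cmod (a - e).
Proof.
intros Hd Ha He.
assert (T := Cmod_triangle (a - e) e); replace (a - e + e)%C with a in T by ring.
repeat split; try lra; apply Cmod_gt_0; lra.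
Qed.

Lemma cauchy_kernel_1_cderiv (z0 : C) (rho : R) (h : R -> C) (z : C) :
  Cmod (z - z0) < rho -> (forall t, rcont h t) ->
  cderiv (cauchy_kernel z0 rho h 1) z (cauchy_kernel z0 rho h 2 z).
Proof.
intros Hz Hh; pose (d := rho - Cmod (z - z0)).
assert (Hd : 0 < d) by (unfold d; lra).
eapply cderiv_eq.
- apply (cauchy_kernel_cderiv z0 rho h 1 z (2 / (d * d * d)) d); trivial.
  + apply Rlt_le, Rdiv_lt_0_compat; [lra|now repeat apply Rmult_lt_0_compat].
  + unfold d; lra.
  + intros a e Ha He; destruct (inv_pos_lower a e d Hd Ha He) as (A0 & A1 & A2 & _).
    replace ((/ (a - e)) ^ 1 - (/ a) ^ 1 - e * (INR 1 * (/ a) ^ 2))%C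
      with (/ (a - e) * / a * / a * (e * e))%C by (simpl; field; auto).
    rewrite !Cmod_mult, !Cmod_inv by trivial.
    apply Rmult_le_compat_r; [assert (H := Cmod_ge_0 e); nra|].
    replace (2 / (d * d * d)) with (/ (d / 2) * / d * / d) by (field; lra).
    assert (I1 : / Cmod a <= / d) by (apply Rinv_le_contravar; lra).
    assert (I2 : / Cmod (a - e) <= / (d / 2)) by (apply Rinv_le_contravar; lra).
    assert (P1 : 0 < / Cmod a) by (apply Rinv_0_lt_compat; lra).
    assert (P2 : 0 < / Cmod (a - e)) by (apply Rinv_0_lt_compat; lra).
    repeat apply Rmult_le_compat; try lra; apply Rmult_le_pos; lra.
- simpl; ring.
Qed.

Lemma cauchy_kernel_2_cderiv (z0 : C) (rho : R) (h : R -> C) (z : C) :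
  Cmod (z - z0) < rho -> (forall t, rcont h t) ->
  cderiv (cauchy_kernel z0 rho h 2) z (2 * cauchy_kernel z0 rho h 3 z).
Proof.
intros Hz Hh; pose (d := rho - Cmod (z - z0)).
assert (Hd : 0 < d) by (unfold d; lra).
eapply cderiv_eq.
(* The remainder is [(3 a - 2 e) e^2 / (a^3 (a - e)^2)]. Here [|3 a - 2 e| <= 4 |a|] because
   [2 |e| < d <= |a|], and [|a - e| >= d / 2]; the constant is 4 times two factors [1 / d] and two
   factors [2 / d]. *)
- apply (cauchy_kernel_cderiv z0 rho h 2 z (16 / (d * d * d * d)) d); trivial.
  + apply Rlt_le, Rdiv_lt_0_compat; [lra|now repeat apply Rmult_lt_0_compat].
  + unfold d; lra.
  + intros a e Ha He; destruct (inv_pos_lower a e d Hd Ha He) as (A0 & A1 & A2 & A3).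
    replace ((/ (a - e)) ^ 2 - (/ a) ^ 2 - e * (INR 2 * (/ a) ^ 3))%C
      with ((3 * a - 2 * e) * / a * / a * / a * / (a - e) * / (a - e) * (e * e))%C
      by (rewrite (S_INR 1), INR_1, RtoC_plus; simpl; field; auto).
    rewrite !Cmod_mult, !Cmod_inv by trivial.
    apply Rmult_le_compat_r; [assert (H := Cmod_ge_0 e); nra|].
    assert (P1 : 0 < / Cmod a) by (apply Rinv_0_lt_compat; lra).
    assert (P2 : 0 < / Cmod (a - e)) by (apply Rinv_0_lt_compat; lra).
    assert (I0 : Cmod (3 * a - 2 * e) * / Cmod a <= 4).
    { apply Rmult_le_reg_r with (Cmod a); [lra|].
      rewrite Rmult_assoc, Rinv_l, Rmult_1_r by lra.
      assert (T := Cmod_triangle (3 * a) (- (2 * e))).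
      rewrite Cmod_opp, !Cmod_mult, !Cmod_R, !Rabs_pos_eq in T by lra.
      unfold Cminus; lra. }
    replace (16 / (d * d * d * d)) with (4 * / d * / d * / (d / 2) * / (d / 2)) by (field; lra).
    assert (I1 : / Cmod a <= / d) by (apply Rinv_le_contravar; lra).
    assert (I2 : / Cmod (a - e) <= / (d / 2)) by (apply Rinv_le_contravar; lra).
    assert (P0 := Cmod_ge_0 (3 * a - 2 * e)).
    revert I0; generalize 4; intros c4 I0.
    repeat apply Rmult_le_compat; try lra; repeat apply Rmult_le_pos; lra.
- simpl INR; rewrite RtoC_plus; ring.
Qed.

(** A total function, unspecified where [F] has no derivative, so that derivatives can be
    iterated. *)
Definition Dc (F : C -> C) (z : C) : C := epsilon (inhabits (RtoC 0)) (cderiv F z).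

Lemma Dc_correct (F : C -> C) (z : C) : cdiff F z -> cderiv F z (Dc F z).
Proof. intros H; exact (epsilon_spec (inhabits (RtoC 0)) (cderiv F z) H). Qed.

Lemma Dc_unique (F : C -> C) (z l : C) : cderiv F z l -> Dc F z = l.
Proof. intros H; apply (cderiv_unique F z); trivial; apply Dc_correct; now exists l. Qed.

Lemma cdiff_rcont_circle (F : C -> C) (z0 : C) (rho Rd : R) :
  0 <= rho < Rd -> (forall w, Cmod (w - z0) < Rd -> cdiff F w) ->
  forall t, rcont (fun t => F (circle z0 rho t) * dcircle rho t)%C t.
Proof.
intros HR HF t; apply rcont_mult; [|apply rcont_dcircle].
apply rcont_cdiff; [apply HF; rewrite Cmod_circle; lra|apply rcont_circle].
Qed.

Lemma cauchy_formula_kernel (F : C -> C) (z0 : C) (rho Rd : R) :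
  0 <= rho < Rd -> (forall w, Cmod (w - z0) < Rd -> cdiff F w) ->
  forall z, Cmod (z - z0) < rho ->
  F z = (/ (2 * PI * Ci) * cauchy_kernel z0 rho (fun t => F (circle z0 rho t) * dcircle rho t) 1 z)%C.
Proof.
intros HR HF z Hz.
replace (cauchy_kernel z0 rho (fun t => F (circle z0 rho t) * dcircle rho t)%C 1 z)
  with (2 * PI * Ci * F z)%C.
- field; assert (H := PI_RGT_0); repeat split; intros E; injection E; lra.
- symmetry; apply cI_unique; eapply cint_ext; [apply two_pi_pos| |
    apply (cauchy_formula F z0 z rho Rd); trivial; lra].
  intros t _; simpl; unfold Cdiv; ring.
Qed.

(** On the disc of half the radius [F] is a Cauchy-type integral, so its derivative is the integral
    with the squared kernel, which can be differentiated again. *)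
Theorem cdiff_Dc (F : C -> C) (z0 : C) (Rd : R) : 0 < Rd ->
  (forall w, Cmod (w - z0) < Rd -> cdiff F w) -> cdiff (Dc F) z0.
Proof.
intros HR HF; set (rho := Rd / 2).
set (h := fun t => (F (circle z0 rho t) * dcircle rho t)%C).
assert (Hh : forall t, rcont h t) by (apply (cdiff_rcont_circle F z0 rho Rd); trivial; unfold rho; lra).
assert (HK := cauchy_formula_kernel F z0 rho Rd ltac:(unfold rho; lra) HF); fold h in HK.
assert (HD : forall z, Cmod (z - z0) < rho -> Dc F z = (/ (2 * PI * Ci) * cauchy_kernel z0 rho h 2 z)%C).
{ intros z Hz; apply Dc_unique.
  apply (cderiv_ext (fun z => / (2 * PI * Ci) * cauchy_kernel z0 rho h 1 z)%C) with (d := rho - Cmod (z - z0)); [lra| |].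
  - intros w Hw; symmetry; apply HK.
    replace (w - z0)%C with ((w - z) + (z - z0))%C by ring.
    eapply Rle_lt_trans; [apply Cmod_triangle|lra].
  - eapply cderiv_eq; [apply cderiv_mult; [apply cderiv_const|now apply cauchy_kernel_1_cderiv]|].
    now rewrite Cmult_0_l, Cplus_0_l. }
apply (cdiff_ext (fun z => / (2 * PI * Ci) * cauchy_kernel z0 rho h 2 z)%C) with (d := rho); [unfold rho; lra| |].
- intros w Hw; symmetry; now apply HD.
- eexists; apply cderiv_mult; [apply cderiv_const|apply cauchy_kernel_2_cderiv; trivial].
  replace (z0 - z0)%C with (RtoC 0) by ring; rewrite Cmod_0; unfold rho; lra.
Qed.

Definition divided_difference (F : C -> C) (z0 z : C) : C :=
  if excluded_middle_informative (z = z0) then Dc F z0 else ((F z - F z0) / (z - z0))%C.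

Lemma divided_difference_eq (F : C -> C) (z0 z : C) :
  F z = (F z0 + (z - z0) * divided_difference F z0 z)%C.
Proof.
unfold divided_difference; destruct (excluded_middle_informative (z = z0)) as [->|H]; [ring|].
field; intros E; apply H; replace z with (z - z0 + z0)%C by ring; rewrite E; ring.
Qed.

(** Off [z0] this is the quotient rule. Near [z0] the identity [1 / (w - y) - 1 / (w - z0) = (y -
    z0) / ((w - y) (w - z0))] shows that the divided difference is again a Cauchy-type integral,
    with density [h / (w - z0)]; this includes the value [Dc F z0] at [z0]. *)
Theorem cdiff_divided_difference (F : C -> C) (z0 : C) (Rd : R) :
  (forall w, Cmod (w - z0) < Rd -> cdiff F w) ->
  forall z, Cmod (z - z0) < Rd -> cdiff (divided_difference F z0) z.
Proof.
intros HF z Hz.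
assert (HR : 0 < Rd) by (eapply Rle_lt_trans; [apply Cmod_ge_0|exact Hz]).
destruct (classic (z = z0)) as [->|Hne].
- set (rho := Rd / 2).
  set (h := fun t => (F (circle z0 rho t) * dcircle rho t)%C).
  set (g := fun t => (h t * / (circle z0 rho t - z0))%C).
  assert (Hh : forall t, rcont h t) by (apply (cdiff_rcont_circle F z0 rho Rd); trivial; unfold rho; lra).
  assert (Hc : forall y t, Cmod (y - z0) < rho -> (circle z0 rho t - y)%C <> 0).
  { intros y t Hy; apply Cmod_gt_0; assert (H := circle_dist_lower z0 y rho t); unfold rho in *; lra. }
  assert (Hrho : 0 < rho) by (unfold rho; lra).
  assert (Hz0 : Cmod (z0 - z0) < rho).
  { replace (z0 - z0)%C with (RtoC 0) by ring; rewrite Cmod_0; lra. }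
  assert (Hg : forall t, rcont g t).
  { intros t; apply rcont_mult; trivial; apply rcont_inv; [auto|].
    apply rcont_plus; [apply rcont_circle|apply rcont_const]. }
  assert (HK := cauchy_formula_kernel F z0 rho Rd ltac:(unfold rho; lra) HF); fold h in HK.
  apply (cdiff_ext (fun y => / (2 * PI * Ci) * cauchy_kernel z0 rho g 1 y)%C) with (d := rho); trivial.
  + intros y Hy; unfold divided_difference; destruct (excluded_middle_informative (y = z0)) as [->|Hyz].
    * symmetry; apply Dc_unique.
      apply (cderiv_ext (fun z => / (2 * PI * Ci) * cauchy_kernel z0 rho h 1 z)%C) with (d := rho); trivial.
      -- intros w Hw; symmetry; auto.
      -- eapply cderiv_eq; [apply cderiv_mult; [apply cderiv_const|now apply cauchy_kernel_1_cderiv]|].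
         rewrite Cmult_0_l, Cplus_0_l; f_equal.
         apply cI_ext; intros t; unfold g; simpl; ring.
    * assert (Hyz' : (y - z0)%C <> 0).
      { intros E; apply Hyz; replace y with (y - z0 + z0)%C by ring; rewrite E; ring. }
      rewrite (HK y Hy), (HK z0 Hz0).
      assert (E : cauchy_kernel z0 rho h 1 y = (cauchy_kernel z0 rho h 1 z0 + (y - z0) * cauchy_kernel z0 rho g 1 y)%C).
      { apply cI_unique.
        apply (cint_ext (fun t => h t * (/ (circle z0 rho t - z0)) ^ 1 + (y - z0) * (g t * (/ (circle z0 rho t - y)) ^ 1))%C); [apply two_pi_pos| |].
        - intros t _; unfold g; simpl; field; split; auto.
        - apply cint_plus; [|apply cint_mult_l]; (apply cI_correct; [apply two_pi_pos|]);
            intros t _; now apply rcont_kernel. }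
      assert (H := PI_RGT_0).
      rewrite E; field; repeat split; trivial; intros E'; injection E'; lra.
  + eexists; apply cderiv_mult; [apply cderiv_const|now apply cauchy_kernel_1_cderiv].
- assert (Hne' : (z - z0)%C <> 0).
  { intros E; apply Hne; replace z with (z - z0 + z0)%C by ring; rewrite E; ring. }
  destruct (HF z Hz) as [l Hl].
  apply (cdiff_ext (fun y => (F y + - F z0) * / (y - z0))%C) with (d := Cmod (z - z0)).
  + now apply Cmod_gt_0.
  + intros y Hy; unfold divided_difference; destruct (excluded_middle_informative (y = z0)) as [->|_].
    * rewrite Cmod_minus_sym in Hy; lra.
    * reflexivity.
  + eexists; apply cderiv_mult; [apply cderiv_plus; [exact Hl|apply cderiv_const]|now apply cderiv_inv_sub].
Qed.

(** * Higher derivatives and principal parts *)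

Fixpoint Dc_n (n : nat) (F : C -> C) : C -> C :=
  match n with O => F | S n' => Dc (Dc_n n' F) end.

Lemma Cminus_neq_0 (z w : C) : z <> w -> (z - w)%C <> 0.
Proof. intros H E; apply H; replace z with (z - w + w)%C by ring; rewrite E; ring. Qed.

Lemma disc_sub (z0 z w : C) (r : R) :
  Cmod (w - z) < r - Cmod (z - z0) -> Cmod (w - z0) < r.
Proof.
intros H; replace (w - z0)%C with ((w - z) + (z - z0))%C by ring.
eapply Rle_lt_trans; [apply Cmod_triangle|lra].
Qed.

Lemma cdiff_Dc_n (F : C -> C) (z0 : C) (r : R) (n : nat) :
  (forall z, Cmod (z - z0) < r -> cdiff F z) ->
  forall z, Cmod (z - z0) < r -> cdiff (Dc_n n F) z.
Proof.
intros HF; induction n as [|n IH]; [exact HF|].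
intros z Hz; simpl; apply (cdiff_Dc _ z (r - Cmod (z - z0))); [lra|].
intros w Hw; apply IH, (disc_sub z0 z); exact Hw.
Qed.

Lemma Dc_n_ext (F G : C -> C) (z0 : C) (r : R) (n : nat) :
  (forall z, Cmod (z - z0) < r -> cdiff F z) ->
  (forall z, Cmod (z - z0) < r -> F z = G z) ->
  forall z, Cmod (z - z0) < r -> Dc_n n F z = Dc_n n G z.
Proof.
intros HF HE; induction n as [|n IH]; [exact HE|].
intros z Hz; simpl; symmetry; apply Dc_unique.
apply (cderiv_ext (Dc_n n F)) with (d := r - Cmod (z - z0)); [lra| |].
- intros w Hw; apply IH, (disc_sub z0 z); exact Hw.
- now apply Dc_correct, (cdiff_Dc_n F z0 r).
Qed.

(* Leibniz rule for [F = F z0 + (z - z0) * divided_difference F z0]. *)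
Lemma Dc_n_divided_difference (F : C -> C) (z0 : C) (r : R) (n : nat) :
  (forall z, Cmod (z - z0) < r -> cdiff F z) ->
  forall z, Cmod (z - z0) < r ->
  Dc_n (S n) F z = ((z - z0) * Dc_n (S n) (divided_difference F z0) z
    + RtoC (INR (S n)) * Dc_n n (divided_difference F z0) z)%C.
Proof.
intros HF; set (G := divided_difference F z0).
assert (HG := cdiff_divided_difference F z0 r HF); fold G in HG.
induction n as [|n IH]; intros z Hz.
- change (Dc F z = ((z - z0) * Dc G z + 1 * G z)%C); apply Dc_unique.
  apply (cderiv_ext (fun z => F z0 + (z - z0) * G z)%C) with (d := 1); [lra| |].
  + intros w _; symmetry; apply divided_difference_eq.
  + eapply cderiv_eq.
    * apply cderiv_plus; [apply cderiv_const|].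
      apply cderiv_mult; [apply cderiv_sub|now apply Dc_correct, HG].
    * cbv beta; ring.
- change (Dc (Dc_n (S n) F) z = ((z - z0) * Dc (Dc_n (S n) G) z + RtoC (INR (S (S n))) * Dc (Dc_n n G) z)%C).
  apply Dc_unique.
  apply (cderiv_ext (fun z => (z - z0) * Dc_n (S n) G z + RtoC (INR (S n)) * Dc_n n G z)%C)
    with (d := r - Cmod (z - z0)); [lra| |].
  + intros w Hw; symmetry; apply IH, (disc_sub z0 z); exact Hw.
  + eapply cderiv_eq.
    * apply cderiv_plus; apply cderiv_mult;
        [apply cderiv_sub| |apply cderiv_const|];
        apply Dc_correct; now apply (cdiff_Dc_n G z0 r).
    * cbv beta; rewrite (S_INR (S n)), RtoC_plus; simpl Dc_n; ring.
Qed.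

(* [I Q v] is to be read as: the integral of [Q] along a contour winding once around
   [z0] is [2 pi i v]. *)
Lemma principal_part (I : (C -> C) -> C -> Prop) (z0 : C) :
  (forall F G u v, I F u -> I G v -> I (fun z => F z + G z)%C (u + v)%C) ->
  (forall k F v, I F v -> I (fun z => k * F z)%C (k * v)%C) ->
  I (fun z => / (z - z0))%C 1 ->
  (forall n, I (fun z => (/ (z - z0)) ^ S (S n))%C 0) ->
  forall (k : nat) (G : C -> C) (r : R), 0 < r ->
  (forall z, Cmod (z - z0) < r -> cdiff G z) ->
  exists Q Rm : C -> C,
    I Q (Dc_n k G z0 / RtoC (INR (fact k)))%C /\
    (forall z, z <> z0 -> cdiff Q z) /\
    (forall z, Cmod (z - z0) < r -> cdiff Rm z) /\
    (forall z, Cmod (z - z0) < r -> z <> z0 -> (G z / (z - z0) ^ S k = Q z + Rm z)%C).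
Proof.
intros Iplus Iscal I1 In.
assert (Hpow : forall n z, z <> z0 -> cdiff (fun z => (/ (z - z0)) ^ n)%C z).
{ induction n as [|n IH]; intros z Hz; [exists (RtoC 0); apply (cderiv_const 1)|].
  destruct (IH z Hz) as [l Hl].
  exists (- (/ (z - z0) * / (z - z0)) * (/ (z - z0)) ^ n + / (z - z0) * l)%C.
  apply (cderiv_mult (fun z => / (z - z0))%C); trivial.
  now apply cderiv_inv_sub, Cminus_neq_0. }
assert (Hspow : forall a n z, z <> z0 -> cdiff (fun z => a * (/ (z - z0)) ^ n)%C z).
{ intros a n z Hz; destruct (Hpow n z Hz) as [l Hl].
  eexists; apply cderiv_mult; [apply cderiv_const|exact Hl]. }
induction k as [|k IH]; intros G r Hr HG.
- exists (fun z => G z0 * / (z - z0))%C, (divided_difference G z0); split; [|split; [|split]].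
  + replace (Dc_n 0 G z0 / INR (fact 0))%C with (G z0 * 1)%C; [now apply Iscal|].
    simpl; field; intros E; injection E; lra.
  + intros z Hz; destruct (Hspow (G z0) 1%nat z Hz) as [l Hl]; exists l.
    apply (cderiv_ext (fun z => G z0 * (/ (z - z0)) ^ 1)%C) with (d := 1); trivial; [lra|].
    intros w _; simpl; ring.
  + now apply cdiff_divided_difference.
  + intros z _ Hz; rewrite (divided_difference_eq G z0 z); simpl; field; now apply Cminus_neq_0.
(* Splitting off [G z0] lowers the order of the pole by one, and the split-off power of order at
   least 2 contributes 0. At [z0] the Leibniz rule says that the derivative of order [S k] of [G] is
   [S k] times the [k]-th derivative of the divided difference, which matches the quotient of
   factorials. *)
- destruct (IH (divided_difference G z0) r Hr (cdiff_divided_difference G z0 r HG))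
    as (Q & Rm & H1 & H2 & H3 & H4).
  exists (fun z => Q z + G z0 * (/ (z - z0)) ^ S (S k))%C, Rm; split; [|split; [|split]]; trivial.
  + replace (Dc_n (S k) G z0 / INR (fact (S k)))%C
      with (Dc_n k (divided_difference G z0) z0 / INR (fact k) + G z0 * 0)%C.
    * apply Iplus; trivial; now apply Iscal.
    * rewrite (Dc_n_divided_difference G z0 r k HG);
        [|replace (z0 - z0)%C with (RtoC 0) by ring; now rewrite Cmod_0].
      rewrite fact_simpl, mult_INR, RtoC_mult.
      assert (Hf : RtoC (INR (fact k)) <> 0) by (intros E; apply RtoC_inj in E; now apply (INR_fact_neq_0 k)).
      assert (Hk : RtoC (INR (S k)) <> 0) by (intros E; apply RtoC_inj in E; now apply (not_0_INR (S k))).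
      field; split; trivial.
  + intros z Hz; destruct (H2 z Hz) as [l Hl]; destruct (Hspow (G z0) (S (S k)) z Hz) as [m Hm].
    eexists; apply cderiv_plus; [exact Hl|exact Hm].
  + intros z Hz Hne; assert (Hne' := Cminus_neq_0 _ _ Hne).
    rewrite (divided_difference_eq G z0 z).
    replace (Q z + G z0 * (/ (z - z0)) ^ S (S k) + Rm z)%C
      with (Q z + Rm z + G z0 * (/ (z - z0)) ^ S (S k))%C by ring.
    rewrite <- (H4 z Hz Hne), Cpow_inv by trivial.
    assert (Hp : ((z - z0) ^ k)%C <> 0) by now apply Cpow_nz.
    simpl; field; auto.
Qed.

(** * The logarithmic chart *)

Definition Lp (p : R * R) : C := (ln (fst p), snd p).
Definition Ep (z : C) : R * R := (exp (fst z), snd z).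

Lemma Ep_Lp (p : R * R) : halfplane p -> Ep (Lp p) = p.
Proof. intros H; unfold Ep, Lp; simpl; rewrite exp_ln by exact H; now destruct p. Qed.

Lemma Lp_Ep (z : C) : Lp (Ep z) = z.
Proof. unfold Ep, Lp; simpl; rewrite ln_exp; now destruct z. Qed.

Lemma halfplane_Ep (z : C) : halfplane (Ep z).
Proof. apply exp_pos. Qed.

Lemma Cmod_lt_components (z : C) (d : R) :
  Rabs (fst z) < d / 2 -> Rabs (snd z) < d / 2 -> Cmod z < d.
Proof.
intros H1 H2; eapply Rle_lt_trans; [apply Cmod_2Rmax|].
assert (Hs : sqrt 2 < 2).
{ rewrite <- (sqrt_Rsqr 2) at 2 by lra; apply sqrt_lt_1; unfold Rsqr; lra. }
assert (Hs0 := sqrt_pos 2).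
assert (Rmax (Rabs (fst z)) (Rabs (snd z)) < d / 2) by (apply Rmax_lub_lt; lra).
assert (0 <= Rmax (Rabs (fst z)) (Rabs (snd z))).
{ eapply Rle_trans; [apply Rabs_pos|apply Rmax_l]. }
nra.
Qed.

Lemma Ep_near (z0 : C) (N : R * R -> Prop) : locally (Ep z0) N ->
  exists d, 0 < d /\ forall w, Cmod (w - z0) < d -> N (Ep w).
Proof.
intros [e He].
assert (Hc : continuity_pt exp (fst z0)) by (apply derivable_continuous_pt, derivable_pt_exp).
destruct (Hc e (cond_pos e)) as [d [Hd Hx]].
exists (Rmin d e); split; [apply Rmin_glb_lt; [exact Hd|apply cond_pos]|].
intros w Hw; apply He.
assert (Hr := Rmax_Cmod (w - z0)%C); simpl in Hr.
assert (H1 : Rabs (fst w + - fst z0) < Rmin d e).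
{ eapply Rle_lt_trans; [|exact Hw]; eapply Rle_trans; [apply Rmax_l|exact Hr]. }
assert (H2 : Rabs (snd w + - snd z0) < Rmin d e).
{ eapply Rle_lt_trans; [|exact Hw]; eapply Rle_trans; [apply Rmax_r|exact Hr]. }
split.
- destruct (Req_dec (fst w) (fst z0)) as [E|E].
  + unfold Ep; simpl; rewrite E; apply ball_center.
  + apply (Hx (fst w)); split.
    * split; [exact I|now apply not_eq_sym].
    * eapply Rlt_le_trans; [exact H1|apply Rmin_l].
- eapply Rlt_le_trans; [exact H2|apply Rmin_r].
Qed.

Lemma Lp_near (p : R * R) (d : R) : halfplane p -> 0 < d ->
  locally p (fun q => halfplane q /\ Cmod (Lp q - Lp p) < d).
Proof.
destruct p as [p1 p2]; intros Hp Hd; unfold halfplane in Hp; simpl in Hp.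
assert (Hc : continuity_pt ln (p1)).
{ apply derivable_continuous_pt; exists (/ p1); now apply derivable_pt_lim_ln. }
destruct (Hc (d / 2)) as [e [He Hx]]; [lra|].
assert (Hm : 0 < Rmin (p1) (Rmin e (d / 2))) by (repeat apply Rmin_glb_lt; trivial; lra).
exists (mkposreal _ Hm); intros [q1 q2] [H1 H2]; simpl in H1, H2.
assert (M1 := Rmin_l (p1) (Rmin e (d / 2))).
assert (M2 := Rmin_r (p1) (Rmin e (d / 2))).
assert (M3 := Rmin_l e (d / 2)).
assert (M4 := Rmin_r e (d / 2)).
change (Rabs (q1 + - p1) < Rmin (p1) (Rmin e (d / 2))) in H1.
change (Rabs (q2 + - p2) < Rmin (p1) (Rmin e (d / 2))) in H2.
split.
- unfold halfplane; simpl; destruct (Rabs_def2 _ _ H1); lra.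
- apply Cmod_lt_components; simpl; [|lra].
  destruct (Req_dec (q1) (p1)) as [E|E].
  + rewrite E, Rplus_opp_r, Rabs_R0; lra.
  + apply (Hx (q1)); split.
    * split; [exact I|now apply not_eq_sym].
    * change (Rabs (q1 + - p1) < e); lra.
Qed.

(** * The complex exponential *)

Definition cexp (z : C) : C := (RtoC (exp (fst z)) * cis (snd z))%C.

Lemma cexp_plus (z w : C) : cexp (z + w) = (cexp z * cexp w)%C.
Proof.
unfold cexp; simpl; rewrite exp_plus; unfold cis.
rewrite cos_plus, sin_plus; unfold RtoC, Cmult; simpl.
apply injective_projections; simpl; ring.
Qed.

Lemma cexp_neq_0 (z : C) : cexp z <> 0.
Proof.
apply Cmod_gt_0; unfold cexp; rewrite Cmod_mult, Cmod_cis, Cmod_R, Rabs_pos_eq, Rmult_1_r;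
  [apply exp_pos|left; apply exp_pos].
Qed.

(* With [exp x = 1 + x + o(x)] and [cis y = 1 + iy + o(y)],
   [exp x cis y - 1 - x - iy = (exp x - 1 - x) cis y + x (cis y - 1) + (cis y - 1 - iy)]. *)
Lemma cderiv_cexp_0 : cderiv cexp 0 1.
Proof.
intros eps Heps.
assert (H1 : rderiv (fun x => RtoC (exp x)) 0 1).
{ apply rderiv_pair; simpl; auto_derive; trivial; rewrite exp_0; ring. }
assert (H2 : rderiv cis 0 Ci).
{ eapply rderiv_eq; [apply rderiv_cis|]; unfold cis; rewrite cos_0, sin_0; apply Cmult_1_r. }
destruct (proj1 (rderiv_eps _ _ _) H1 (eps / 3)) as [d1 [Hd1 E1]]; [lra|].
destruct (proj1 (rderiv_eps _ _ _) H2 (eps / 3)) as [d2 [Hd2 E2]]; [lra|].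
destruct (proj1 (rcont_eps _ _) (rcont_cis 0) (eps / 3)) as [d3 [Hd3 E3]]; [lra|].
exists (Rmin d1 (Rmin d2 d3)); split; [repeat apply Rmin_glb_lt; trivial|].
intros w Hw.
assert (M1 := Rmin_l d1 (Rmin d2 d3)); assert (M2 := Rmin_r d1 (Rmin d2 d3)).
assert (M3 := Rmin_l d2 d3); assert (M4 := Rmin_r d2 d3).
assert (Hr := Rmax_Cmod (w - 0)%C); simpl in Hr.
assert (Hl1 := Rmax_l (Rabs (fst w + - 0)) (Rabs (snd w + - 0))).
assert (Hl2 := Rmax_r (Rabs (fst w + - 0)) (Rabs (snd w + - 0))).
specialize (E1 (fst w)); specialize (E2 (snd w)); specialize (E3 (snd w)).
unfold Rminus in E1, E2, E3.
assert (E1' := E1 ltac:(lra)); assert (E2' := E2 ltac:(lra)); assert (E3' := E3 ltac:(lra)).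
clear E1 E2 E3.
assert (Hc0 : cis 0 = 1) by (unfold cis; rewrite cos_0, sin_0; reflexivity).
rewrite Hc0 in E2', E3'; rewrite exp_0 in E1'.
rewrite Ropp_0, !Rplus_0_r in *.
assert (C0 : cexp 0 = 1) by (unfold cexp; simpl; rewrite exp_0, Hc0; ring).
rewrite C0.
replace (cexp w - 1 - 1 * (w - 0))%C with
  ((RtoC (exp (fst w)) - 1 - 1 * RtoC (fst w)) * cis (snd w)
   + (RtoC (fst w) * (cis (snd w) - 1) + (cis (snd w) - 1 - Ci * RtoC (snd w))))%C.
- eapply Rle_trans; [apply Cmod_triangle|].
  assert (T := Cmod_triangle (RtoC (fst w) * (cis (snd w) - 1)) (cis (snd w) - 1 - Ci * RtoC (snd w))).
  rewrite !Cmod_mult, Cmod_cis, Cmod_R in *.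
  assert (P1 := Rabs_pos (fst w)); assert (P2 := Rabs_pos (snd w)).
  assert (P3 := Cmod_ge_0 (cis (snd w) - 1)).
  assert (Q : Rabs (fst w) * Cmod (cis (snd w) - 1) <= Cmod (w - 0) * (eps / 3)).
  { apply Rmult_le_compat; lra. }
  assert (Q1 : eps / 3 * Rabs (fst w) <= eps / 3 * Cmod (w - 0)) by (apply Rmult_le_compat_l; lra).
  assert (Q2 : eps / 3 * Rabs (snd w) <= eps / 3 * Cmod (w - 0)) by (apply Rmult_le_compat_l; lra).
  lra.
- unfold cexp; destruct w as [x y]; unfold cis, RtoC, Ci, Cminus, Cplus, Copp, Cmult; simpl.
  apply injective_projections; simpl; ring.
Qed.

Lemma cderiv_cexp (z : C) : cderiv cexp z (cexp z).
Proof.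
eapply cderiv_eq.
- apply (cderiv_ext (fun w => cexp z * cexp (w - z))%C) with (d := 1); [lra| |].
  + intros w _; rewrite <- cexp_plus; f_equal; ring.
  + apply cderiv_mult; [apply cderiv_const|].
    apply (cderiv_comp cexp (fun w => w - z)%C); [|apply cderiv_sub].
    replace (z - z)%C with (RtoC 0) by ring; apply cderiv_cexp_0.
- cbv beta; ring.
Qed.

Lemma polar_to_C_Ep (z : C) : polar_to_C (Ep z) = cexp z.
Proof. reflexivity. Qed.

(** Because [theta] is not reduced, real powers are single-valued and entire in the chart. *)
Lemma polar_pow_Ep (a : R) (z : C) : polar_pow a (Ep z) = cexp (a * z).
Proof.
unfold polar_pow, cexp, Ep, Rpower; simpl; rewrite ln_exp.
do 2 f_equal; [f_equal|]; ring.
Qed.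

(** * Polar derivatives in the chart *)

Lemma is_Dpol_eps (f : R * R -> C) (p : R * R) (l : C) :
  is_Dpol f p l <-> forall eps, 0 < eps -> locally p (fun q => q <> p ->
    Cmod ((f q - f p) / (polar_to_C q - polar_to_C p) - l) < eps).
Proof.
split.
- intros H eps Heps.
  assert (L : locally (T := C_UniformSpace) l (fun z => Cmod (z - l) < eps)).
  { apply locally_C; exists (mkposreal eps Heps); intros y Hy; exact Hy. }
  exact (H _ L).
- intros H P HP; apply locally_C in HP; destruct HP as [e He].
  destruct (H e (cond_pos e)) as [d Hd]; exists d; intros q Hq Hne; apply He, (Hd q Hq Hne).
Qed.

(** Difference quotients in [r e^(i theta)] and in [z] can be exchanged thanks to this two-sided
    bound. It comes from a first-order error of at most half the slope [Cmod (cexp z0)]. *)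
Lemma cexp_expand (z0 : C) : exists d, 0 < d /\ forall w, Cmod (w - z0) < d ->
  Cmod (cexp z0) / 2 * Cmod (w - z0) <= Cmod (cexp w - cexp z0) /\
  Cmod (cexp w - cexp z0) <= 2 * Cmod (cexp z0) * Cmod (w - z0).
Proof.
assert (Hp : 0 < Cmod (cexp z0)) by apply Cmod_gt_0, cexp_neq_0.
destruct (cderiv_cexp z0 (Cmod (cexp z0) / 2)) as [d [Hd H]]; [lra|].
exists d; split; trivial; intros w Hw; specialize (H w Hw).
assert (H0 := Cmod_ge_0 (w - z0)); split.
- assert (T := Cmod_triangle (cexp w - cexp z0) (- (cexp w - cexp z0 - cexp z0 * (w - z0)))).
  replace (cexp w - cexp z0 + - (cexp w - cexp z0 - cexp z0 * (w - z0)))%C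
    with (cexp z0 * (w - z0))%C in T by ring.
  rewrite Cmod_opp, Cmod_mult in T; nra.
- assert (T := Cmod_triangle (cexp w - cexp z0 - cexp z0 * (w - z0)) (cexp z0 * (w - z0))).
  replace (cexp w - cexp z0 - cexp z0 * (w - z0) + cexp z0 * (w - z0))%C
    with (cexp w - cexp z0)%C in T by ring.
  rewrite Cmod_mult in T; nra.
Qed.

Lemma is_Dpol_cderiv (f : R * R -> C) (z0 l : C) :
  is_Dpol f (Ep z0) l -> cderiv (fun z => f (Ep z)) z0 (l * cexp z0).
Proof.
intros H eps Heps; assert (HD := proj1 (is_Dpol_eps _ _ _) H); clear H.
assert (Hp : 0 < Cmod (cexp z0)) by apply Cmod_gt_0, cexp_neq_0.
set (P := Cmod (cexp z0)) in *; assert (Hl := Cmod_ge_0 l).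
(* An increment of [cexp] is at most [2 * P] times that of [z], so this tolerance costs [eps / 2];
   the other half pays for the linearization of [cexp]. *)
specialize (HD (eps / (4 * P))); apply Ep_near in HD; [|apply Rdiv_lt_0_compat; lra].
destruct HD as [d1 [Hd1 H1]].
destruct (cexp_expand z0) as [d2 [Hd2 H2]]; fold P in H2.
destruct (cderiv_cexp z0 (eps / (2 * (1 + Cmod l)))) as [d3 [Hd3 H3]]; [apply Rdiv_lt_0_compat; lra|].
exists (Rmin d1 (Rmin d2 d3)); split; [repeat apply Rmin_glb_lt; trivial|].
intros w Hw.
assert (M1 := Rmin_l d1 (Rmin d2 d3)); assert (M2 := Rmin_r d1 (Rmin d2 d3)).
assert (M3 := Rmin_l d2 d3); assert (M4 := Rmin_r d2 d3).
destruct (classic (w = z0)) as [->|Hne].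
{ replace (f (Ep z0) - f (Ep z0) - l * cexp z0 * (z0 - z0))%C with (RtoC 0) by ring.
  rewrite Cmod_0; apply Rmult_le_pos; [lra|apply Cmod_ge_0]. }
assert (Hm : 0 < Cmod (w - z0)) by now apply Cmod_gt_0, Cminus_neq_0.
destruct (H2 w) as [L2 U2]; [lra|]; specialize (H3 w ltac:(lra)).
specialize (H1 w ltac:(lra)); rewrite !polar_to_C_Ep in H1.
assert (H1' : Cmod ((f (Ep w) - f (Ep z0)) / (cexp w - cexp z0) - l) < eps / (4 * P)).
{ apply H1; intros E; apply Hne; rewrite <- (Lp_Ep w), E; apply Lp_Ep. }
assert (Hd : (cexp w - cexp z0)%C <> 0) by (apply Cmod_gt_0; nra).
replace (f (Ep w) - f (Ep z0) - l * cexp z0 * (w - z0))%C with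
  (((f (Ep w) - f (Ep z0)) / (cexp w - cexp z0) - l) * (cexp w - cexp z0)
   + l * (cexp w - cexp z0 - cexp z0 * (w - z0)))%C by (field; trivial).
eapply Rle_trans; [apply Cmod_triangle|]; rewrite !Cmod_mult.
apply Rle_trans with (eps / (4 * P) * (2 * P * Cmod (w - z0))
  + (1 + Cmod l) * (eps / (2 * (1 + Cmod l)) * Cmod (w - z0))).
- apply Rplus_le_compat; apply Rmult_le_compat; try apply Cmod_ge_0; lra.
- right; field; lra.
Qed.

Lemma cderiv_is_Dpol (f : R * R -> C) (p : R * R) (m : C) : halfplane p ->
  cderiv (fun z => f (Ep z)) (Lp p) m -> is_Dpol f p (m / cexp (Lp p)).
Proof.
intros Hhp H; apply is_Dpol_eps; intros eps Heps; set (z0 := Lp p) in *.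
assert (Hp : 0 < Cmod (cexp z0)) by apply Cmod_gt_0, cexp_neq_0.
set (P := Cmod (cexp z0)) in *; assert (Hm := Cmod_ge_0 m).
(* Over the denominator [cexp z0 * (cexp w - cexp z0)], of modulus at least [P^2 / 2] times
   [|w - z0|], the numerator is at most [e (P + |m|) |w - z0|]; this [e] makes the quotient at most
   [eps / 2]. *)
pose (e := eps * P * P / (4 * (P + Cmod m))).
assert (He : 0 < e).
{ apply Rdiv_lt_0_compat; [repeat apply Rmult_lt_0_compat|]; lra. }
destruct (H e He) as [d1 [Hd1 H1]].
destruct (cexp_expand z0) as [d2 [Hd2 H2]]; fold P in H2.
destruct (cderiv_cexp z0 e He) as [d3 [Hd3 H3]].
assert (Hmin : 0 < Rmin d1 (Rmin d2 d3)) by (repeat apply Rmin_glb_lt; trivial).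
generalize (Lp_near p _ Hhp Hmin); apply filter_imp.
intros q [Hq Hqd] Hne; fold z0 in Hqd; set (w := Lp q) in *.
assert (M1 := Rmin_l d1 (Rmin d2 d3)); assert (M2 := Rmin_r d1 (Rmin d2 d3)).
assert (M3 := Rmin_l d2 d3); assert (M4 := Rmin_r d2 d3).
assert (Hwz : w <> z0).
{ intros E; apply Hne; rewrite <- (Ep_Lp q Hq), <- (Ep_Lp p Hhp); unfold w, z0 in E; now rewrite E. }
assert (Hm0 : 0 < Cmod (w - z0)) by now apply Cmod_gt_0, Cminus_neq_0.
destruct (H2 w) as [L2 U2]; [lra|]; specialize (H3 w ltac:(lra)); specialize (H1 w ltac:(lra)).
assert (Hd : (cexp w - cexp z0)%C <> 0) by (apply Cmod_gt_0; nra).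
assert (Eq : f q = f (Ep w)) by (unfold w; now rewrite Ep_Lp).
assert (Epp : f p = f (Ep z0)) by (unfold z0; now rewrite Ep_Lp).
assert (Pq : polar_to_C q = cexp w) by (unfold w; now rewrite <- polar_to_C_Ep, Ep_Lp).
assert (Pp : polar_to_C p = cexp z0) by (unfold z0; now rewrite <- polar_to_C_Ep, Ep_Lp).
rewrite Eq, Epp, Pq, Pp.
assert (Hc := cexp_neq_0 z0).
replace ((f (Ep w) - f (Ep z0)) / (cexp w - cexp z0) - m / cexp z0)%C with
  ((cexp z0 * (f (Ep w) - f (Ep z0) - m * (w - z0)) - m * (cexp w - cexp z0 - cexp z0 * (w - z0)))
   / (cexp z0 * (cexp w - cexp z0)))%C by (field; auto).
rewrite Cmod_div by now apply Cmult_neq_0.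
rewrite Cmod_mult; fold P.
assert (HN : Cmod (cexp z0 * (f (Ep w) - f (Ep z0) - m * (w - z0)) - m * (cexp w - cexp z0 - cexp z0 * (w - z0)))
  <= P * (e * Cmod (w - z0)) + Cmod m * (e * Cmod (w - z0))).
{ eapply Rle_trans; [apply Cmod_triangle|]; rewrite Cmod_opp, !Cmod_mult; fold P.
  apply Rplus_le_compat; apply Rmult_le_compat_l; trivial; lra. }
assert (Hden : 0 < P * Cmod (cexp w - cexp z0)) by (apply Rmult_lt_0_compat; [|nra]; trivial).
apply Rmult_lt_reg_r with (P * Cmod (cexp w - cexp z0)); trivial.
unfold Rdiv; rewrite Rmult_assoc, Rinv_l, Rmult_1_r by lra.
eapply Rle_lt_trans; [exact HN|].
apply Rlt_le_trans with (eps * (P * (P / 2 * Cmod (w - z0)))).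
- replace (P * (e * Cmod (w - z0)) + Cmod m * (e * Cmod (w - z0)))
    with (eps * P * P / 4 * Cmod (w - z0)) by (unfold e; field; lra).
  assert (0 < eps * P * P * Cmod (w - z0)) by (repeat apply Rmult_lt_0_compat; trivial); lra.
- apply Rmult_le_compat_l; [lra|]; apply Rmult_le_compat_l; lra.
Qed.

Lemma polar_analytic_cdiff (U : R * R -> Prop) (f : R * R -> C) (z : C) :
  polar_analytic U f -> U (Ep z) -> cdiff (fun z => f (Ep z)) z.
Proof.
intros (_ & _ & H) Hz; destruct (H _ Hz) as [l Hl]; eexists; exact (is_Dpol_cderiv f z l Hl).
Qed.

Lemma open_Ep (U : R * R -> Prop) (z : C) : open U -> U (Ep z) ->
  exists d, 0 < d /\ forall w, Cmod (w - z) < d -> U (Ep w).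
Proof. intros HU Hz; now apply Ep_near, HU. Qed.

Lemma Cdiv_eq (y l e : C) : e <> 0 -> (y * e)%C = l -> y = (l / e)%C.
Proof. intros He <-; field; exact He. Qed.

(** [iota] returns the limit only if it is unique, and uniqueness is inherited from complex
    derivatives through the chart. *)
Lemma Dpol_Ep (f : R * R -> C) (z l : C) :
  cderiv (fun z => f (Ep z)) z l -> is_Dpol f (Ep z) (Dpol f (Ep z)) /\
  l = (cexp z * Dpol f (Ep z))%C.
Proof.
intros H.
assert (HD : is_Dpol f (Ep z) (l / cexp z)).
{ rewrite <- (Lp_Ep z) at 2; apply cderiv_is_Dpol; [apply halfplane_Ep|now rewrite Lp_Ep]. }
assert (Hc := cexp_neq_0 z).
assert (E : Dpol f (Ep z) = (l / cexp z)%C).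
{ apply (iota_unique (V := C_R_CompleteNormedModule)); [|exact HD].
  intros y Hy; apply is_Dpol_cderiv in Hy;   exact (Cdiv_eq y l _ Hc (cderiv_unique _ _ _ _ Hy H)). }
rewrite E; split; [exact HD|field; exact Hc].
Qed.

(** In the chart [Dpol f] is a complex derivative divided by [cexp], so [cdiff_Dc] supplies the
    regularity. *)
Lemma polar_analytic_Dpol (U : R * R -> Prop) (f : R * R -> C) :
  polar_analytic U f -> polar_analytic U (Dpol f).
Proof.
intros Hf; assert (Hf' := Hf); destruct Hf' as (HU & Hh & _).
split; [|split]; trivial; intros p Hp.
assert (HpE : U (Ep (Lp p))) by (rewrite Ep_Lp; auto).
destruct (open_Ep U (Lp p) HU HpE) as [d [Hd Hw]].
assert (HF : forall w, Cmod (w - Lp p) < d -> cdiff (fun z => f (Ep z)) w).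
{ intros w Hwd; apply (polar_analytic_cdiff U); auto. }
assert (HD : cdiff (fun z => Dpol f (Ep z)) (Lp p)).
{ destruct (cdiff_Dc _ _ _ Hd HF) as [l Hl].
  apply (cdiff_ext (fun z => Dc (fun z => f (Ep z)) z * / cexp z)%C) with (d := d); trivial.
  - intros w Hwd; destruct (Dpol_Ep f w _ (Dc_correct _ _ (HF w Hwd))) as [_ E].
    rewrite E; field; apply cexp_neq_0.
  - eexists; apply cderiv_mult; [exact Hl|].
    apply (cderiv_inv cexp); [apply cexp_neq_0|apply cderiv_cexp]. }
destruct HD as [l Hl]; eexists; apply (cderiv_is_Dpol (Dpol f) p l); auto.
Qed.

Lemma cderiv_Dpol_n (U : R * R -> Prop) (f : R * R -> C) (j : nat) (z : C) :
  polar_analytic U f -> U (Ep z) ->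
  cderiv (fun z => Dpol_n j f (Ep z)) z (cexp z * Dpol_n (S j) f (Ep z)).
Proof.
intros Hf Hz.
assert (Hj : polar_analytic U (Dpol_n j f)).
{ induction j as [|j IH]; [exact Hf|now apply polar_analytic_Dpol]. }
destruct (polar_analytic_cdiff U _ z Hj Hz) as [l Hl].
destruct (Dpol_Ep _ _ _ Hl) as [_ E]; simpl; now rewrite <- E.
Qed.

Lemma cderiv_cexp_scal (a z : C) : cderiv (fun z => cexp (a * z)) z (a * cexp (a * z)).
Proof.
eapply cderiv_eq.
- apply (cderiv_comp cexp (fun z => a * z)%C); [apply cderiv_cexp|].
  apply cderiv_mult; [apply cderiv_const|apply cderiv_id].
- cbv beta; ring.
Qed.

(** * The operators [Theta] and the generalized Stirling numbers *)

Definition theta_term (f : R * R -> C) (j : nat) (z : C) : C :=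
  (cexp (RtoC (INR j) * z) * Dpol_n j f (Ep z))%C.

(** The factor [cexp (j z)] reproduces the term [j] times, and the chain-rule factor [cexp z] raises
    it to the next term: this is the source of the recursion for [stirling]. *)
Lemma cderiv_theta_term (U : R * R -> Prop) (f : R * R -> C) (j : nat) (z : C) :
  polar_analytic U f -> U (Ep z) ->
  cderiv (theta_term f j) z (RtoC (INR j) * theta_term f j z + theta_term f (S j) z).
Proof.
intros Hf Hz; eapply cderiv_eq.
- apply cderiv_mult; [apply cderiv_cexp_scal|now apply (cderiv_Dpol_n U)].
- unfold theta_term; rewrite S_INR, RtoC_plus.
  replace ((INR j + 1) * z)%C with (INR j * z + z)%C by ring.
  rewrite cexp_plus; ring.
Qed.

Fixpoint csum (u : nat -> C) (n : nat) : C :=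
  match n with O => u O | S n' => (csum u n' + u (S n'))%C end.

Lemma Theta_csum (c : R) (k : nat) (f : R * R -> C) (z : C) :
  Theta c k f (Ep z) = csum (fun j => RtoC (stirling c k j) * theta_term f j z)%C k.
Proof.
unfold Theta.
assert (H : forall n, sum_n (fun j => (stirling c k j * polar_pow (INR j) (Ep z) * Dpol_n j f (Ep z))%C) n
  = csum (fun j => RtoC (stirling c k j) * theta_term f j z)%C n).
{ induction n as [|n IH].
  - rewrite sum_O; unfold csum, theta_term; rewrite polar_pow_Ep.
    match goal with |- ?x = ?y => change (@eq C x y) end; ring.
  - rewrite sum_Sn, IH.
    match goal with |- plus ?x ?y = _ => change (@eq C (x + y)
      (csum (fun j => stirling c k j * theta_term f j z) n + stirling c k (S n) * theta_term f (S n) z))%C end.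
    rewrite polar_pow_Ep; generalize (csum (fun j => stirling c k j * theta_term f j z)%C n).
    intros x; unfold theta_term; ring. }
apply H.
Qed.

Lemma stirling_gt (c : R) (k j : nat) : (k < j)%nat -> stirling c k j = 0.
Proof.
revert j; induction k as [|k IH]; intros [|j] H; try lia; [reflexivity|].
simpl; rewrite !IH by lia; ring.
Qed.

(** The part of the recursion carrying the preceding index is shifted by one and becomes [u (S j)].
    At the upper end only the unshifted half of the term [S n] remains; for [n = k] it vanishes by
    [stirling_gt]. *)
Lemma csum_stirling_succ (c : R) (k : nat) (u : nat -> C) (n : nat) :
  csum (fun j => RtoC (stirling c (S k) j) * u j)%C (S n) =
  (csum (fun j => RtoC (stirling c k j) * (RtoC (c + INR j) * u j + u (S j)))%C n
   + RtoC (stirling c k (S n)) * (RtoC (c + INR (S n)) * u (S n)))%C.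
Proof.
induction n as [|n IH].
- simpl; rewrite !RtoC_plus, !RtoC_mult, !RtoC_plus; ring.
- change (csum (fun j => stirling c (S k) j * u j)%C (S n) + stirling c (S k) (S (S n)) * u (S (S n)) =
   csum (fun j => stirling c k j * (RtoC (c + INR j) * u j + u (S j)))%C n
   + stirling c k (S n) * (RtoC (c + INR (S n)) * u (S n) + u (S (S n)))
   + stirling c k (S (S n)) * (RtoC (c + INR (S (S n))) * u (S (S n))))%C.
  rewrite IH.
  replace (stirling c (S k) (S (S n))) with
    (stirling c k (S n) + (c + INR (S (S n))) * stirling c k (S (S n))) by reflexivity.
  generalize (csum (fun j => stirling c k j * (RtoC (c + INR j) * u j + u (S j)))%C n); intros x.
  rewrite !RtoC_plus, !RtoC_mult, !RtoC_plus; ring.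
Qed.

Lemma cderiv_csum (u u' : nat -> C -> C) (n : nat) (z : C) :
  (forall j, cderiv (u j) z (u' j z)) ->
  cderiv (fun z => csum (fun j => u j z) n) z (csum (fun j => u' j z) n).
Proof.
intros H; induction n as [|n IH]; [apply H|]; simpl; now apply cderiv_plus.
Qed.

Lemma csum_ext (u v : nat -> C) (n : nat) : (forall j, u j = v j) -> csum u n = csum v n.
Proof. intros H; induction n as [|n IH]; simpl; now rewrite ?IH, H. Qed.

Lemma csum_plus_scal (u v : nat -> C) (a : C) (n : nat) :
  csum (fun j => u j + a * v j)%C n = (csum u n + a * csum v n)%C.
Proof. induction n as [|n IH]; simpl; [reflexivity|rewrite IH; ring]. Qed.

(** The iteration rule of the operators, [r e^(i theta) D_pol] being [d/dz] in the chart. The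
    subtracted term is what the factor [cexp (c z)] will absorb. *)
Lemma cderiv_Theta (U : R * R -> Prop) (f : R * R -> C) (c : R) (k : nat) (z : C) :
  polar_analytic U f -> U (Ep z) ->
  cderiv (fun z => Theta c k f (Ep z)) z (Theta c (S k) f (Ep z) - RtoC c * Theta c k f (Ep z)).
Proof.
intros Hf Hz.
apply (cderiv_ext (fun z => csum (fun j => RtoC (stirling c k j) * theta_term f j z)%C k)) with (d := 1);
  [lra|intros w _; symmetry; apply Theta_csum|].
eapply cderiv_eq.
- apply (cderiv_csum (fun j z => RtoC (stirling c k j) * theta_term f j z)%C
    (fun j z => RtoC (stirling c k j) * (RtoC (INR j) * theta_term f j z + theta_term f (S j) z))%C).
  intros j; eapply cderiv_eq.
  + apply cderiv_mult; [apply cderiv_const|now apply (cderiv_theta_term U)].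
  + cbv beta; ring.
- rewrite !Theta_csum, csum_stirling_succ, (stirling_gt c k (S k)) by lia.
  rewrite (csum_ext (fun j => stirling c k j * (RtoC (c + INR j) * theta_term f j z + theta_term f (S j) z))%C
    (fun j => stirling c k j * (INR j * theta_term f j z + theta_term f (S j) z)
      + RtoC c * (stirling c k j * theta_term f j z))%C).
  + rewrite csum_plus_scal; ring.
  + intros j; rewrite RtoC_plus; ring.
Qed.

Lemma Dc_n_Theta (U : R * R -> Prop) (f : R * R -> C) (c : R) (k : nat) :
  polar_analytic U f -> forall z, U (Ep z) ->
  Dc_n k (fun z => cexp (RtoC c * z) * f (Ep z))%C z = (cexp (RtoC c * z) * Theta c k f (Ep z))%C.
Proof.
intros Hf; assert (HU : open U) by apply Hf.
induction k as [|k IH]; intros z Hz.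
- simpl; unfold Theta; rewrite sum_O.
  change (cexp (c * z) * f (Ep z) = cexp (c * z) * (1 * polar_pow 0 (Ep z) * f (Ep z)))%C.
  rewrite polar_pow_Ep, Cmult_0_l; unfold cexp at 3; simpl.
  unfold cis; rewrite exp_0, cos_0, sin_0; change (1, 0) with (RtoC 1); ring.
- destruct (open_Ep U z HU Hz) as [d [Hd Hw]].
  simpl; apply Dc_unique.
  apply (cderiv_ext (fun z => cexp (RtoC c * z) * Theta c k f (Ep z))%C) with (d := d); trivial.
  + intros w Hwd; symmetry; apply IH; auto.
  + eapply cderiv_eq; [apply cderiv_mult; [apply cderiv_cexp_scal|now apply (cderiv_Theta U)]|].
    cbv beta; ring.
Qed.

(** * Logarithmic poles and uniqueness of the residue *)

Lemma polar_log_Lp (p q : R * R) : halfplane p -> halfplane q ->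
  polar_log p q = (Lp q - Lp p)%C.
Proof.
intros Hp Hq; unfold polar_log; rewrite ln_div by assumption.
unfold Lp, RtoC, Ci, Cplus, Cmult, Cminus, Copp; simpl; apply injective_projections; simpl; ring.
Qed.

Lemma cdiff_zero_at_limit (H : C -> C) (z0 : C) (d : R) : 0 < d -> cdiff H z0 ->
  (forall z, Cmod (z - z0) < d -> z <> z0 -> H z = 0) -> H z0 = 0.
Proof.
intros Hd [l Hl] Hz; apply NNPP; intros Hne.
assert (Hp : 0 < Cmod (H z0)) by now apply Cmod_gt_0.
destruct (cderiv_cont H z0 l Hl _ Hp) as [d' [Hd' Hw]].
pose (h := Rmin d d' / 2).
assert (M1 := Rmin_l d d'); assert (M2 := Rmin_r d d').
assert (Hh : 0 < h) by (unfold h; assert (0 < Rmin d d') by (now apply Rmin_glb_lt); lra).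
assert (Ch : Cmod (z0 + RtoC h - z0) = h).
{ replace (z0 + RtoC h - z0)%C with (RtoC h) by ring; rewrite Cmod_R; apply Rabs_pos_eq; lra. }
specialize (Hw (z0 + RtoC h)%C); rewrite (Hz (z0 + RtoC h)%C) in Hw.
- replace (0 - H z0)%C with (- H z0)%C in Hw by ring.
  rewrite Cmod_opp, Ch in Hw; assert (h < d') by (unfold h in *; lra).
  specialize (Hw ltac:(assumption)); lra.
- rewrite Ch; unfold h in *; lra.
- intros E; rewrite E in Ch; replace (z0 - z0)%C with (RtoC 0) in Ch by ring.
  rewrite Cmod_0 in Ch; lra.
Qed.

(* A logarithmic pole seen through the chart [z = log r + i theta], with the factor
   [(r e^(i theta))^c = e^(c z)] included. *)
Lemma log_pole_chart (f : R * R -> C) (p : R * R) (k : nat) (g : R * R -> C) (c : R) :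
  log_pole_with f p k g ->
  let G := (fun z => cexp (RtoC c * z) * g (Ep z))%C in
  halfplane p /\ (1 <= k)%nat /\ G (Lp p) <> 0 /\
  (polar_pow c p * (Theta c (k - 1) g p / RtoC (INR (fact (k - 1)))))%C
    = (Dc_n (k - 1) G (Lp p) / RtoC (INR (fact (k - 1))))%C /\
  exists r, 0 < r /\ (forall z, Cmod (z - Lp p) < r -> cdiff G z) /\
    (forall z, Cmod (z - Lp p) < r -> z <> Lp p ->
       (cexp (RtoC c * z) * f (Ep z) = G z / (z - Lp p) ^ k)%C).
Proof.
intros (Hk & U & (HU & HUp & HUh & _) & Hg & Hgp & Hf) G.
assert (Hp : halfplane p) by auto.
assert (HpE : U (Ep (Lp p))) by now rewrite Ep_Lp.
split; [|split; [|split; [|split]]]; trivial.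
- apply Cmult_neq_0; [apply cexp_neq_0|now rewrite Ep_Lp].
- unfold G; rewrite (Dc_n_Theta U g c (k - 1) Hg _ HpE), <- polar_pow_Ep, Ep_Lp by trivial.
  unfold Cdiv; ring.
- destruct (open_Ep U (Lp p) HU HpE) as [r [Hr Hw]]; exists r; split; [|split]; trivial.
  + intros z Hz; destruct (polar_analytic_cdiff U g z Hg (Hw z Hz)) as [l Hl].
    eexists; apply cderiv_mult; [apply cderiv_cexp_scal|exact Hl].
  + intros z Hz Hne; rewrite (Hf (Ep z)).
    * rewrite polar_log_Lp, Lp_Ep by (trivial; apply halfplane_Ep); unfold G, Cdiv; ring.
    * split; [auto|]; intros E; apply Hne; now rewrite <- (Lp_Ep z), E.
Qed.

(** Otherwise [G'] would equal [(z - z0)^(k' - k) G] off [z0], and continuity would force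
    [G' z0 = 0]. *)
Lemma pole_order_le (G G' : C -> C) (z0 : C) (r : R) (k k' : nat) : 0 < r ->
  cdiff G z0 -> cdiff G' z0 -> G' z0 <> 0 ->
  (forall z, Cmod (z - z0) < r -> z <> z0 -> (G z / (z - z0) ^ k = G' z / (z - z0) ^ k')%C) ->
  (k' <= k)%nat.
Proof.
intros Hr [l Hl] [l' Hl'] Hne H.
destruct (Nat.le_gt_cases k' k) as [|Hlt]; [trivial|exfalso; apply Hne].
(* One factor [z - z0] is kept apart from the power [m], so that the product visibly vanishes at
   [z0] even for [m = 0]. *)
pose (m := (k' - k - 1)%nat).
assert (Hpow : cdiff (fun z => (z - z0) ^ m)%C z0).
{ induction m as [|m [d Hd]]; [exists (RtoC 0); apply (cderiv_const 1)|].
  eexists; apply (cderiv_mult (fun z => z - z0)%C (fun z => (z - z0) ^ m)%C);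
    [apply cderiv_sub|exact Hd]. }
destruct Hpow as [d Hd].
assert (E : (G' z0 + - (1) * (G z0 * ((z0 - z0) * (z0 - z0) ^ m)) = 0)%C).
{ apply (cdiff_zero_at_limit (fun z => G' z + - (1) * (G z * ((z - z0) * (z - z0) ^ m)))%C z0 r); trivial.
  - eexists; apply cderiv_plus; [exact Hl'|].
    apply cderiv_mult; [apply cderiv_const|]; apply cderiv_mult; [exact Hl|].
    apply cderiv_mult; [apply cderiv_sub|exact Hd].
  - intros z Hz Hzne; specialize (H z Hz Hzne).
    assert (Hz0 := Cminus_neq_0 _ _ Hzne).
    replace k' with (k + S m)%nat in H by (unfold m; lia).
    rewrite Cpow_add_r in H.
    assert (Hpk : ((z - z0) ^ k)%C <> 0) by now apply Cpow_nz.
    assert (Hpm : ((z - z0) ^ m)%C <> 0) by now apply Cpow_nz.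
    replace (G' z) with ((G' z / ((z - z0) ^ k * (z - z0) ^ S m)) * ((z - z0) ^ k * (z - z0) ^ S m))%C
      by (simpl; field; auto).
    rewrite <- H; simpl; field; auto. }
replace (G' z0) with (G' z0 + - (1) * (G z0 * ((z0 - z0) * (z0 - z0) ^ m)))%C by ring.
exact E.
Qed.

(** Comparing orders both ways gives [k = k']; the numerators then agree off [z0], hence at [z0] by
    continuity, and so do their derivatives. *)
Lemma is_residue_unique (c : R) (f : R * R -> C) (p : R * R) (v v' : C) :
  is_residue c f p v -> is_residue c f p v' -> v = v'.
Proof.
intros (k & g & Hg & ->) (k' & g' & Hg' & ->).
destruct (log_pole_chart f p k g c Hg) as (Hp & Hk & Hn & -> & r & Hr & Hd & He).
destruct (log_pole_chart f p k' g' c Hg') as (_ & Hk' & Hn' & -> & r' & Hr' & Hd' & He').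
set (G := fun z => (cexp (c * z) * g (Ep z))%C) in *.
set (G' := fun z => (cexp (c * z) * g' (Ep z))%C) in *.
set (z0 := Lp p) in *.
pose (s := Rmin r r').
assert (M1 : s <= r) by apply Rmin_l; assert (M2 : s <= r') by apply Rmin_r.
assert (Hs : 0 < s) by now apply Rmin_glb_lt.
assert (Hz0 : Cmod (z0 - z0) < s).
{ replace (z0 - z0)%C with (RtoC 0) by ring; now rewrite Cmod_0. }
assert (HE : forall z, Cmod (z - z0) < s -> z <> z0 -> (G z / (z - z0) ^ k = G' z / (z - z0) ^ k')%C).
{ intros z Hz Hne; transitivity (cexp (c * z) * f (Ep z))%C; [symmetry; apply He|apply He']; trivial; lra. }
assert (Ek : k = k').
{ apply Nat.le_antisymm.
  - apply (pole_order_le G' G z0 s); auto; [apply Hd'; lra|apply Hd; lra|].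
    intros z Hz Hne; symmetry; auto.
  - apply (pole_order_le G G' z0 s); auto; [apply Hd; lra|apply Hd'; lra]. }
subst k'; f_equal.
assert (HGG : forall z, Cmod (z - z0) < s -> z <> z0 -> G z = G' z).
{ intros z Hz Hne; specialize (HE z Hz Hne).
  assert (Hpk : ((z - z0) ^ k)%C <> 0) by now apply Cpow_nz, Cminus_neq_0.
  replace (G z) with (G z / (z - z0) ^ k * (z - z0) ^ k)%C by (field; trivial).
  rewrite HE; field; trivial. }
apply (Dc_n_ext G G' z0 s); trivial.
- intros z Hz; apply Hd; lra.
- intros z Hz; destruct (classic (z = z0)) as [->|Hne]; [|auto].
  destruct (Hd z0) as [l Hl]; [lra|]; destruct (Hd' z0) as [l' Hl']; [lra|].
  assert (E : (G z0 + - (1) * G' z0 = 0)%C).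
  { apply (cdiff_zero_at_limit (fun z => G z + - (1) * G' z)%C z0 s); trivial.
    - eexists; apply cderiv_plus; [exact Hl|]; apply cderiv_mult; [apply cderiv_const|exact Hl'].
    - intros z Hz' Hne; rewrite HGG by trivial; ring. }
  replace (G z0) with (G z0 + - (1) * G' z0 + G' z0)%C by ring; rewrite E; ring.
Qed.

Lemma residue_correct (c : R) (f : R * R -> C) (p : R * R) :
  log_pole f p -> is_residue c f p (residue c f p).
Proof.
intros (k & g & Hg).
apply (iota_correct (V := C_R_CompleteNormedModule) (is_residue c f p)).
eexists; split; [exists k, g; split; [exact Hg|reflexivity]|].
intros v Hv; apply (is_residue_unique c f p); trivial.
exists k, g; split; [exact Hg|reflexivity].
Qed.

(** * Contour integrals *)

(** This is [dz / dt] for [z = log r + i theta]. At a corner [Derive] has no meaningful value; only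
    finitely many parameters are concerned. *)
Definition dLp (gamma : R -> R * R) (t : R) : C :=
  (Derive (fun s => fst (gamma s)) t / fst (gamma t), Derive (fun s => snd (gamma s)) t).

Definition contour_integral (F : C -> C) (gamma : R -> R * R) (a b : R) (v : C) : Prop :=
  cint (fun t => F (Lp (gamma t)) * dLp gamma t)%C a b v.

Lemma is_derive_ln_affine (f : R -> R) (p u t : R) : ex_derive f t ->
  0 < (1 - u) * p + u * f t ->
  is_derive (fun s => ln ((1 - u) * p + u * f s)) t (u * Derive f t / ((1 - u) * p + u * f t)).
Proof.
intros Hf Hp; auto_derive; [repeat split; trivial|].
change (Derive (fun x => f x) t) with (Derive f t); field; lra.
Qed.

Lemma is_derive_affine (f : R -> R) (p u t : R) : ex_derive f t ->
  is_derive (fun s => (1 - u) * p + u * f s) t (u * Derive f t).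
Proof.
intros Hf; auto_derive; [trivial|].
change (Derive (fun x => f x) t) with (Derive f t); ring.
Qed.

Lemma is_derive_ln_segment (p q u : R) : 0 < (1 - u) * p + u * q ->
  is_derive (fun s => ln ((1 - s) * p + s * q)) u ((q - p) / ((1 - u) * p + u * q)).
Proof. intros Hp; auto_derive; [trivial|field; lra]. Qed.

Lemma rderiv_Lp (eta : R -> R * R) (t : R) : C1_curve eta -> 0 < fst (eta t) ->
  rderiv (fun t => Lp (eta t)) t (dLp eta t).
Proof.
intros H Hp; destruct (H t) as (H1 & H2 & _ & _); apply rderiv_pair; simpl.
- assert (Hl := is_derive_ln_affine (fun s => fst (eta s)) 0 1 t H1 ltac:(lra)).
  apply (is_derive_ext (K := R_AbsRing) (V := R_NormedModule) (fun s => ln ((1 - 1) * 0 + 1 * fst (eta s)))).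
  + intros s; f_equal; ring.
  + replace (Derive (fun s => fst (eta s)) t / fst (eta t)) with
      (1 * Derive (fun s => fst (eta s)) t / ((1 - 1) * 0 + 1 * fst (eta t))) by (field; lra).
    exact Hl.
- now apply Derive_correct.
Qed.

Lemma C1_curve_continuous (eta : R -> R * R) (t : R) : C1_curve eta ->
  continuous (fun s => fst (eta s)) t /\ continuous (fun s => snd (eta s)) t.
Proof.
intros H; destruct (H t) as (H1 & H2 & _ & _).
split; now apply (ex_derive_continuous (V := R_NormedModule)).
Qed.

Lemma rcont_dLp (eta : R -> R * R) (t : R) : C1_curve eta -> 0 < fst (eta t) ->
  rcont (dLp eta) t.
Proof.
intros H Hp; destruct (H t) as (_ & _ & H3 & H4).
destruct (C1_curve_continuous eta t H) as [H1 _].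
apply rcont_pair; simpl; trivial.
apply (continuous_mult (K := R_AbsRing)); trivial.
apply continuous_Rinv_comp; [trivial|lra].
Qed.

(** Increments of [W] telescope over the pieces. Three choices of [W] are used: a primitive along
    the curve, the integral over a segment from a base point, and a continuous logarithm. *)
Lemma piecewise_contour_integral (F : C -> C) (gamma : R -> R * R) (a b : R) (W : R -> C) :
  piecewise_C1 gamma a b ->
  (forall x y eta, C1_curve eta -> a <= x < y -> y <= b ->
     (forall t, x <= t <= y -> gamma t = eta t) ->
     contour_integral F eta x y (W y - W x)) ->
  contour_integral F gamma a b (W b - W a).
Proof.
intros (n & x & Ha & Hb & Hi) H.
assert (Hmono : forall i j, (i <= j <= n)%nat -> x i <= x j).
{ intros i j Hij; replace j with (i + (j - i))%nat by lia.
  assert (Hk : (i + (j - i) <= n)%nat) by lia; revert Hk; generalize (j - i)%nat; intros k.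
  induction k as [|k IH]; intros Hk; [rewrite Nat.add_0_r; lra|].
  rewrite Nat.add_succ_r; destruct (Hi (i + k)%nat) as [Hl _]; [lia|].
  specialize (IH ltac:(lia)); lra. }
assert (Hind : forall i, (i <= n)%nat -> contour_integral F gamma (x 0%nat) (x i) (W (x i) - W (x 0%nat))).
{ induction i as [|i IH]; intros Hin.
  - replace (W (x 0%nat) - W (x 0%nat))%C with (RtoC 0) by ring.
    apply (is_RInt_point (V := C_R_NormedModule)).
  - replace (W (x (S i)) - W (x 0%nat))%C with ((W (x i) - W (x 0%nat)) + (W (x (S i)) - W (x i)))%C by ring.
    apply cint_Chasles with (x i); [apply IH; lia|].
    destruct (Hi i) as (Hl & eta & Heta & Heq); [lia|].
    apply (cint_ext (fun t => F (Lp (eta t)) * dLp eta t)%C); [lra| |].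
    + intros t Ht; rewrite (Heq t) by lra; f_equal; unfold dLp; rewrite (Heq t) by lra.
      (* The two curves have equal derivatives only inside the piece, where they agree on a
         neighbourhood; this is enough, since the integral ignores the end points. *)
      assert (Hloc : locally t (fun s => gamma s = eta s)).
      { assert (Hm : 0 < Rmin (t - x i) (x (S i) - t)) by (apply Rmin_glb_lt; lra).
        exists (mkposreal _ Hm); intros s Hs; apply Heq.
        change (Rabs (s + - t) < Rmin (t - x i) (x (S i) - t)) in Hs.
        assert (M1 := Rmin_l (t - x i) (x (S i) - t)); assert (M2 := Rmin_r (t - x i) (x (S i) - t)).
        destruct (Rabs_def2 _ _ Hs); lra. }
      f_equal; [f_equal|]; apply Derive_ext_loc; revert Hloc; apply filter_imp; now intros s ->.
    + apply H; trivial; [split; trivial|].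
      * rewrite <- Ha; apply Hmono; lia.
      * rewrite <- Hb; apply Hmono; lia. }
rewrite <- Ha, <- Hb; apply Hind; lia.
Qed.

Lemma contour_integral_primitive (F P : C -> C) (gamma : R -> R * R) (a b : R) :
  piecewise_C1 gamma a b ->
  (forall t, a <= t <= b -> halfplane (gamma t)) ->
  (forall t, a <= t <= b -> cdiff F (Lp (gamma t)) /\ cderiv P (Lp (gamma t)) (F (Lp (gamma t)))) ->
  contour_integral F gamma a b (P (Lp (gamma b)) - P (Lp (gamma a))).
Proof.
intros Hg Hh HF; apply (piecewise_contour_integral F gamma a b (fun t => P (Lp (gamma t)))); trivial.
intros x y eta Heta Hx Hy Heq; rewrite !Heq by lra.
assert (Hp : forall t, x <= t <= y -> 0 < fst (eta t)).
{ intros t Ht; rewrite <- Heq by trivial; apply Hh; lra. }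
assert (HFe : forall t, x <= t <= y -> cdiff F (Lp (eta t)) /\ cderiv P (Lp (eta t)) (F (Lp (eta t)))).
{ intros t Ht; rewrite <- Heq by trivial; apply HF; lra. }
apply (cint_rderiv (fun t => P (Lp (eta t)))); [lra| |].
- intros t Ht; apply rderiv_comp; [apply HFe|apply rderiv_Lp]; auto.
- intros t Ht; apply rcont_mult; [|apply rcont_dLp; auto].
  apply (rcont_cdiff F (fun t => Lp (eta t))); [now apply HFe|].
  eapply rderiv_cont, rderiv_Lp; auto.
Qed.

Definition seg (p q : R * R) (u : R) : R * R :=
  ((1 - u) * fst p + u * fst q, (1 - u) * snd p + u * snd q).

Lemma Cmod_le_sum (z : C) : Cmod z <= Rabs (fst z) + Rabs (snd z).
Proof.
replace z with (RtoC (fst z) + Ci * RtoC (snd z))%C at 1.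
- eapply Rle_trans; [apply Cmod_triangle|].
  rewrite Cmod_mult, Cmod_Ci, !Cmod_R; lra.
- destruct z as [x y]; unfold RtoC, Ci, Cplus, Cmult; simpl; apply injective_projections; simpl; ring.
Qed.

Lemma continuous_positive_bound (f : R -> R) (x y : R) : x <= y ->
  (forall t, x <= t <= y -> continuous f t) -> (forall t, x <= t <= y -> 0 < f t) ->
  exists m, 0 < m /\ forall t, x <= t <= y -> m <= f t.
Proof.
intros Hxy Hc Hp; destruct (continuity_ab_min f x y Hxy) as [s [Hs1 Hs2]].
- intros t Ht; now apply continuity_pt_filterlim, Hc.
- exists (f s); split; auto.
Qed.

(** [W t] is the integral of [F dz] over the image of the segment from [p] to [gamma t]. On the
    rectangle of a piece the edge [u = 0] is the single point [p], so the vanishing boundary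
    integral says that the integral over the piece is the increment of [W]. A closed curve returns
    to the same value of [W]. *)
Lemma star_cauchy (F : C -> C) (gamma : R -> R * R) (a b : R) (p : R * R) :
  piecewise_C1 gamma a b -> gamma a = gamma b -> halfplane p ->
  (forall t, a <= t <= b -> halfplane (gamma t)) ->
  (forall u t, 0 <= u <= 1 -> a <= t <= b -> cdiff F (Lp (seg p (gamma t) u))) ->
  contour_integral F gamma a b 0.
Proof.
intros Hg Hab Hp Hh HF.
pose (W := fun t => cI (fun u => F (Lp (seg p (gamma t) u)) *
  ((fst (gamma t) - fst p) / fst (seg p (gamma t) u), snd (gamma t) - snd p)%R)%C 0 1).
replace (RtoC 0) with (W b - W a)%C by (unfold W; rewrite Hab; ring).
apply piecewise_contour_integral; trivial.
intros x y eta Heta Hx Hy Heq.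
assert (Hpe : forall t, x <= t <= y -> 0 < fst (eta t)).
{ intros t Ht; rewrite <- Heq by trivial; apply Hh; lra. }
assert (HFe : forall u t, 0 <= u <= 1 -> x <= t <= y -> cdiff F (Lp (seg p (eta t) u))).
{ intros u t Hu Ht; rewrite <- Heq by trivial; apply HF; lra. }
destruct (continuous_positive_bound (fun t => fst (eta t)) x y) as [m0 [Hm0 Hm]]; trivial; [lra| |].
{ intros t _; now apply C1_curve_continuous. }
(* A lower bound for [r] on all segments, which bounds the factor [1 / r] in both partial
   derivatives. *)
pose (m := Rmin m0 (fst p)).
assert (Hmp : 0 < m) by (apply Rmin_glb_lt; trivial).
assert (Hms : forall u t, 0 <= u <= 1 -> x <= t <= y -> m <= fst (seg p (eta t) u)).
{ intros u t Hu Ht; specialize (Hm t Ht); unfold seg; simpl.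
  assert (M1 := Rmin_l m0 (fst p)); assert (M2 := Rmin_r m0 (fst p)); fold m in M1, M2; nra. }
assert (Hsp : forall u t, 0 <= u <= 1 -> x <= t <= y -> 0 < fst (seg p (eta t) u)).
{ intros u t Hu Ht; specialize (Hms u t Hu Ht); lra. }
destruct (rcont_bounded (fun t => (fst (eta t) - fst p, snd (eta t) - snd p)%R : C) x y)
  as [B1 [HB1 HB1']]; [lra| |].
{ intros t _; destruct (C1_curve_continuous eta t Heta) as [H1 H2]; apply rcont_pair; simpl;
    apply (continuous_minus (V := R_NormedModule)); trivial; apply continuous_const. }
destruct (rcont_bounded (fun t => (Derive (fun s => fst (eta s)) t, Derive (fun s => snd (eta s)) t) : C) x y)
  as [B2 [HB2 HB2']]; [lra| |].
{ intros t _; destruct (Heta t) as (_ & _ & H3 & H4); now apply rcont_pair. }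
pose (Z := fun u t => Lp (seg p (eta t) u)).
pose (Zu := fun u t => ((fst (eta t) - fst p) / fst (seg p (eta t) u), snd (eta t) - snd p)%R : C).
pose (Zv := fun u t => (u * Derive (fun s => fst (eta s)) t / fst (seg p (eta t) u),
  u * Derive (fun s => snd (eta s)) t)%R : C).
assert (Hest : forall r1 r2 s B, m <= s -> Cmod (r1, r2) <= B -> Cmod (r1 / s, r2) <= B / m + B).
{ intros r1 r2 s B Hs HB.
  assert (Hr := Rmax_Cmod (r1, r2)); simpl in Hr.
  assert (Hl1 := Rmax_l (Rabs r1) (Rabs r2)); assert (Hl2 := Rmax_r (Rabs r1) (Rabs r2)).
  eapply Rle_trans; [apply Cmod_le_sum|]; simpl; apply Rplus_le_compat; [|lra].
  unfold Rdiv; rewrite Rabs_mult, (Rabs_pos_eq (/ s)) by (left; apply Rinv_0_lt_compat; lra).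
  apply Rmult_le_compat; [apply Rabs_pos|left; apply Rinv_0_lt_compat; lra|lra|].
  apply Rinv_le_contravar; lra. }
pose (M := Rmax (B1 / m + B1) (B2 / m + B2)).
assert (HZ : smooth_map Z Zu Zv 0 1 x y M).
{ intros u t Hu Ht; specialize (Hsp u t Hu Ht); specialize (Hms u t Hu Ht).
  destruct (Heta t) as (D1 & D2 & C1 & C2).
  destruct (C1_curve_continuous eta t Heta) as [K1 K2].
  split; [|split; [|split; [|split; [|split]]]].
  - apply rderiv_pair; unfold seg in *; simpl in *.
    + now apply is_derive_ln_segment.
    + generalize (snd p) (snd (eta t)); intros; auto_derive; trivial; ring.
  - apply rderiv_pair; unfold seg in *; simpl in *.
    + now apply (is_derive_ln_affine (fun s => fst (eta s))).
    + now apply (is_derive_affine (fun s => snd (eta s))).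
  - apply rcont_pair; unfold seg in *; simpl in *; [|apply continuous_const].
    revert Hsp; generalize (fst p) (fst (eta t)); intros.
    apply (ex_derive_continuous (V := R_NormedModule)); auto_derive; lra.
  - apply rcont_pair; unfold seg in *; simpl in *.
    + apply (continuous_mult (K := R_AbsRing)).
      * apply (continuous_mult (K := R_AbsRing)); [apply continuous_const|exact C1].
      * apply continuous_Rinv_comp; [|lra].
        apply (continuous_plus (V := R_NormedModule)); [apply continuous_const|].
        apply (continuous_mult (K := R_AbsRing)); [apply continuous_const|exact K1].
    + apply (continuous_mult (K := R_AbsRing)); [apply continuous_const|exact C2].
  - eapply Rle_trans; [apply (Hest _ _ _ B1 Hms), HB1'; trivial|apply Rmax_l].
  - eapply Rle_trans; [apply (Hest _ _ _ B2 Hms)|apply Rmax_r].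
    replace ((u * Derive (fun s => fst (eta s)) t)%R, (u * Derive (fun s => snd (eta s)) t)%R)
      with (RtoC u * (Derive (fun s => fst (eta s)) t, Derive (fun s => snd (eta s)) t))%C
      by (unfold RtoC, Cmult; simpl; f_equal; ring).
    rewrite Cmod_mult, Cmod_R, Rabs_pos_eq by lra.
    specialize (HB2' t Ht); assert (H0 := Cmod_ge_0 (Derive (fun s => fst (eta s)) t, Derive (fun s => snd (eta s)) t)).
    nra. }
assert (Gt := homotopy_goursat F Z Zu Zv 0 1 x y M Rle_0_1 ltac:(lra) HZ HFe).
unfold boundary_integral in Gt.
assert (E0 : cI (fun t => F (Z 0 t) * Zv 0 t)%C x y = 0).
{ apply cI_unique, (cint_ext (fun _ => 0 * RtoC 1)%C); [lra| |].
  - intros t _; replace (Zv 0 t) with (RtoC 0); [ring|].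
    unfold Zv, RtoC; f_equal; unfold Rdiv; ring.
  - assert (Q : cint (fun _ => 0 * RtoC 1)%C x y (0 * (RtoC y - RtoC x))%C).
    { apply cint_mult_l.
      apply (cint_rderiv RtoC (fun _ => RtoC 1)); [lra|intros; apply rderiv_RtoC|intros; apply rcont_const]. }
    now replace (0 * (RtoC y - RtoC x))%C with (RtoC 0) in Q by ring. }
assert (EW : forall t, x <= t <= y -> cI (fun u => F (Z u t) * Zu u t)%C 0 1 = W t).
{ intros t Ht; unfold W; rewrite Heq by trivial; reflexivity. }
rewrite E0, !EW in Gt by lra.
replace (W y - W x)%C with (cI (fun t => F (Z 1 t) * Zv 1 t)%C x y).
- apply (cint_ext (fun t => F (Z 1 t) * Zv 1 t)%C); [lra| |].
  + intros t Ht.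
    assert (E1 : seg p (eta t) 1 = eta t) by (unfold seg; destruct (eta t); simpl; f_equal; ring).
    unfold Z, Zv; rewrite E1; f_equal; unfold dLp; f_equal; [f_equal|]; ring.
  + apply cI_correct; [lra|]; intros t Ht.
    apply (edge_v_cont F Z Zu Zv 0 1 x y M HZ HFe); lra.
- match type of Gt with (?A - _ - ?Bx)%C = _ => replace A with (A - 0 - Bx + Bx)%C by ring end.
  rewrite Gt; ring.
Qed.

(** * Winding number *)

Lemma continuous_eps (f : R -> R) (t : R) : continuous f t ->
  forall eps, 0 < eps -> exists d, 0 < d /\ forall s, Rabs (s - t) < d -> Rabs (f s - f t) < eps.
Proof.
intros H eps Heps.
destruct (H _ (locally_ball (f t) (mkposreal eps Heps))) as [d Hd].
exists d; split; [apply cond_pos|]; intros s Hs; exact (Hd s Hs).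
Qed.

(** Needed because an angle given on a closed piece has a two-sided derivative only in its
    interior. *)
Lemma is_RInt_open_derive (h psi : R -> R) (x y : R) : x < y ->
  (forall t, x <= t <= y -> continuous h t) ->
  (forall t, x <= t <= y -> continuous psi t) ->
  (forall t, x < t < y -> is_derive psi t (h t)) ->
  is_RInt h x y (psi y - psi x).
Proof.
intros Hxy Hh Hpsi Hd.
assert (Hex : forall s t, x <= s <= t -> t <= y -> ex_RInt h s t).
{ intros s t Hs Ht; apply (ex_RInt_continuous (V := R_CompleteNormedModule)).
  rewrite Rmin_left, Rmax_right by lra; intros; apply Hh; lra. }
assert (E : RInt h x y = psi y - psi x).
2: { rewrite <- E; apply (RInt_correct (V := R_CompleteNormedModule)), Hex; lra. }
destruct (rcont_bounded (fun t => RtoC (h t)) x y) as [H [HH0 HH]]; [lra| |].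
{ intros t Ht; apply rcont_pair; simpl; [now apply Hh|apply continuous_const]. }
apply cond_eq; intros eps Heps.
assert (He : 0 < eps / 8) by lra.
destruct (continuous_eps psi x (Hpsi x ltac:(lra)) _ He) as [d1 [Hd1 P1]].
destruct (continuous_eps psi y (Hpsi y ltac:(lra)) _ He) as [d2 [Hd2 P2]].
(* Cutting off length [q] at each end changes [psi] by less than [eps / 8] and the integral by at
   most [q * H <= eps / 8]; four such errors stay below [eps]. *)
pose (q := Rmin (Rmin (d1 / 2) (d2 / 2)) (Rmin ((y - x) / 2) (eps / (8 * (1 + H))))).
assert (M1 := Rmin_l (Rmin (d1 / 2) (d2 / 2)) (Rmin ((y - x) / 2) (eps / (8 * (1 + H))))).
assert (M2 := Rmin_r (Rmin (d1 / 2) (d2 / 2)) (Rmin ((y - x) / 2) (eps / (8 * (1 + H))))).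
assert (M3 := Rmin_l (d1 / 2) (d2 / 2)); assert (M4 := Rmin_r (d1 / 2) (d2 / 2)).
assert (M5 := Rmin_l ((y - x) / 2) (eps / (8 * (1 + H)))).
assert (M6 := Rmin_r ((y - x) / 2) (eps / (8 * (1 + H)))).
fold q in M1, M2.
assert (Hq : 0 < q).
{ unfold q; repeat apply Rmin_glb_lt; try lra; apply Rdiv_lt_0_compat; lra. }
assert (Hint : is_RInt h (x + q) (y - q) (psi (y - q) - psi (x + q))).
{ apply (is_RInt_derive (V := R_CompleteNormedModule) psi h);
    rewrite Rmin_left, Rmax_right by lra; intros t Ht; [apply Hd|apply Hh]; lra. }
apply (is_RInt_unique (V := R_CompleteNormedModule)) in Hint.
assert (Hb : forall s t, x <= s <= t -> t <= y -> Rabs (RInt h s t) <= (t - s) * H).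
{ intros s t Hs Ht; apply abs_RInt_le_const; [lra|now apply Hex|].
  intros r Hr; specialize (HH r ltac:(lra)); now rewrite Cmod_R in HH. }
assert (S1 : RInt h x y = RInt h x (x + q) + RInt h (x + q) (y - q) + RInt h (y - q) y).
{ rewrite <- (RInt_Chasles (V := R_CompleteNormedModule) h x (y - q) y) by (apply Hex; lra).
  rewrite <- (RInt_Chasles (V := R_CompleteNormedModule) h x (x + q) (y - q)) by (apply Hex; lra).
  reflexivity. }
rewrite S1, Hint.
assert (B1 := Hb x (x + q) ltac:(lra) ltac:(lra)).
assert (B2 := Hb (y - q) y ltac:(lra) ltac:(lra)).
assert (Hqh : q * H <= eps / 8).
{ apply Rle_trans with (eps / (8 * (1 + H)) * (1 + H)).
  - apply Rmult_le_compat; lra.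
  - right; field; lra. }
assert (P1' := P1 (x + q) ltac:(rewrite Rabs_pos_eq; lra)).
assert (P2' := P2 (y - q) ltac:(rewrite Rabs_left; lra)).
replace (x + q - x) with q in B1 by ring; replace (y - (y - q)) with q in B2 by ring.
assert (T1 := Rabs_le_between (RInt h x (x + q)) (q * H)).
assert (T2 := Rabs_le_between (RInt h (y - q) y) (q * H)).
apply T1 in B1; apply T2 in B2.
apply Rabs_def2 in P1'; apply Rabs_def2 in P2'.
apply Rabs_def1; lra.
Qed.

Lemma atan_sin_cos (d r : R) : Rabs d < PI / 2 -> 0 < r -> atan (r * sin d / (r * cos d)) = d.
Proof.
intros Hd Hr; destruct (Rabs_def2 _ _ Hd).
assert (Hc : 0 < cos d) by (apply cos_gt_0; lra).
replace (r * sin d / (r * cos d)) with (tan d) by (unfold tan; field; lra).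
apply atan_tan; lra.
Qed.

Definition arg_density (u v : R -> R) (t : R) : R :=
  (u t * Derive v t - v t * Derive u t) / (u t ^ 2 + v t ^ 2).

Lemma is_derive_atan_ratio (u v : R -> R) (t : R) : ex_derive u t -> ex_derive v t ->
  0 < u t * u t + v t * v t -> forall k,
  is_derive (fun s => k + atan ((v s * u t - u s * v t) / (u s * u t + v s * v t))) t (arg_density u v t).
Proof.
intros Hu Hv HD k; unfold arg_density.
auto_derive.
- repeat split; trivial; lra.
- change (Derive (fun x => u x) t) with (Derive u t); change (Derive (fun x => v x) t) with (Derive v t).
  replace (v t * u t + - (u t * v t)) with 0 by ring.
  field; repeat split; try lra; nra.
Qed.

(** Near [t] the continuous angle stays within [PI / 2] of [psi t], hence equals [psi t] plus an
    arctangent expressed in the coordinates alone, which is differentiable. *)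
Lemma is_derive_arg (u v psi : R -> R) (x y t : R) :
  x < t < y -> continuous psi t -> ex_derive u t -> ex_derive v t ->
  (forall s, x <= s <= y -> exists rho, 0 < rho /\ u s = rho * cos (psi s) /\ v s = rho * sin (psi s)) ->
  is_derive psi t (arg_density u v t).
Proof.
intros Ht Hc Hu Hv Hpol.
destruct (Hpol t) as (rt & Hrt & Eu & Ev); [lra|].
assert (HD : u t * u t + v t * v t = rt * rt).
{ rewrite Eu, Ev; assert (H := sin2_cos2 (psi t)); unfold Rsqr in H.
  transitivity (rt * rt * (sin (psi t) * sin (psi t) + cos (psi t) * cos (psi t))); [ring|rewrite H; ring]. }
assert (HD0 : 0 < rt * rt) by now apply Rmult_lt_0_compat.
destruct (continuous_eps psi t Hc (PI / 2)) as [d [Hd Hs]]; [assert (H := PI_RGT_0); lra|].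
apply (is_derive_ext_loc (fun s => psi t + atan ((v s * u t - u s * v t) / (u s * u t + v s * v t)))).
- assert (Hm : 0 < Rmin d (Rmin (t - x) (y - t))) by (repeat apply Rmin_glb_lt; lra).
  exists (mkposreal _ Hm); intros s Hsb.
  change (Rabs (s - t) < Rmin d (Rmin (t - x) (y - t))) in Hsb.
  assert (M1 := Rmin_l d (Rmin (t - x) (y - t))); assert (M2 := Rmin_r d (Rmin (t - x) (y - t))).
  assert (M3 := Rmin_l (t - x) (y - t)); assert (M4 := Rmin_r (t - x) (y - t)).
  specialize (Hs s ltac:(lra)); destruct (Rabs_def2 _ _ Hsb).
  destruct (Hpol s) as (rs & Hrs & Eus & Evs); [lra|].
  replace (v s * u t - u s * v t) with (rs * rt * sin (psi s - psi t))
    by (rewrite Eus, Evs, Eu, Ev, sin_minus; ring).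
  replace (u s * u t + v s * v t) with (rs * rt * cos (psi s - psi t))
    by (rewrite Eus, Evs, Eu, Ev, cos_minus; ring).
  rewrite atan_sin_cos; [apply Rplus_minus|exact Hs|now apply Rmult_lt_0_compat].
- apply is_derive_atan_ratio; trivial; lra.
Qed.


(** [N] and [X] are the coordinates of the vector in the frame turned by [phi]. Since [N > 0], its
    angle in that frame is the arctangent of [X / N]; the modulus is written
    [N * sqrt (1 + (X / N) ^ 2)]. *)
Lemma lift_in_half_plane (w1 w2 phi : R) :
  0 < w1 * cos phi + w2 * sin phi ->
  exists rho, 0 < rho /\
    w1 = rho * cos (phi + atan ((w2 * cos phi - w1 * sin phi) / (w1 * cos phi + w2 * sin phi))) /\
    w2 = rho * sin (phi + atan ((w2 * cos phi - w1 * sin phi) / (w1 * cos phi + w2 * sin phi))).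
Proof.
set (N := w1 * cos phi + w2 * sin phi); set (X := w2 * cos phi - w1 * sin phi); intros HN.
assert (Hs : 0 < sqrt (1 + (X / N) ^ 2)) by (apply sqrt_lt_R0; assert (0 <= (X / N) ^ 2) by apply pow2_ge_0; lra).
assert (Hsc := sin2_cos2 phi); unfold Rsqr in Hsc.
exists (N * sqrt (1 + (X / N) ^ 2)); split; [now apply Rmult_lt_0_compat|].
rewrite cos_plus, sin_plus, cos_atan, sin_atan.
replace (1 + (X / N)²) with (1 + (X / N) ^ 2) by (unfold Rsqr; ring).
set (q := sqrt (1 + (X / N) ^ 2)) in *.
split.
- transitivity (N * cos phi - X * sin phi); [|field; lra].
  unfold N, X; transitivity (w1 * (sin phi * sin phi + cos phi * cos phi)); [rewrite Hsc|]; ring.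
- transitivity (N * sin phi + X * cos phi); [|field; lra].
  unfold N, X; transitivity (w2 * (sin phi * sin phi + cos phi * cos phi)); [rewrite Hsc|]; ring.
Qed.

(** [dz / z] is [d ln |z| + i d arg z]. The angle [psi] is only assumed continuous; its derivative
    inside the interval comes from [is_derive_arg]. *)
Lemma cint_inv_lift (u v du dv psi : R -> R) (x y : R) : x < y ->
  (forall t, x <= t <= y -> is_derive u t (du t) /\ is_derive v t (dv t) /\
     continuous du t /\ continuous dv t /\ continuous psi t) ->
  (forall s, x <= s <= y -> exists rho, 0 < rho /\ u s = rho * cos (psi s) /\ v s = rho * sin (psi s)) ->
  cint (fun t => / (u t, v t) * (du t, dv t))%C x y
    (ln (u y ^ 2 + v y ^ 2) / 2 - ln (u x ^ 2 + v x ^ 2) / 2, psi y - psi x).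
Proof.
intros Hxy Hc Hpol.
assert (HD : forall t, x <= t <= y -> 0 < u t ^ 2 + v t ^ 2).
{ intros t Ht; destruct (Hpol t Ht) as (r & Hr & Eu & Ev); rewrite Eu, Ev.
  assert (H := sin2_cos2 (psi t)); unfold Rsqr in H.
  replace ((r * cos (psi t)) ^ 2 + (r * sin (psi t)) ^ 2)
    with (r * r * (sin (psi t) * sin (psi t) + cos (psi t) * cos (psi t))) by ring.
  rewrite H; nra. }
assert (Hcu : forall t, x <= t <= y -> continuous u t).
{ intros t Ht; apply (ex_derive_continuous (V := R_NormedModule)); eexists; now apply Hc. }
assert (Hcv : forall t, x <= t <= y -> continuous v t).
{ intros t Ht; apply (ex_derive_continuous (V := R_NormedModule)); eexists; now apply Hc. }
assert (HcI : forall t, x <= t <= y -> rcont (fun t => / (u t, v t) * (du t, dv t))%C t).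
{ intros t Ht; destruct (Hc t Ht) as (H1 & H2 & H3 & H4 & H5).
  apply rcont_mult; [|now apply rcont_pair].
  apply rcont_inv; [|apply rcont_pair; auto].
  intros E; injection E; intros E2 E1; specialize (HD t Ht); rewrite E1, E2 in HD; lra. }
apply cint_pair; simpl fst; simpl snd.
- apply (is_RInt_derive (V := R_CompleteNormedModule) (fun t => ln (u t ^ 2 + v t ^ 2) / 2));
    rewrite Rmin_left, Rmax_right by lra; intros t Ht.
  + destruct (Hc t Ht) as (H1 & H2 & _); specialize (HD t Ht); simpl; auto_derive.
    * simpl in HD; repeat split; trivial; try lra; eexists; eassumption.
    * change (Derive (fun x => u x) t) with (Derive u t); change (Derive (fun x => v x) t) with (Derive v t).
      rewrite (is_derive_unique _ _ _ H1), (is_derive_unique _ _ _ H2).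
      simpl in HD; field; lra.
  + exact (rcont_fst _ _ (HcI t Ht)).
- apply (is_RInt_open_derive _ psi x y Hxy).
  + intros t Ht; exact (rcont_snd _ _ (HcI t Ht)).
  + intros t Ht; now apply Hc.
  + intros t Ht; destruct (Hc t) as (H1 & H2 & _ & _ & H5); [lra|].
    specialize (HD t ltac:(lra)); simpl in HD.
    match goal with |- is_derive _ _ ?d => replace d with (arg_density u v t) end.
    * apply (is_derive_arg u v psi x y); trivial; eexists; eassumption.
    * unfold arg_density; rewrite (is_derive_unique _ _ _ H1), (is_derive_unique _ _ _ H2).
      simpl; field; lra.
Qed.

Lemma ln_diff_sign (r r0 : R) : 0 < r -> 0 < r0 -> r <> r0 -> 0 < (ln r - ln r0) * (r - r0).
Proof.
intros Hr Hr0 Hne; destruct (Rdichotomy _ _ Hne) as [H|H].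
- assert (ln r < ln r0) by now apply ln_increasing. nra.
- assert (ln r0 < ln r) by now apply ln_increasing. nra.
Qed.

(* Seen from [p], the vector [q - p] and its image [Lp q - Lp p] lie in a common half-plane,
   because [ln] is increasing. *)
Lemma Lp_same_half_plane (p : R * R) (r phi : R) : halfplane p -> 0 < r ->
  0 < fst p + r * cos phi ->
  0 < (ln (fst p + r * cos phi) - ln (fst p)) * cos phi + r * sin phi * sin phi.
Proof.
intros Hp Hr Hq; unfold halfplane in Hp.
destruct (Req_dec (cos phi) 0) as [E|E].
- assert (H := sin2_cos2 phi); unfold Rsqr in H; rewrite E in *.
  replace (r * sin phi * sin phi) with (r * (sin phi * sin phi + 0 * 0)) by ring; rewrite H; lra.
- assert (Hne : fst p + r * cos phi <> fst p).
  { intros H; apply E; assert (r * cos phi = 0) by lra; nra. }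
  assert (H := ln_diff_sign _ _ Hq Hp Hne).
  replace (fst p + r * cos phi - fst p) with (r * cos phi) in H by ring.
  assert (0 < (ln (fst p + r * cos phi) - ln (fst p)) * cos phi) by nra.
  assert (0 <= r * (sin phi * sin phi)) by (apply Rmult_le_pos; [lra|apply Rle_0_sqr]).
  lra.
Qed.

Lemma is_derive_sub_const (f : R -> R) (t d k : R) :
  is_derive f t d -> is_derive (fun s => f s - k) t d.
Proof.
intros H; auto_derive; [now exists d|].
change (Derive (fun x => f x) t) with (Derive f t); rewrite (is_derive_unique _ _ _ H); ring.
Qed.

(** [phi] is an angle about [p], whereas the integral needs one about [Lp p] in the chart. By
    [Lp_same_half_plane] it is enough to add an arctangent; this correction depends on the point and
    on the sine and cosine of [phi] only, so it returns to its initial value and the total change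
    remains [2 * PI]. *)
Lemma winding_contour (gamma : R -> R * R) (a b : R) (p : R * R) (phi : R -> R) :
  a < b -> piecewise_C1 gamma a b -> gamma a = gamma b -> halfplane p ->
  (forall t, a <= t <= b -> halfplane (gamma t)) ->
  (forall t, a <= t <= b -> continuous phi t) ->
  (forall t, a <= t <= b -> exists rho, 0 < rho /\
     gamma t = (fst p + rho * cos (phi t), snd p + rho * sin (phi t))) ->
  phi b = phi a + 2 * PI ->
  contour_integral (fun z => / (z - Lp p))%C gamma a b (2 * PI * Ci)%C.
Proof.
intros Hlt Hg Hab Hp Hh Hc Hpol H2pi.
pose (w1 := fun q : R * R => ln (fst q) - ln (fst p)); pose (w2 := fun q : R * R => snd q - snd p).
pose (psi := fun (q : R * R) f => f + atan ((w2 q * cos f - w1 q * sin f) / (w1 q * cos f + w2 q * sin f))).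
assert (HN : forall t, a <= t <= b -> 0 < w1 (gamma t) * cos (phi t) + w2 (gamma t) * sin (phi t)).
{ intros t Ht; specialize (Hh t Ht); destruct (Hpol t Ht) as (r & Hr & E); unfold w1, w2.
  unfold halfplane in Hh; rewrite E in *; simpl in *.
  replace (snd p + r * sin (phi t) - snd p) with (r * sin (phi t)) by ring.
  now apply Lp_same_half_plane. }
pose (W := fun t => (ln (w1 (gamma t) ^ 2 + w2 (gamma t) ^ 2) / 2, psi (gamma t) (phi t)) : C).
replace (2 * PI * Ci)%C with (W b - W a)%C.
2: { unfold W, psi; rewrite <- Hab, H2pi.
  rewrite cos_plus, sin_plus, cos_2PI, sin_2PI, !Rmult_1_r, !Rmult_0_r, Rminus_0_r, Rplus_0_r.
  unfold RtoC, Ci, Cminus, Cplus, Copp, Cmult; simpl; apply injective_projections; simpl; ring. }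
apply piecewise_contour_integral; trivial.
intros x y eta Heta Hx Hy Heq.
assert (HNe : forall t, x <= t <= y -> 0 < w1 (eta t) * cos (phi t) + w2 (eta t) * sin (phi t)).
{ intros t Ht; rewrite <- Heq by trivial; apply HN; lra. }
assert (Hpe : forall t, x <= t <= y -> 0 < fst (eta t)).
{ intros t Ht; rewrite <- Heq by trivial; apply Hh; lra. }
pose (u := fun t => w1 (eta t)); pose (v := fun t => w2 (eta t)).
unfold W; rewrite !Heq by lra.
apply (cint_ext (fun t => / (u t, v t) * dLp eta t)%C); [lra| |].
{ intros t _; do 2 f_equal; unfold u, v, w1, w2, Lp, Cminus, Cplus, Copp; simpl; f_equal; ring. }
apply (cint_inv_lift u v (fun t => fst (dLp eta t)) (fun t => snd (dLp eta t))
  (fun t => psi (eta t) (phi t))); [lra| |].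
- intros t Ht.
  destruct (rderiv_components _ _ _ (rderiv_Lp eta t Heta (Hpe t Ht))) as [H1 H2].
  assert (Hcd := rcont_dLp eta t Heta (Hpe t Ht)).
  assert (Hu : is_derive u t (fst (dLp eta t))).
  { exact (is_derive_sub_const _ _ _ (ln (fst p)) H1). }
  assert (Hv : is_derive v t (snd (dLp eta t))).
  { exact (is_derive_sub_const _ _ _ (snd p) H2). }
  split; [exact Hu|split; [exact Hv|split; [now apply rcont_fst|split; [now apply rcont_snd|]]]].
  assert (Cu : continuous u t) by (apply (ex_derive_continuous (V := R_NormedModule)); eexists; exact Hu).
  assert (Cv : continuous v t) by (apply (ex_derive_continuous (V := R_NormedModule)); eexists; exact Hv).
  assert (Cp : continuous phi t) by (apply Hc; lra).
  assert (Cc : continuous (fun s => cos (phi s)) t) by (apply (continuous_comp phi cos); [trivial|apply continuous_cos]).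
  assert (Cs : continuous (fun s => sin (phi s)) t) by (apply (continuous_comp phi sin); [trivial|apply continuous_sin]).
  unfold psi; apply (continuous_plus (V := R_NormedModule)); [exact Cp|].
  apply (continuous_comp (fun s => (v s * cos (phi s) - u s * sin (phi s)) / (u s * cos (phi s) + v s * sin (phi s))) atan);
    [|apply continuous_atan].
  apply (continuous_mult (K := R_AbsRing)).
  + apply (continuous_minus (V := R_NormedModule)); now apply (continuous_mult (K := R_AbsRing)).
  + apply continuous_Rinv_comp; [|specialize (HNe t Ht); unfold u, v; lra].
    apply (continuous_plus (V := R_NormedModule)); now apply (continuous_mult (K := R_AbsRing)).
- intros t Ht; exact (lift_in_half_plane _ _ _ (HNe t Ht)).
Qed.

Lemma full_turn (gamma : R -> R * R) (a b : R) (p : R * R) (phi : R -> R) :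
  a < b -> gamma a = gamma b ->
  (forall t, a <= t <= b -> continuous phi t) ->
  (forall t, a <= t <= b -> exists rho, 0 < rho /\
     gamma t = (fst p + rho * cos (phi t), snd p + rho * sin (phi t))) ->
  phi a < phi b ->
  (forall s t rho, a <= s < b -> a <= t < b -> 0 < rho ->
     gamma t = (fst p + rho * (fst (gamma s) - fst p), snd p + rho * (snd (gamma s) - snd p)) -> s = t) ->
  phi b = phi a + 2 * PI.
Proof.
intros Hlt Hab Hc Hpol Hinc Hray.
assert (HPI := PI_RGT_0).
destruct (Hpol a) as (ra & Hra & Ea); [lra|]; destruct (Hpol b) as (rb & Hrb & Eb); [lra|].
destruct (Rtotal_order (phi b) (phi a + 2 * PI)) as [Hl|[E|Hg]]; trivial; exfalso.
(* Equal end points have equal directions, so [sin d = 0] and [cos d > 0], impossible strictly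
   between 0 and [2 * PI]. *)
- pose (d := phi b - phi a).
  assert (Eq : ra * cos (phi a) = rb * cos (phi b) /\ ra * sin (phi a) = rb * sin (phi b)).
  { rewrite Hab, Eb in Ea; injection Ea; intros; lra. }
  destruct Eq as [E1 E2].
  assert (S0 : sin d = 0).
  { apply Rmult_eq_reg_l with (ra * rb); [|nra]; rewrite Rmult_0_r; unfold d; rewrite sin_minus.
    replace (ra * rb * (sin (phi b) * cos (phi a) - cos (phi b) * sin (phi a)))
      with ((rb * sin (phi b)) * (ra * cos (phi a)) - (rb * cos (phi b)) * (ra * sin (phi a))) by ring.
    rewrite E1, E2; ring. }
  assert (C0 : 0 < cos d).
  { apply Rmult_lt_reg_l with (ra * rb); [nra|]; rewrite Rmult_0_r; unfold d; rewrite cos_minus.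
    replace (ra * rb * (cos (phi b) * cos (phi a) + sin (phi b) * sin (phi a)))
      with ((rb * cos (phi b)) * (ra * cos (phi a)) + (rb * sin (phi b)) * (ra * sin (phi a))) by ring.
    rewrite <- E1, <- E2; assert (H := sin2_cos2 (phi a)); unfold Rsqr in H.
    replace (ra * cos (phi a) * (ra * cos (phi a)) + ra * sin (phi a) * (ra * sin (phi a)))
      with (ra * ra * (sin (phi a) * sin (phi a) + cos (phi a) * cos (phi a))) by ring.
    rewrite H; nra. }
  assert (Hd : 0 < d < 2 * PI) by (unfold d; lra).
  destruct (Rtotal_order d PI) as [H|[H|H]].
  + assert (0 < sin d) by (apply sin_gt_0; lra); lra.
  + rewrite H, cos_PI in C0; lra.
  + assert (sin d < 0) by (apply sin_lt_0; lra); lra.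
(* The angle would pass [phi a + 2 * PI] before the end, putting a second point of the curve on the
   ray through [gamma a]. *)
- destruct (Ranalysis5.IVT_interv (fun t => phi t - (phi a + 2 * PI)) a b) as (t & Ht & Et); trivial; try lra.
  { intros t Ht; apply continuity_pt_filterlim.
    apply (continuous_minus (V := R_NormedModule) phi (fun _ => phi a + 2 * PI));
      [now apply Hc|apply continuous_const]. }
  assert (Htb : t <> b) by (intros E; rewrite E in Et; lra).
  assert (Hta : t <> a) by (intros E; rewrite E in Et; lra).
  destruct (Hpol t Ht) as (rt & Hrt & Ept).
  apply Hta; symmetry; apply (Hray a t (rt / ra)); [lra|lra|now apply Rdiv_lt_0_compat|].
  replace (phi t) with (phi a + 2 * PI) in Ept by lra.
  rewrite cos_plus, sin_plus, cos_2PI, sin_2PI, !Rmult_1_r, !Rmult_0_r, Rminus_0_r, Rplus_0_r in Ept.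
  rewrite Ept, Ea; simpl; f_equal; field; lra.
Qed.

(** * Boundary points of a convex open set *)

Lemma convex_open_segment (Om : R * R -> Prop) (p q : R * R) (u : R) :
  open Om -> is_convex Om -> Om p -> boundary Om q -> 0 <= u < 1 -> Om (seg p q u).
Proof.
intros Ho Hc Hp Hq Hu; destruct (Ho p Hp) as [e He].
assert (Hr : 0 < e * (1 - u)) by (apply Rmult_lt_0_compat; [apply cond_pos|lra]).
destruct (proj1 (Hq _ (locally_ball q (mkposreal _ Hr)))) as (q' & [B1 B2] & Hq').
change (Rabs (fst q' - fst q) < e * (1 - u)) in B1.
change (Rabs (snd q' - snd q) < e * (1 - u)) in B2.
(* The boundary point [q] is replaced by a nearby [q'] of [Om], and [p] is moved to [p'] so that the
   point with ratio [u] does not change. With [q'] within [e * (1 - u)] of [q], the point [p'] stays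
   in the ball of radius [e]. *)
pose (p' := (fst p + u / (1 - u) * (fst q - fst q'), snd p + u / (1 - u) * (snd q - snd q'))).
assert (Hsmall : forall r, Rabs r < e * (1 - u) -> Rabs (u / (1 - u) * r) < e).
{ intros r Hrr; rewrite Rabs_mult, Rabs_pos_eq by (apply Rdiv_le_0_compat; lra).
  assert (H0 := Rabs_pos r).
  apply Rmult_lt_reg_r with (1 - u); [lra|].
  replace (u / (1 - u) * Rabs r * (1 - u)) with (u * Rabs r) by (field; lra); nra. }
assert (Hp' : Om p').
{ apply He; split.
  - change (Rabs (fst p' - fst p) < e); unfold p'; simpl.
    replace (fst p + u / (1 - u) * (fst q - fst q') - fst p) with (u / (1 - u) * (fst q - fst q')) by ring.
    apply Hsmall; rewrite Rabs_minus_sym; exact B1.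
  - change (Rabs (snd p' - snd p) < e); unfold p'; simpl.
    replace (snd p + u / (1 - u) * (snd q - snd q') - snd p) with (u / (1 - u) * (snd q - snd q')) by ring.
    apply Hsmall; rewrite Rabs_minus_sym; exact B2. }
replace (seg p q u) with ((1 - u) * fst p' + u * fst q', (1 - u) * snd p' + u * snd q');
  [apply Hc; trivial; lra|].
unfold seg, p'; simpl; f_equal; field; lra.
Qed.

Lemma boundary_not_in_open (Om : R * R -> Prop) (q : R * R) : open Om -> boundary Om q -> ~ Om q.
Proof.
intros Ho Hb Hq; destruct (proj2 (Hb Om (Ho q Hq))) as (q' & H1 & H2); auto.
Qed.

(** The nearer of two distinct boundary points on a ray would lie on the half-open segment to the
    farther one, hence in [Om], but an open set contains none of its boundary. *)
Lemma boundary_ray_unique (Om : R * R -> Prop) (p q q' : R * R) (rho : R) :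
  open Om -> is_convex Om -> Om p -> boundary Om q -> boundary Om q' -> 0 < rho ->
  q' = (fst p + rho * (fst q - fst p), snd p + rho * (snd q - snd p)) -> q = q'.
Proof.
intros Ho Hc Hp Hq Hq' Hr E.
destruct (Rtotal_order rho 1) as [H|[H|H]].
- exfalso; apply (boundary_not_in_open Om q' Ho Hq').
  replace q' with (seg p q rho); [apply convex_open_segment; trivial; lra|].
  rewrite E; unfold seg; f_equal; ring.
- rewrite E, H; destruct q as [q1 q2]; simpl; f_equal; ring.
- exfalso; apply (boundary_not_in_open Om q Ho Hq).
  replace q with (seg p q' (/ rho)).
  + apply convex_open_segment; trivial; split; [left; now apply Rinv_0_lt_compat|].
    rewrite <- Rinv_1; apply Rinv_lt_contravar; lra.
  + rewrite E; destruct q as [q1 q2]; unfold seg; simpl; f_equal; field; lra.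
Qed.

(** * The residue theorem *)

Lemma cderiv_inv_sub_pow (z0 z : C) (n : nat) : z <> z0 ->
  cderiv (fun z => (/ (z - z0)) ^ n)%C z (- RtoC (INR n) * (/ (z - z0)) ^ S n).
Proof.
intros Hz; assert (Hz' := Cminus_neq_0 _ _ Hz).
induction n as [|n IH].
- eapply cderiv_eq; [apply (cderiv_const 1)|simpl; ring].
- eapply cderiv_eq.
  + apply (cderiv_mult (fun z => / (z - z0))%C (fun z => (/ (z - z0)) ^ n)%C);
      [now apply cderiv_inv_sub|exact IH].
  + rewrite S_INR, RtoC_plus; simpl; ring.
Qed.

(** From exponent 2 on, negative powers have a single-valued primitive off [z0]. *)
Lemma contour_power_zero (gamma : R -> R * R) (a b : R) (z0 : C) (n : nat) :
  piecewise_C1 gamma a b -> gamma a = gamma b ->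
  (forall t, a <= t <= b -> halfplane (gamma t)) ->
  (forall t, a <= t <= b -> Lp (gamma t) <> z0) ->
  contour_integral (fun z => (/ (z - z0)) ^ S (S n))%C gamma a b 0.
Proof.
intros Hg Hab Hh Hz.
pose (P := fun z => (- / RtoC (INR (S n)) * (/ (z - z0)) ^ S n)%C).
assert (Hn : RtoC (INR (S n)) <> 0) by (intros E; apply RtoC_inj in E; now apply (not_0_INR (S n))).
replace (RtoC 0) with (P (Lp (gamma b)) - P (Lp (gamma a)))%C by (rewrite Hab; ring).
apply contour_integral_primitive; trivial; intros t Ht; specialize (Hz t Ht); split.
- eexists; now apply cderiv_inv_sub_pow.
- eapply cderiv_eq.
  + apply cderiv_mult; [apply cderiv_const|now apply cderiv_inv_sub_pow].
  + rewrite Cmult_0_l, Cplus_0_l; generalize ((/ (Lp (gamma t) - z0)) ^ S (S n))%C; intros w.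
    field; exact Hn.
Qed.

Lemma Lp_inj (p q : R * R) : halfplane p -> halfplane q -> Lp p = Lp q -> p = q.
Proof. intros Hp Hq E; rewrite <- (Ep_Lp p Hp), E; now apply Ep_Lp. Qed.

(* Subtracting principal parts one pole at a time leaves a function holomorphic on the
   star-shaped closed region, whose integral vanishes. *)
Lemma contour_sum (gamma : R -> R * R) (a b : R) (p0 : R * R) (v : R * R -> C) :
  a < b -> piecewise_C1 gamma a b -> gamma a = gamma b -> halfplane p0 ->
  (forall t, a <= t <= b -> halfplane (gamma t)) ->
  forall (ps : list (R * R)) (F : C -> C), NoDup ps ->
  (forall p, In p ps -> halfplane p /\ forall t, a <= t <= b -> Lp (gamma t) <> Lp p) ->
  (forall u t, 0 <= u <= 1 -> a <= t <= b -> ~ In (Lp (seg p0 (gamma t) u)) (map Lp ps) ->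
     cdiff F (Lp (seg p0 (gamma t) u))) ->
  (forall p, In p ps -> exists (Q Rm : C -> C) (r : R), 0 < r /\
     contour_integral Q gamma a b (2 * PI * Ci * v p)%C /\
     (forall z, z <> Lp p -> cdiff Q z) /\
     (forall z, Cmod (z - Lp p) < r -> cdiff Rm z) /\
     (forall z, Cmod (z - Lp p) < r -> z <> Lp p -> F z = (Q z + Rm z)%C)) ->
  contour_integral F gamma a b (2 * PI * Ci * fold_right Cplus (RtoC 0) (map v ps))%C.
Proof.
intros Hlt Hg Hab Hp0 Hh; induction ps as [|p ps IH]; intros F Hnd Hps HF Hloc.
- simpl; rewrite Cmult_0_r; apply (star_cauchy F gamma a b p0); trivial.
  intros u t Hu Ht; apply HF; simpl; auto.
- inversion_clear Hnd as [|? ? Hnin Hnd'].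
  destruct (Hloc p (or_introl eq_refl)) as (Q & Rm & r & Hr & HQ & HQd & HRd & Heq).
  destruct (Hps p (or_introl eq_refl)) as [Hp Htr].
  set (z0 := Lp p) in *.
  (* Off [z0] the difference [F - Q] equals the regular part [Rm] near the pole; giving it the value
     [Rm z0] at [z0] removes the singularity. *)
  pose (F1 := fun z => if excluded_middle_informative (z = z0) then Rm z0 else (F z + - (1) * Q z)%C).
  assert (HF1 : forall z, z <> z0 -> F1 z = (F z + - (1) * Q z)%C).
  { intros z Hz; unfold F1; now destruct (excluded_middle_informative (z = z0)). }
  assert (HF1z : F1 z0 = Rm z0).
  { unfold F1; now destruct (excluded_middle_informative (z0 = z0)). }
  assert (Hneg : forall z, z <> z0 -> cdiff (fun z => - (1) * Q z)%C z).
  { intros z Hz; destruct (HQd z Hz) as [m Hm]; eexists; apply cderiv_mult; [apply cderiv_const|exact Hm]. }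
  assert (I1 : contour_integral F1 gamma a b (2 * PI * Ci * fold_right Cplus (RtoC 0) (map v ps))%C).
  { apply IH; trivial.
    - intros q Hq; apply Hps; now right.
    - intros u t Hu Ht Hn; set (z := Lp (seg p0 (gamma t) u)) in *.
      destruct (classic (z = z0)) as [E|Hne].
      + apply (cdiff_ext Rm) with (d := r); [trivial| |].
        * rewrite E; intros w Hw; destruct (classic (w = z0)) as [->|Hw0]; [now rewrite HF1z|].
          rewrite HF1, Heq by trivial; ring.
        * apply HRd; rewrite E; replace (z0 - z0)%C with (RtoC 0) by ring; now rewrite Cmod_0.
      + apply (cdiff_ext (fun z => F z + - (1) * Q z)%C) with (d := Cmod (z - z0)).
        * now apply Cmod_gt_0, Cminus_neq_0.
        * intros w Hw; symmetry; apply HF1; intros ->; rewrite Cmod_minus_sym in Hw; lra.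
        * destruct (HF u t Hu Ht) as [l Hl].
          { simpl; intros [E|Hin]; [now apply Hne|now apply Hn]. }
          destruct (Hneg z Hne) as [m Hm]; eexists; apply cderiv_plus; [exact Hl|exact Hm].
    - intros q Hq; destruct (Hloc q (or_intror Hq)) as (Q' & R' & r' & Hr' & HQ' & HQd' & HRd' & Heq').
      destruct (Hps q (or_intror Hq)) as [Hqh _].
      assert (Hqp : Lp q <> z0).
      { intros E; apply Hnin; now rewrite <- (Lp_inj q p Hqh Hp E). }
      (* At another pole the subtraction of [Q] affects the regular part only, on a disc small
         enough to avoid [z0]. *)
      exists Q', (fun z => R' z + - (1) * Q z)%C, (Rmin r' (Cmod (Lp q - z0))).
      assert (M1 := Rmin_l r' (Cmod (Lp q - z0))); assert (M2 := Rmin_r r' (Cmod (Lp q - z0))).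
      assert (Hne : forall z, Cmod (z - Lp q) < Rmin r' (Cmod (Lp q - z0)) -> z <> z0).
      { intros z Hz E; rewrite E, Cmod_minus_sym in Hz; lra. }
      split; [apply Rmin_glb_lt; [trivial|now apply Cmod_gt_0, Cminus_neq_0]|].
      split; [trivial|split; [trivial|split]].
      + intros z Hz; destruct (HRd' z) as [l Hl]; [lra|].
        destruct (Hneg z (Hne z Hz)) as [m Hm]; eexists; apply cderiv_plus; [exact Hl|exact Hm].
      + intros z Hz Hzq; rewrite HF1 by auto; rewrite Heq' by (trivial; lra); ring. }
  simpl; replace (2 * PI * Ci * (v p + fold_right Cplus 0 (map v ps)))%C with
    (2 * PI * Ci * fold_right Cplus 0 (map v ps) + 2 * PI * Ci * v p)%C by ring.
  apply (cint_ext (fun t => F1 (Lp (gamma t)) * dLp gamma t + Q (Lp (gamma t)) * dLp gamma t)%C); [lra| |].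
  + intros t Ht; rewrite HF1 by (apply Htr; lra); ring.
  + now apply cint_plus.
Qed.

(** [e^(i theta) (dr + i r dtheta)] is [r e^(i theta)] times [dr / r + i dtheta]; the extracted
    factor raises the exponent from [c - 1] to [c]. *)
Lemma polar_integrand_Lp (c : R) (f : R * R -> C) (gamma : R -> R * R) (t : R) :
  halfplane (gamma t) ->
  (polar_pow (c - 1) (gamma t) * f (gamma t) * cis (snd (gamma t)) *
     (RtoC (Derive (fun s => fst (gamma s)) t) +
      Ci * RtoC (fst (gamma t)) * RtoC (Derive (fun s => snd (gamma s)) t)))%C
  = (cexp (RtoC c * Lp (gamma t)) * f (Ep (Lp (gamma t))) * dLp gamma t)%C.
Proof.
intros Hh; rewrite Ep_Lp by trivial.
assert (Hr : RtoC (fst (gamma t)) <> 0).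
{ intros E; apply RtoC_inj in E; unfold halfplane in Hh; lra. }
assert (E1 : (polar_pow (c - 1) (gamma t) * (RtoC (fst (gamma t)) * cis (snd (gamma t))))%C
  = cexp (RtoC c * Lp (gamma t))).
{ rewrite <- (Ep_Lp (gamma t) Hh) at 1; rewrite polar_pow_Ep.
  replace (RtoC (fst (gamma t)) * cis (snd (gamma t)))%C with (cexp (Lp (gamma t))).
  - rewrite <- cexp_plus; f_equal; rewrite RtoC_minus; ring.
  - unfold cexp, Lp; simpl; now rewrite exp_ln. }
rewrite <- E1.
replace (dLp gamma t) with (RtoC (Derive (fun s => fst (gamma s)) t) / RtoC (fst (gamma t))
  + Ci * RtoC (Derive (fun s => snd (gamma s)) t))%C.
- field; exact Hr.
- unfold dLp; unfold halfplane in Hh; unfold Cdiv; rewrite <- RtoC_inv, <- RtoC_mult by lra.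
  unfold RtoC, Ci, Cplus, Cmult; simpl; f_equal; unfold Rdiv; ring.
Qed.

Theorem theorem5 :
  forall (D : R * R -> Prop) (f : R * R -> C) (S : R * R -> Prop)
         (gamma : R -> R * R) (a b : R) (Om : R * R -> Prop)
         (poles : list (R * R)) (c : R),
    is_domain D -> is_convex D ->
    (forall p, S p -> D p) ->
    polar_analytic (fun p => D p /\ ~ S p) f ->
    (forall p, S p -> log_pole f p) ->
    closed_regular_curve gamma a b ->
    (forall p, trace gamma a b p -> D p) ->
    is_domain Om -> is_convex Om ->
    (forall p, Om p -> D p) ->
    (forall p, boundary Om p <-> trace gamma a b p) ->
    counterclockwise gamma a b Om ->
    (forall p, S p -> ~ trace gamma a b p) ->
    NoDup poles ->
    (forall p, In p poles <-> S p /\ Om p) ->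
    is_polar_integral (fun p => polar_pow (c - 1) p * f p)%C gamma a b
      (RtoC (2 * PI) * Ci * fold_right Cplus (RtoC 0) (map (residue c f) poles))%C.
Proof.
intros D f S gamma a b Om poles c HD _ HSD Hf HS Hgam HtrD HOm HOmc HOmD Hbd Hccw HStr Hnd Hpoles.
destruct Hgam as (Hlt & Hpw & Hab & Hsimple).
destruct HOm as ((p0 & Hp0) & HOmo & _ & HOmh).
destruct HD as (_ & _ & _ & HDh).
assert (Htr : forall t, a <= t <= b -> trace gamma a b (gamma t)) by (intros t Ht; now exists t).
assert (Hh : forall t, a <= t <= b -> halfplane (gamma t)) by auto.
assert (Hb : forall t, a <= t <= b -> boundary Om (gamma t)) by (intros t Ht; apply Hbd; auto).
assert (Hoff : forall p, In p poles -> halfplane p /\ forall t, a <= t <= b -> Lp (gamma t) <> Lp p).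
{ intros p Hp; apply Hpoles in Hp; destruct Hp as [HSp HOp]; split; [auto|].
  intros t Ht E; apply (HStr p HSp); apply Lp_inj in E; auto; rewrite <- E; auto. }
rewrite RtoC_mult.
apply (cint_ext (fun t => cexp (RtoC c * Lp (gamma t)) * f (Ep (Lp (gamma t))) * dLp gamma t)%C); [lra| |].
{ intros t Ht; symmetry; apply polar_integrand_Lp, Hh; lra. }
apply (contour_sum gamma a b p0 (residue c f) Hlt Hpw Hab (HOmh p0 Hp0) Hh poles
  (fun z => cexp (RtoC c * z) * f (Ep z))%C); trivial.
- intros u t Hu Ht Hn.
  assert (HSg : halfplane (seg p0 (gamma t) u)).
  { assert (H1 := Hh t Ht); assert (H2 := HOmh p0 Hp0); unfold halfplane, seg in *; simpl.
    destruct (Rle_lt_or_eq_dec u 1) as [Hu1| ->]; [lra| |lra].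
    assert (0 < (1 - u) * fst p0) by (apply Rmult_lt_0_compat; lra).
    assert (0 <= u * fst (gamma t)) by (apply Rmult_le_pos; lra); lra. }
  assert (HDS : D (seg p0 (gamma t) u) /\ ~ S (seg p0 (gamma t) u)).
  (* For [u < 1] the point is in [Om], where every singularity is a listed pole; for [u = 1] it is
     on [gamma], which carries no singularity. *)
  { destruct (Rle_lt_or_eq_dec u 1) as [Hu1| ->]; [lra| |].
    - assert (HO : Om (seg p0 (gamma t) u)) by (apply convex_open_segment; auto; lra).
      split; [auto|]; intros HSq; apply Hn, in_map, Hpoles; auto.
    - replace (seg p0 (gamma t) 1) with (gamma t)
        by (unfold seg; destruct (gamma t); simpl; f_equal; ring).
      split; [auto|]; intros HSq; exact (HStr _ HSq (Htr t Ht)). }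
  destruct (polar_analytic_cdiff _ f (Lp (seg p0 (gamma t) u)) Hf) as [l Hl]; [now rewrite Ep_Lp|].
  eexists; apply cderiv_mult; [apply cderiv_cexp_scal|exact Hl].
- intros p Hp; destruct (Hoff p Hp) as [Hph Hne].
  destruct (proj1 (Hpoles p) Hp) as [HSp HOp].
  destruct (residue_correct c f p (HS p HSp)) as (k & g & Hg & ->).
  destruct (log_pole_chart f p k g c Hg) as (_ & Hk & _ & -> & r & Hr & HG & HGf).
  destruct (Hccw p HOp) as (phi & Hphi & Hpol & Hinc).
  assert (H2pi : phi b = phi a + 2 * PI).
  { apply (full_turn gamma a b p phi); trivial.
    intros s t rho Hs Ht Hrho E; apply Hsimple; trivial.
    apply (boundary_ray_unique Om p (gamma s) (gamma t) rho); trivial; apply Hb; lra. }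
  (* The order [k] is at least 1, and [principal_part] treats a pole of order [k - 1] plus one, so
     its coefficient is the derivative of order [k - 1] in the residue. *)
  destruct (principal_part (fun Q v => contour_integral Q gamma a b (2 * PI * Ci * v)%C) (Lp p))
    with (k := (k - 1)%nat) (G := fun z => (cexp (RtoC c * z) * g (Ep z))%C) (r := r)
    as (Q & Rm & H1 & H2 & H3 & H4); trivial.
  + intros F G u v HF HG'; rewrite Cmult_plus_distr_l.
    apply (cint_ext (fun t => F (Lp (gamma t)) * dLp gamma t + G (Lp (gamma t)) * dLp gamma t)%C); [lra| |].
    * intros t _; ring.
    * now apply cint_plus.
  + intros q F v HF; replace (2 * PI * Ci * (q * v))%C with (q * (2 * PI * Ci * v))%C by ring.
    apply (cint_ext (fun t => q * (F (Lp (gamma t)) * dLp gamma t))%C); [lra| |].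
    * intros t _; ring.
    * now apply cint_mult_l.
  + rewrite Cmult_1_r; now apply (winding_contour gamma a b p phi).
  + intros n; rewrite Cmult_0_r; now apply contour_power_zero.
  + exists Q, Rm, r; split; [trivial|split; [exact H1|split; [trivial|split; [trivial|]]]].
    intros z Hz Hzp; rewrite HGf by trivial; rewrite <- H4 by trivial.
    now replace (Datatypes.S (k - 1)) with k by lia.
Qed.
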